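(* Let $x^*\in\mathcal M$ be an index-$k$ saddle point and let $\delta>0$, $L>\mu>0$ be such that for every $x\in\mathcal M$ with $d(x,x^* )<\delta$ the eigenvalues of $\operatorname{Hess}f(x)$ satisfy $$-L\le\lambda_1\le\cdots\le\lambda_k\le-\mu<0<\mu\le\lambda_{k+1}\le\cdots\le\lambda_{d-m}\le L .$$ Let $R^*=I-2\sum_{i=1}^kv_i^*(v_i^* )^\top$ on $T_{x^*}\mathcal M$, where $v_1^*,\dots,v_k^*$ are orthonormal eigenvectors of $\operatorname{Hess}f(x^* )$ for its $k$ negative eigenvalues. Let $0<\Delta t<\frac1{2L}$ and $0<\gamma<1$. (1) The Euler discretization of the constrained saddle dynamics, $$\begin{aligned}x_{n+1}&=\mathrm{Ret}_{x_n}(-\Delta t\,R_n\operatorname{grad}f(x_n)),\\ \bar R_{n+1}&=R_n+\Delta t\big(\operatorname{Hess}f(x_n)-R_n\operatorname{Hess}f(x_n)R_n\big),\\ \hat R_{n+1}&=\mathrm{Orth}_{x_n}(\bar R_{n+1}),\qquad R_{n+1}=P_{x_n\to x_{n+1}}\circ\hat R_{n+1}\circ P_{x_{n+1}\to x_n},\end{aligned}$$ is locally contractive (and hence asymptotically linearly stable) at $(x^*,R^* )$. (2) The Euler discretization of the momentum-based constrained saddle dynamics, $$\begin{aligned}\bar r_n&=-\Delta t\,R_n\operatorname{grad}f(x_n)+\gamma r_n,\qquad x_{n+1}=\mathrm{Ret}_{x_n}(\bar r_n),\qquad r_{n+1}=P_{x_n\to x_{n+1}}\bar r_n,\\ \bar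 R_{n+1}&=R_n+\Delta t\big(\operatorname{Hess}f(x_n)-R_n\operatorname{Hess}f(x_n)R_n\big),\\ \hat R_{n+1}&=\mathrm{Orth}_{x_n}(\bar R_{n+1}),\qquad R_{n+1}=P_{x_n\to x_{n+1}}\circ\hat R_{n+1}\circ P_{x_{n+1}\to x_n},\end{aligned}$$ is locally contractive at $(x^*,0,R^* )$.
   Context: Let $f:\mathbb{R}^d\to\mathbb{R}$ and $c_1,\dots,c_m:\mathbb{R}^d\to\mathbb{R}$ be smooth, $\mathcal M=\{x\in\mathbb{R}^d:c_1(x)=\dots=c_m(x)=0\}$, with $\nabla c_1(x),\dots,\nabla c_m(x)$ linearly independent for every $x\in\mathcal M$. $\mathcal M$ carries the Riemannian metric induced from $\mathbb{R}^d$, with geodesic distance $d(\cdot,\cdot)$ and Riemannian gradient and Hessian $\operatorname{grad}f$, $\operatorname{Hess}f$. $P_{x\to y}:T_x\mathcal M\to T_y\mathcal M$ denotes parallel transport along the (short) geodesic between nearby points. An index-$k$ saddle point is a point with $\operatorname{grad}f(x^* )=0$ such that $\operatorname{Hess}f(x^* )$ has exactly $k$ negative eigenvalues; $1\le k\le d-m-1$. $\mathrm{Ret}$ is a smooth retraction: $\mathrm{Ret}_x:T_x\mathcal M\to\mathcal M$ with $\mathrm{Ret}_x(0)=x$ and $\frac{d}{dt}|_{t=0}\mathrm{Ret}_x(t\eta)=\eta$ for all $\eta\in T_x\mathcal M$. $R_n$ is a self-adjoint operator on $T_{x_n}\mathcal M$ and $r_n\in T_{x_n}\mathcal M$. For a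 self-adjoint operator $\bar R=V\Sigma V^\top$ on $T_x\mathcal M$ (orthogonal eigendecomposition, eigenvalues in increasing order, with a gap between the $k$-th and $(k+1)$-st), $\mathrm{Orth}_x(\bar R)=V\operatorname{diag}(\underbrace{-1,\dots,-1}_k,1,\dots,1)V^\top$. Each scheme is the iteration of a map $(x_n,R_n)\mapsto(x_{n+1},R_{n+1})$, respectively $(x_n,r_n,R_n)\mapsto(x_{n+1},r_{n+1},R_{n+1})$, near the indicated point. It is viewed in local coordinates by expressing $x$ through $\exp_{x^*}^{-1}(x)\in T_{x^*}\mathcal M$ and transporting $r$ and $R$ to $T_{x^*}\mathcal M$ by parallel transport. Locally contractive at a point means that the point is a fixed point of the map and the spectral radius of the Jacobian of the map there is strictly less than $1$. *)

(* Defs.v *)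
From HB Require Import structures.
From mathcomp Require Import all_boot all_order all_algebra.
From mathcomp Require Import all_classical all_reals all_analysis.
From mathcomp Require Import complex.

Set Implicit Arguments.
Unset Strict Implicit.
Unset Printing Implicit Defensive.

Import Order.TTheory GRing.Theory Num.Theory.
Import numFieldNormedType.Exports.

Local Open Scope classical_set_scope.
Local Open Scope ring_scope.

(* Vectors of R^d are row vectors, and an operator is a matrix A acting by
   u |-> u *m A, so that a composite is written from left to right.  The
   library norm of 'rV[R]_d is the sup norm; the Riemannian metric is the
   Euclidean inner product, whence [enorm]. *)

Section Smooth.
Context {R : realType} {V W : normedModType R}.

(* C^(n+1) on the open set U: differentiable, with all directional derivatives
   of class C^n. *)
Fixpoint Ck_on (n : nat) (U : set V) (f : V -> W) : Prop :=
  match n with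
  | 0%N => forall x, U x -> {for x, continuous f}
  | n'.+1 => (forall x, U x -> differentiable f x) /\
             forall v, Ck_on n' U ('D_v f)
  end.

Definition smooth (f : V -> W) : Prop := forall n, Ck_on n setT f.

(* Smoothness on an arbitrary subset of V: f extends, near each point of A, to
   a C^oo map on an open set; f itself is irrelevant outside A. *)
Definition smooth_on (A : set V) (f : V -> W) : Prop :=
  forall x, A x -> exists (U : set V) (g : V -> W),
    [/\ open U, U x, forall n, Ck_on n U g &
        forall y, U y -> A y -> f y = g y].

End Smooth.

Definition enorm (R : realType) (d : nat) (v : 'rV[R]_d) : R :=
  Num.sqrt ((v *m v^T) 0 0).

Definition egrad (R : realType) (d : nat) (f : 'rV[R]_d -> R)
    (x : 'rV[R]_d) : 'rV[R]_d :=
  \row_j 'D_(delta_mx 0 j) f x.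

Section Manifold.
Context {R : realType} {d m : nat}.
Variable c : 'I_m -> 'rV[R]_d -> R.
Implicit Types (x y u v w : 'rV[R]_d) (g X : R -> 'rV[R]_d).

Definition mfd : set 'rV[R]_d := [set x | forall i, c i x = 0].

Definition cgrad x : 'M[R]_(m, d) := \matrix_(i < m) egrad (c i) x.

Definition licq : Prop := forall x, mfd x -> row_free (cgrad x).

Definition tangent x : set 'rV[R]_d := [set v | v *m (cgrad x)^T = 0].

Definition normal x : set 'rV[R]_d := [set v | (v <= cgrad x)%MS].

Definition tangent_bundle : set ('rV[R]_d * 'rV[R]_d) :=
  [set p | mfd p.1 /\ tangent p.1 p.2].

(* Orthogonal projection onto the tangent space.  It is meaningful on the open
   set where the constraint gradients are independent, so that it may be
   differentiated there. *)
Definition tproj x : 'M[R]_d :=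
  1%:M - (cgrad x)^T *m invmx (cgrad x *m (cgrad x)^T) *m cgrad x.

Definition rgrad (f : 'rV[R]_d -> R) x : 'rV[R]_d := egrad f x *m tproj x.

(* Hess f(x)[u] is the tangential part of the derivative of [rgrad f] along u
   (Levi-Civita connection of the induced metric), extended by 0 to the normal
   space. *)
Definition rhess (f : 'rV[R]_d -> R) x : 'M[R]_d :=
  tproj x *m 'J (rgrad f) x *m tproj x.

(* Curves are parametrised by [0, 1] and required to be regular on a slightly
   larger open interval, which gives derivatives at the endpoints. *)
Definition near01 (P : R -> Prop) : Prop :=
  exists2 e : R, 0 < e & forall t : R, - e < t < 1 + e -> P t.

Definition C1_curve x y : set (R -> 'rV[R]_d) :=
  [set g | [/\ g 0 = x, g 1 = y &
     near01 (fun t => [/\ mfd (g t), derivable g t 1 &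
                         {for t, continuous (derive1 g)}])]].

Definition curve_length g : \bar R :=
  (\int[lebesgue_measure]_(t in `[0%R, 1%R]) (enorm (derive1 g t))%:E)%E.

(* +oo when x and y are not joined by a curve. *)
Definition geodist x y : \bar R :=
  ereal_inf [set curve_length g | g in C1_curve x y].

(* Zero covariant acceleration: g'' is normal to the manifold. *)
Definition geodesic g : Prop :=
  near01 (fun t => [/\ mfd (g t), derivable g t 1, derivable (derive1 g) t 1 &
                      normal (g t) (derive1 (derive1 g) t)]).

(* A shortest one among the geodesics joining x to y. *)
Definition short_geodesic x y g : Prop :=
  [/\ geodesic g, g 0 = x, g 1 = y &
      forall h, geodesic h -> h 0 = x -> h 1 = y ->
        (curve_length g <= curve_length h)%E].

Definition exp_map x v : 'rV[R]_d :=
  xget x [set y | exists g, [/\ geodesic g, g 0 = x, derive1 g 0 = v & g 1 = y]].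

(* The branch of the inverse of [exp_map x] that vanishes at x. *)
Definition exp_inv x y : 'rV[R]_d :=
  xget 0 [set v | [/\ tangent x v, exp_map x v = y &
     forall w, tangent x w -> exp_map x w = y -> enorm v <= enorm w]].

(* Tangent field with zero covariant derivative along g. *)
Definition parallel_along g X : Prop :=
  near01 (fun t => [/\ tangent (g t) (X t), derivable X t 1 &
                      normal (g t) (derive1 X t)]).

Definition ptrans x y w : 'rV[R]_d :=
  xget 0 [set w' | exists g X,
     [/\ short_geodesic x y g, parallel_along g X, X 0 = w & X 1 = w']].

(* Matrix of [ptrans x y] on the tangent space at x, extended by 0 to the
   normal space. *)
Definition ptransmx x y : 'M[R]_d := lin1_mx (fun v => ptrans x y (v *m tproj x)).

(* P_{x -> y} o A o P_{y -> x} *)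
Definition op_ptrans x y (A : 'M[R]_d) : 'M[R]_d :=
  ptransmx y x *m A *m ptransmx x y.

(* The rows of V form an orthonormal eigenbasis of the tangent space for the
   operator A, with eigenvalues s in increasing order. *)
Definition eigendecomp x (A : 'M[R]_d) (V : 'M[R]_(d - m, d))
    (s : 'rV[R]_(d - m)) : Prop :=
  [/\ V *m V^T = 1%:M, V *m (cgrad x)^T = 0, A = V^T *m diag_mx s *m V &
      forall i j : 'I_(d - m), (i <= j)%N -> s 0 i <= s 0 j].

Definition ordered_eigenvalues x (A : 'M[R]_d) (s : 'rV[R]_(d - m)) : Prop :=
  exists V, eigendecomp x A V s.

Definition index_saddle (f : 'rV[R]_d -> R) (k : nat) x : Prop :=
  [/\ mfd x, rgrad f x = 0 &
      exists2 s, ordered_eigenvalues x (rhess f x) s &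
                 #|[set i | s 0 i < 0]%SET| = k].

Definition orth (k : nat) x (A : 'M[R]_d) : 'M[R]_d :=
  xget 0 [set B | exists V s,
    [/\ eigendecomp x A V s,
        forall i j : 'I_(d - m), (i < k)%N -> (k <= j)%N -> s 0 i < s 0 j &
        B = V^T *m diag_mx (\row_i (if (i < k)%N then -1 else 1)) *m V]].

Definition smooth_retraction (Ret : 'rV[R]_d -> 'rV[R]_d -> 'rV[R]_d) : Prop :=
  [/\ forall x v, mfd x -> tangent x v -> mfd (Ret x v),
      forall x, mfd x -> Ret x 0 = x,
      forall x v, mfd x -> tangent x v ->
        is_derive (0 : R) (1 : R) (fun t : R => Ret x (t *: v)) v &
      smooth_on tangent_bundle (fun p => Ret p.1 p.2)].

Section Schemes.
Variables (f : 'rV[R]_d -> R) (Ret : 'rV[R]_d -> 'rV[R]_d -> 'rV[R]_d).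
Variables (k : nat) (dt gamma : R).

Definition R_update (x : 'rV[R]_d) (A : 'M[R]_d) (x' : 'rV[R]_d) : 'M[R]_d :=
  let Abar := A + dt *: (rhess f x - A *m rhess f x *m A) in
  op_ptrans x x' (orth k x Abar).

Definition csd_step (z : 'rV[R]_d * 'M[R]_d) : 'rV[R]_d * 'M[R]_d :=
  let: (x, A) := z in
  let x' := Ret x (- dt *: (rgrad f x *m A)) in
  (x', R_update x A x').

Definition mcsd_step (z : 'rV[R]_d * 'rV[R]_d * 'M[R]_d) :
    'rV[R]_d * 'rV[R]_d * 'M[R]_d :=
  let: (x, r, A) := z in
  let rbar := - dt *: (rgrad f x *m A) + gamma *: r in
  let x' := Ret x rbar in
  (x', rbar *m ptransmx x x', R_update x A x').

End Schemes.

(* Local coordinates at x0.  A self-adjoint operator on the tangent space is a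
   symmetric matrix S with S *m (cgrad x0)^T = 0. *)

Definition csd_chart x0 (z : 'rV[R]_d * 'M[R]_d) : 'rV[R]_d * 'M[R]_d :=
  let x := exp_map x0 z.1 in (x, op_ptrans x0 x z.2).

Definition csd_coords x0 (z : 'rV[R]_d * 'M[R]_d) : 'rV[R]_d * 'M[R]_d :=
  (exp_inv x0 z.1, op_ptrans z.1 x0 z.2).

Definition csd_space x0 : {vspace 'rV[R]_d * 'M[R]_d} :=
  lker (linfun (fun z : 'rV[R]_d * 'M[R]_d =>
    (z.1 *m (cgrad x0)^T, z.2 *m (cgrad x0)^T, z.2 - z.2^T))).

Definition mcsd_chart x0 (z : 'rV[R]_d * 'rV[R]_d * 'M[R]_d) :
    'rV[R]_d * 'rV[R]_d * 'M[R]_d :=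
  let x := exp_map x0 z.1.1 in
  (x, z.1.2 *m ptransmx x0 x, op_ptrans x0 x z.2).

Definition mcsd_coords x0 (z : 'rV[R]_d * 'rV[R]_d * 'M[R]_d) :
    'rV[R]_d * 'rV[R]_d * 'M[R]_d :=
  (exp_inv x0 z.1.1, z.1.2 *m ptransmx z.1.1 x0, op_ptrans z.1.1 x0 z.2).

Definition mcsd_space x0 : {vspace 'rV[R]_d * 'rV[R]_d * 'M[R]_d} :=
  lker (linfun (fun z : 'rV[R]_d * 'rV[R]_d * 'M[R]_d =>
    (z.1.1 *m (cgrad x0)^T, z.1.2 *m (cgrad x0)^T,
     z.2 *m (cgrad x0)^T, z.2 - z.2^T))).

End Manifold.

Definition spectral_radius (R : realType) (n : nat) (A : 'M[R]_n) : R :=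
  sup [set complex.Re `|l| |
        l in [set l : R[i] | eigenvalue (map_mx (real_complex R) A) l]].

(* A map [step] is read in the coordinates given by [chart] (coordinates to
   states) and [coords] (states to coordinates), the coordinates ranging over
   the vector space E, and then in a basis of E, which turns it into a map of
   R^(dim E) near the image of the point under study. *)
Section LocalCoordinates.
Context {R : realType} {W : vectType R}.
Variables (E : {vspace W}) (chart coords step : W -> W) (p : W).

Definition basis_coord (w : W) : 'rV[R]_(\dim E) :=
  \row_i coord (vbasis E) i w.

Definition basis_point (u : 'rV[R]_(\dim E)) : W :=
  \sum_i u 0 i *: (vbasis E)`_i.

Definition local_map (u : 'rV[R]_(\dim E)) : 'rV[R]_(\dim E) :=
  basis_coord (coords (step (chart (basis_point u)))).

Definition local_point : 'rV[R]_(\dim E) := basis_coord (coords p).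

Definition locally_contractive : Prop :=
  [/\ step p = p, differentiable local_map local_point &
      spectral_radius ('J local_map local_point) < 1].

(* The linearisation u |-> u *m J at the fixed point is asymptotically stable. *)
Definition asymptotically_linearly_stable : Prop :=
  [/\ step p = p, differentiable local_map local_point &
      forall u, iter n (fun v => v *m 'J local_map local_point) u @[n --> \oo]
                --> (0 : 'rV[R]_(\dim E))].

End LocalCoordinates.

(* Main.v *)
Require Import Defs.
From HB Require Import structures.
From mathcomp Require Import all_boot all_order all_algebra.
From mathcomp Require Import all_classical all_reals all_analysis.
From mathcomp Require Import complex ring lra.

Set Implicit Arguments.
Unset Strict Implicit.
Unset Printing Implicit Defensive.

Import Order.TTheory GRing.Theory Num.Theory.
Import numFieldNormedType.Exports.

Local Open Scope classical_set_scope.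
Local Open Scope ring_scope.

(** In coordinates at the saddle point xs both schemes are, to first order, the
    same schemes on a flat space, and there they can be diagonalised.

    Why the geometry disappears.  To first order at xs the exponential map and
    its inverse are translations, the retraction is a translation as well, and
    parallel transport differs from orthogonal projection only to second order
    in the distance ([local_geometry]).  The derivatives of the projections that
    remain only occur in the effect of a displacement of x on R, and the
    Jacobian is block triangular, since grad f vanishes at xs: a variation of R
    does not move x.  So only the diagonal blocks matter.  In an orthonormal
    eigenframe of H = Hess f(xs), in which Rs is diagonal with signs sg and
    H Rs = |H|, put h_i = dt |lambda_i|, which lies in [dt mu, 1/2).

    - The position block of the first scheme is diagonal with entries 1 - h_i
      ([tcoord_step]).
    - With momentum, position and momentum form 2 x 2 blocks of trace
      1 - h_i + gamma and determinant gamma; their non-real eigenvalues have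
      modulus sqrt gamma and the real ones lie between gamma and 1 - h_i
      ([eigen_momentum]).
    - To first order, orthogonalisation near an involution is the Newton step
      (3 A - A^3) / 2 towards the sign of A ([orth_estimate]), whose derivative
      at Rs is X |-> (X - Rs X Rs) / 2.  Composed with the step in R, the
      matrix block is diagonal with entries
      (1 - sg_i sg_j) / 2 * (1 - h_i - h_j) in [0, 1) ([ocoord_step]).

    Hence all eigenvalues have modulus at most 1 - dt mu, respectively
    max (sqrt gamma) (1 - dt mu).  For the first scheme the iterates of the
    Jacobian tend to 0 because the positions decay geometrically and drive the
    matrix entries through contracting recurrences ([csd_iterates_cvg0]).

    The facts of Riemannian geometry are obtained from the equation
    g'' = g' B(g, g') for geodesics and X' = X B(g, g') for parallel fields,
    where B is the transport operator of the constraints ([transport_op]).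
    Short solutions, of initial and of boundary value problems, are fixed points
    of contractions on Lipschitz curves ([ode_exists]) and are unique
    ([ode_unique]); this identifies the short geodesics in the definitions of
    the exponential map and of parallel transport, with quantitative bounds. *)

(** * Sup norm of matrices *)

Section MatrixNorm.
Context {R : realType}.

Lemma mxnorm_ub m n (A : 'M[R]_(m, n)) i j : `|A i j| <= `|A|.
Proof. by rewrite [leRHS]/Num.Def.normr/= mx_normrE; exact: (le_bigmax _ _ (i, j)). Qed.

Lemma mxnorm_le m n (A : 'M[R]_(m, n)) (e : R) :
  0 <= e -> (forall i j, `|A i j| <= e) -> `|A| <= e.
Proof.
by move=> e0 Ae; rewrite /Num.Def.normr/= mx_normrE bigmax_le// => -[i j] _ /=.
Qed.

Lemma mxnormM m n p (A : 'M[R]_(m, n)) (B : 'M[R]_(n, p)) :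
  `|A *m B| <= n%:R * `|A| * `|B|.
Proof.
apply: mxnorm_le => [|i j]; first by rewrite !mulr_ge0.
rewrite mxE (le_trans (ler_norm_sum _ _ _))//.
rewrite (@le_trans _ _ (\sum_(l < n) `|A| * `|B|))//.
  by apply: ler_sum => l _; rewrite normrM ler_pM// mxnorm_ub.
by rewrite sumr_const card_ord -[leLHS]mulr_natl mulrA.
Qed.

Lemma mxnorm_tr m n (A : 'M[R]_(m, n)) : `|A^T| = `|A|.
Proof.
apply/eqP; rewrite eq_le; apply/andP; split; apply: mxnorm_le => // i j.
  by rewrite mxE mxnorm_ub.
by rewrite -[A i j]/(A i j) -[A]trmxK mxE trmxK mxnorm_ub.
Qed.

Lemma dot_sum n (v w : 'rV[R]_n) : (v *m w^T) 0 0 = \sum_j v 0 j * w 0 j.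
Proof. by rewrite mxE; apply: eq_bigr => j _; rewrite mxE. Qed.

Lemma enorm_ge0 n (v : 'rV[R]_n) : 0 <= enorm v.
Proof. exact: sqrtr_ge0. Qed.

Lemma dot_ge0 n (v : 'rV[R]_n) : 0 <= (v *m v^T) 0 0.
Proof. by rewrite dot_sum sumr_ge0// => j _; rewrite -expr2 sqr_ge0. Qed.

Lemma mxnorm_le_enorm n (v : 'rV[R]_n) : `|v| <= enorm v.
Proof.
apply: mxnorm_le => [|i j]; first exact: enorm_ge0.
rewrite ord1 -sqrtr_sqr ler_sqrt ?sqr_ge0 ?dot_ge0// dot_sum.
rewrite (bigD1 j)//= expr2 lerDl sumr_ge0// => l _.
by rewrite -expr2 sqr_ge0.
Qed.

Lemma enorm_le_mxnorm n (v : 'rV[R]_n) : enorm v <= n%:R * `|v|.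
Proof.
rewrite -[leRHS]ger0_norm ?mulr_ge0// -sqrtr_sqr ler_sqrt ?sqr_ge0// dot_sum.
case: n v => [|n] v; first by rewrite big_ord0 mul0r expr0n.
apply: (@le_trans _ _ (\sum_(j < n.+1) `|v| ^+ 2)).
  apply: ler_sum => j _; rewrite -expr2 -real_normK ?num_real//.
  by rewrite lerXn2r ?nnegrE// mxnorm_ub.
rewrite sumr_const card_ord -[leLHS]mulr_natl exprMn ler_wpM2r ?sqr_ge0//.
by rewrite ler_eXnr// ler1n.
Qed.

Lemma dot_eq0 n (v : 'rV[R]_n) : (v *m v^T) 0 0 = 0 -> v = 0.
Proof.
move=> v0; apply/eqP; rewrite -normr_le0 (le_trans (mxnorm_le_enorm v))//.
by rewrite /enorm v0 sqrtr0.
Qed.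

Lemma mxtrace_gram_eq0 m n (A : 'M[R]_(m, n)) : \tr (A *m A^T) = 0 -> A = 0.
Proof.
move=> trA; apply/row_matrixP => i; rewrite row0; apply: dot_eq0.
have ge0 (j : 'I_m) : 0 <= (A *m A^T) j j.
  by rewrite mxE sumr_ge0// => l _; rewrite mxE -expr2 sqr_ge0.
have/eqP := trA; rewrite /mxtrace psumr_eq0// => /allP/(_ i).
rewrite mem_index_enum => /(_ isT)/eqP <-.
by rewrite dot_sum mxE; apply: eq_bigr => j _; rewrite !mxE.
Qed.

(** The trace of a symmetric idempotent is its squared Frobenius norm. *)
Lemma sym_idem_trace0 n (D : 'M[R]_n) :
  D^T = D -> D *m D = D -> \tr D = 0 -> D = 0.
Proof. by move=> DT DD trD; apply: mxtrace_gram_eq0; rewrite DT DD. Qed.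

End MatrixNorm.

(** * Curves of matrices *)

Section Curves.
Context {R : realType}.

Lemma is_derive_mxP (V : normedModType R) m n (M : V -> 'M[R]_(m, n)) t v dM :
  is_derive t v M dM <-> forall i j, is_derive t v (fun x => M x i j) (dM i j).
Proof.
split=> [[dMt <-] i j|H].
  apply: DeriveDef; first exact: (derivable_mxP M t v).1.
  by rewrite derive_mx// mxE.
have dM' : derivable M t v by apply/derivable_mxP => i j; case: (H i j).
apply: DeriveDef => //; rewrite derive_mx//; apply/matrixP => i j.
by rewrite mxE; case: (H i j).
Qed.

Lemma is_derive_bigsum (V : normedModType R) (I : finType) (F : I -> V -> R)
    (dF : I -> R) t v :
  (forall i, is_derive t v (F i) (dF i)) ->
  is_derive t v (fun x => \sum_i F i x) (\sum_i dF i).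
Proof.
move=> H; rewrite -[fun x => _](_ : \sum_(i in I) F i = _); last first.
  by apply/funext => x; rewrite fct_sumE.
by elim/big_ind2 : _ => // [|f df g dg ? ?]; [exact: is_derive_cst|exact: is_deriveD].
Qed.

Lemma is_derive_mulmx (V : normedModType R) m n p (A : V -> 'M[R]_(m, n))
    (B : V -> 'M[R]_(n, p)) t v dA dB :
  is_derive t v A dA -> is_derive t v B dB ->
  is_derive t v (fun x => A x *m B x) (dA *m B t + A t *m dB).
Proof.
move=> /is_derive_mxP HA /is_derive_mxP HB; apply/is_derive_mxP => i j.
under [X in is_derive _ _ X _]eq_fun do rewrite mxE.
rewrite !mxE -big_split/=.
apply: is_derive_bigsum => l.
rewrite -[fun x => _]/((fun x => A x i l) * (fun x => B x l j)).
have H := @is_deriveM _ _ (fun x => A x i l) (fun x => B x l j) t v _ _ (HA i l) (HB l j).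
apply: is_derive_eq H _.
by rewrite addrC /GRing.scale/= [B t l j * _]mulrC.
Qed.

Lemma is_derive_tr (V : normedModType R) m n (A : V -> 'M[R]_(m, n)) t v dA :
  is_derive t v A dA -> is_derive t v (fun x => (A x)^T) dA^T.
Proof.
move=> /is_derive_mxP HA; apply/is_derive_mxP => i j; rewrite mxE.
by under [X in is_derive _ _ X _]eq_fun do rewrite mxE.
Qed.

Lemma is_derive_mulmxr (V : normedModType R) m n p (A : V -> 'M[R]_(m, n))
    (B : 'M[R]_(n, p)) t v dA :
  is_derive t v A dA -> is_derive t v (fun x => A x *m B) (dA *m B).
Proof.
move=> HA; apply: is_derive_eq; first exact: (is_derive_mulmx HA (is_derive_cst B t v)).
by rewrite mulmx0 addr0.
Qed.

Lemma is_derive_continuous (V : normedModType R) (g : R -> V) t dg :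
  is_derive t (1 : R) g dg -> {for t, continuous g}.
Proof. by move=> [/derivable1_diffP/differentiable_continuous]. Qed.

Lemma is_derive1 (V : normedModType R) (g : R -> V) t dg :
  is_derive t (1 : R) g dg -> derive1 g t = dg.
Proof. by move=> [_ <-]; rewrite derive1E. Qed.

Lemma derivable_is_derive1 (V : normedModType R) (g : R -> V) t :
  derivable g t (1 : R) -> is_derive t (1 : R) g (derive1 g t).
Proof. by move=> gd; rewrite derive1E; exact: derivableP gd. Qed.

Lemma is_derive_along (V : normedModType R) (phi : V -> R) (g : R -> V) t dg :
  differentiable phi (g t) -> is_derive t (1 : R) g dg ->
  is_derive t (1 : R) (phi \o g) ('D_dg phi (g t)).
Proof.
move=> dphi [/derivable1_diffP dgt gE].
have dc : differentiable (phi \o g) t by exact: differentiable_comp.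
apply: DeriveDef; first by apply/derivable1_diffP.
rewrite deriveE// diff_comp//= -[X in 'd phi _ X](_ : dg = _).
  by rewrite deriveE.
by rewrite -gE deriveE.
Qed.

(** The mean value theorem gives inequalities for vector-valued curves entry by
    entry, without loss in the sup norm. *)
Lemma mvt_le (f df : R -> R) (a b M : R) : a <= b ->
  (forall t, a <= t <= b -> is_derive t (1 : R) f (df t)) ->
  (forall t, a <= t <= b -> `|df t| <= M) -> `|f b - f a| <= M * (b - a).
Proof.
move=> ab df_ dfM.
have [||c cab ->] := @MVT_segment _ f df a b ab.
- by move=> x; rewrite in_itv/= => /andP[ax xb]; apply: df_; rewrite !ltW.
- apply: continuous_in_subspaceT => x; rewrite inE/= in_itv/= => xab.
  exact: is_derive_continuous (df_ x xab).
rewrite normrM [`|b - a|]ger0_norm ?subr_ge0// ler_wpM2r ?subr_ge0//.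
by apply: dfM; rewrite in_itv/= in cab.
Qed.

Lemma mvt_mx_le m n (g dg : R -> 'M[R]_(m, n)) (a b M : R) : a <= b ->
  (forall t, a <= t <= b -> is_derive t (1 : R) g (dg t)) ->
  (forall t, a <= t <= b -> `|dg t| <= M) -> `|g b - g a| <= M * (b - a).
Proof.
move=> ab dg_ dgM.
have M0 : 0 <= M by apply: le_trans (dgM a _); rewrite ?lexx.
apply: mxnorm_le => [|i j]; first by rewrite mulr_ge0// subr_ge0.
rewrite !mxE; apply: (@mvt_le (fun t => g t i j) (fun t => dg t i j)) => //.
  by move=> t /dg_/is_derive_mxP.
by move=> t /dgM; apply: le_trans; exact: mxnorm_ub.
Qed.

Lemma mvt_mx_abs m n (g dg : R -> 'M[R]_(m, n)) (a b M : R) :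
  (forall t, Num.min a b <= t <= Num.max a b -> is_derive t (1 : R) g (dg t)) ->
  (forall t, Num.min a b <= t <= Num.max a b -> `|dg t| <= M) ->
  `|g b - g a| <= M * `|b - a|.
Proof.
have [ab|/ltW ba] := leP a b => H1 H2.
  by rewrite [`|b - a|]ger0_norm ?subr_ge0//; exact: mvt_mx_le H1 H2.
rewrite distrC [`|b - a|]distrC [`|a - b|]ger0_norm ?subr_ge0//.
exact: mvt_mx_le H1 H2.
Qed.

Lemma mvt_mx_cst m n (g : R -> 'M[R]_(m, n)) (a b s t : R) :
  (forall t, a < t < b -> is_derive t (1 : R) g 0) ->
  a < s < b -> a < t < b -> g s = g t.
Proof.
move=> H /andP[as_ sb] /andP[at_ tb]; apply/eqP; rewrite -subr_eq0 -normr_le0.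
rewrite -[leRHS](mul0r `|s - t|); apply: (@mvt_mx_abs _ _ g (fun=> 0)) => u.
  by rewrite ge_min le_max => /andP[/orP[]? /orP[]?]; apply: H; lra.
by rewrite normr0.
Qed.

End Curves.

(** * Functions of class C^k *)

Section Differentials.
Context {R : realType} {V W : normedModType R}.
Implicit Types f g : V -> W.

(** A linear part with an o(y) remainder determines the differential; stated
    with explicit epsilons so that remainders can be estimated by hand. *)
Lemma diff_of_littleo f (df : {linear V -> W}) x : continuous df ->
  (forall e : R, 0 < e -> \forall y \near (0 : V),
     `|f (y + x) - (f x + df y)| <= e * `|y|) ->
  is_diff x f df.
Proof.
move=> dfc H.
have E : f \o shift x = cst (f x) + df +o_ 0 id by apply/eqaddoP => e /H.
have dE := diff_unique dfc E.
by apply: DiffDef => //; apply/diff_locallyP; rewrite dE.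
Qed.

Lemma littleo_of_diff f x : differentiable f x ->
  forall e : R, 0 < e -> \forall y \near (0 : V),
     `|f (y + x) - (f x + 'd f x y)| <= e * `|y|.
Proof. by move=> /diff_locallyP[_ /eqaddoP H] e /H. Qed.

Lemma near_eq_differentiable f g x :
  {near x, f =1 g} -> differentiable f x -> differentiable g x.
Proof.
move=> fg fx.
suff : is_diff x g ('d f x) by case.
apply: diff_of_littleo => [|e e0]; first exact: diff_continuous.
rewrite -(nbhs_singleton fg).
have fg0 : \forall y \near (0 : V), f (y + x) = g (y + x).
  rewrite (near_shift x) /=; near=> y.
  by rewrite sub0r /comp/= subrK; near: y.
by near do rewrite -(near fg0 _)//; exact: littleo_of_diff.
Unshelve. all: by end_near. Qed.

End Differentials.

Section Ck.
Context {R : realType} {V : normedModType R}.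
Variables (U : set V) (oU : open U).
Implicit Types f g : V -> R.

Lemma near_open (P : V -> Prop) x : U x -> (forall y, U y -> P y) ->
  \forall y \near x, P y.
Proof. by move=> Ux H; near=> y; apply: H; near: y; exact: open_nbhs_nbhs.
Unshelve. all: by end_near. Qed.

Lemma Ck_on_ext n f g : (forall x, U x -> f x = g x) ->
  Ck_on n U f -> Ck_on n U g.
Proof.
elim: n f g => [|n IH] f g fg /=.
  move=> fc x Ux.
  have fgx : {near x, f =1 g} by exact: near_open.
  have fcx := fc x Ux; rewrite /prop_for /continuous_at -fg//.
  by apply: cvg_trans fcx; exact: near_eq_cvg.
move=> [fd fD]; split=> [x Ux|v].
  by apply: near_eq_differentiable (fd x Ux); exact: near_open.
apply: IH (fD v) => x Ux.
by apply: near_eq_derive; exact: near_open.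
Qed.

Lemma Ck_onW n f : Ck_on n.+1 U f -> Ck_on n U f.
Proof.
elim: n f => [|n IH] f /=; first by move=> [fd _] x /fd/differentiable_continuous.
by move=> [fd fD]; split=> // v; apply: IH; exact: fD.
Qed.

Lemma Ck_on_diff n f x : Ck_on n.+1 U f -> U x -> differentiable f x.
Proof. by move=> /= [H _] /H. Qed.

Lemma Ck_on_cst n (a : R) : Ck_on n U (fun=> a).
Proof.
elim: n a => [|n IH] a /=; first by move=> x _; exact: cst_continuous.
split=> [x _|v]; first exact: differentiable_cst.
by rewrite [X in Ck_on _ _ X](_ : _ = fun=> 0)//; apply/funext => x; exact: derive_cst.
Qed.

Lemma Ck_onD n f g : Ck_on n U f -> Ck_on n U g -> Ck_on n U (fun x => f x + g x).
Proof.
elim: n f g => [|n IH] f g /=.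
  by move=> fc gc x Ux; apply: continuousD; [exact: fc|exact: gc].
move=> [fd fD] [gd gD]; split=> [x Ux|v].
  by apply: differentiableD; [exact: fd|exact: gd].
apply: Ck_on_ext (IH _ _ (fD v) (gD v)) => x Ux.
by rewrite -deriveD//; apply: diff_derivable; [exact: fd|exact: gd].
Qed.

Lemma Ck_onM n f g : Ck_on n U f -> Ck_on n U g -> Ck_on n U (fun x => f x * g x).
Proof.
elim: n f g => [|n IH] f g.
  by move=> fc gc x Ux; apply: continuousM; [exact: fc|exact: gc].
move=> fC gC; have [fd fD] := fC; have [gd gD] := gC; split=> [x Ux|v].
  by apply: differentiableM; [exact: fd|exact: gd].
apply: Ck_on_ext (Ck_onD (IH _ _ (Ck_onW fC) (gD v)) (IH _ _ (Ck_onW gC) (fD v))) => x Ux.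
by rewrite (@deriveM _ _ f g)//; apply: diff_derivable; [exact: fd|exact: gd].
Qed.

Lemma Ck_onN n f : Ck_on n U f -> Ck_on n U (fun x => - f x).
Proof.
move=> fC; apply: Ck_on_ext (Ck_onM (Ck_on_cst n (-1)) fC) => x _.
by rewrite mulN1r.
Qed.

Lemma Ck_onV n f : (forall x, U x -> f x != 0) ->
  Ck_on n U f -> Ck_on n U (fun x => (f x)^-1).
Proof.
move=> f0; elim: n => [|n IH].
  by move=> fc x Ux; apply: continuousV; [exact: f0|exact: fc].
move=> fC; have [fd fD] := fC; split=> [x Ux|v].
  by apply: differentiableV; [exact: fd|exact: f0].
have fV := IH (Ck_onW fC).
apply: Ck_on_ext (Ck_onN (Ck_onM (Ck_onM fV fV) (fD v))) => x Ux.
rewrite (@deriveV _ _ f)//; [|exact: f0|by apply: diff_derivable; exact: fd].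
by rewrite /GRing.scale/= mulNr expr2 invfM.
Qed.

Lemma Ck_on_sum n (I : finType) (P : pred I) (F : I -> V -> R) :
  (forall i, Ck_on n U (F i)) -> Ck_on n U (fun x => \sum_(i | P i) F i x).
Proof.
move=> H; rewrite unlock; elim: (index_enum I) => [|i s IH] /=; first exact: Ck_on_cst.
by case: (P i) => //; exact: Ck_onD.
Qed.

Lemma Ck_on_prod n (I : finType) (P : pred I) (F : I -> V -> R) :
  (forall i, Ck_on n U (F i)) -> Ck_on n U (fun x => \prod_(i | P i) F i x).
Proof.
move=> H; rewrite unlock; elim: (index_enum I) => [|i s IH] /=; first exact: Ck_on_cst.
by case: (P i) => //; exact: Ck_onM.
Qed.

Definition mxCk n m p (F : V -> 'M[R]_(m, p)) :=
  forall i j, Ck_on n U (fun x => F x i j).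

Lemma mxCk_mul n m p q (F : V -> 'M[R]_(m, p)) (G : V -> 'M[R]_(p, q)) :
  mxCk n F -> mxCk n G -> mxCk n (fun x => F x *m G x).
Proof.
move=> FC GC i j; under eq_fun do rewrite mxE.
by apply: Ck_on_sum => l; apply: Ck_onM.
Qed.

Lemma mxCk_tr n m p (F : V -> 'M[R]_(m, p)) : mxCk n F -> mxCk n (fun x => (F x)^T).
Proof. by move=> FC i j; under eq_fun do rewrite mxE. Qed.

Lemma mxCk_cst n m p (A : 'M[R]_(m, p)) : mxCk n (fun=> A).
Proof. by move=> i j; exact: Ck_on_cst. Qed.

Lemma mxCkD n m p (F G : V -> 'M[R]_(m, p)) :
  mxCk n F -> mxCk n G -> mxCk n (fun x => F x + G x).
Proof. by move=> FC GC i j; under eq_fun do rewrite mxE; exact: Ck_onD. Qed.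

Lemma mxCkN n m p (F : V -> 'M[R]_(m, p)) : mxCk n F -> mxCk n (fun x => - F x).
Proof. by move=> FC i j; under eq_fun do rewrite mxE; exact: Ck_onN. Qed.

Lemma Ck_on_det n m (F : V -> 'M[R]_m) : mxCk n F -> Ck_on n U (fun x => \det (F x)).
Proof.
move=> FC; apply: Ck_on_sum => s; apply: Ck_onM; first exact: Ck_on_cst.
by apply: Ck_on_prod => i.
Qed.

(** Inversion of matrices is as smooth as the determinant and the cofactors,
    by Cramer's rule. *)
Lemma mxCk_inv n m (F : V -> 'M[R]_m) : (forall x, U x -> F x \in unitmx) ->
  mxCk n F -> mxCk n (fun x => invmx (F x)).
Proof.
move=> Fu FC i j.
apply: (@Ck_on_ext _ (fun x => (\det (F x))^-1 * cofactor (F x) j i)).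
  by move=> x Ux; rewrite /invmx Fu// !mxE.
apply: Ck_onM.
  apply: Ck_onV; last exact: Ck_on_det.
  by move=> x /Fu; rewrite unitmxE unitfE.
apply: Ck_onM; first exact: Ck_on_cst.
by apply: Ck_on_det => a b; under eq_fun do rewrite !mxE; exact: FC.
Qed.

End Ck.

Section CkOpen.
Context {R : realType} {V : normedModType R}.

Lemma Ck_onS n (U U' : set V) (f : V -> R) : U' `<=` U -> Ck_on n U f -> Ck_on n U' f.
Proof.
elim: n f => [|n IH] f UU /=; first by move=> fc x /UU/fc.
by move=> [fd fD]; split=> [x /UU/fd//|v]; apply: IH.
Qed.

End CkOpen.

(** * Primitives and fixed points of operators on curves *)

Section Primitive.
Context {R : realType}.
Local Notation mu := (@lebesgue_measure R).

(* The left end -4 only has to lie to the left of the time interval on which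
   curves are considered. *)
Lemma primitive_ex (f : R -> R) : continuous f ->
  exists F : R -> R, F 0 = 0 /\ forall t : R, -4 < t -> is_derive t (1 : R) F (f t).
Proof.
move=> fc.
exists (fun t => \int[mu]_(x in `[-4, t]) f x - \int[mu]_(x in `[-4, 0]) f x)%R.
split=> [|t t4]; first by rewrite subrr.
have fi : mu.-integrable `[-4, t + 1] (EFin \o f).
  apply: continuous_compact_integrable; first exact: segment_compact.
  by apply: continuous_subspaceT.
have [] := @continuous_FTC1_closed R f (-4) t (t + 1) _ fi t4 (fc t).
  by rewrite ltrDl.
move=> Fd; rewrite derive1E => FE.
have dF : is_derive t (1 : R) (fun t => \int[mu]_(x in `[-4, t]) f x)%R (f t).
  exact: DeriveDef.
by apply: is_derive_eq; rewrite oppr0 addr0.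
Qed.

Lemma mx_primitive_ex m n (f : R -> 'M[R]_(m, n)) :
  (forall i j, continuous (fun t => f t i j)) ->
  exists F : R -> 'M[R]_(m, n),
    F 0 = 0 /\ forall t : R, -4 < t -> is_derive t (1 : R) F (f t).
Proof.
move=> fc; have H i j := primitive_ex (fc i j).
exists (fun t => \matrix_(i, j) sval (cid (H i j)) t); split.
  by apply/matrixP => i j; rewrite !mxE; case: cid => F [].
move=> t t4; apply/is_derive_mxP => i j.
under eq_fun do rewrite mxE.
by case: cid => F /= [_ /(_ t t4)].
Qed.

End Primitive.

Section FixedPoint.
Context {R : realType}.

Lemma le_div_expn2_le0 (c x : R) : (forall n, x <= c / 2 ^+ n) -> x <= 0.
Proof.
move=> H; rewrite leNgt; apply/negP => x0.
have c0 : 0 < c by have := H 0%N; rewrite expr0 divr1; exact: lt_le_trans.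
have /archi_boundP := ltW (divr_gt0 c0 x0); set n := Num.bound _ => cxn.
have := H n; rewrite ler_pdivlMr ?exprn_gt0// => /le_lt_trans.
rewrite ltr_pdivrMr// in cxn => /(_ _ cxn); rewrite [n%:R * _]mulrC ltr_pM2l//.
by rewrite -natrX ltr_nat ltnNge ltnW// ltn_expl.
Qed.

(** The limit is the supremum of the lower bounds u n - q n that the geometric
    rate q n provides; this gives the rate of convergence at once. *)
Lemma geometric_limit (u : nat -> R) (b : R) :
  (forall n, `|u n.+1 - u n| <= b / 2 ^+ n) ->
  exists l, forall n, `|u n - l| <= 2 * b / 2 ^+ n.
Proof.
move=> H; pose q n := 2 * b / 2 ^+ n.
have qS n : q n - b / 2 ^+ n = q n.+1.
  by rewrite /q exprS; field; rewrite expf_neq0.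
have lo n k : u n - q n <= u (n + k)%N - q (n + k)%N.
  elim: k => [|k IH]; rewrite ?addn0// addnS (le_trans IH)// -qS.
  by have /ler_normlP[] := H (n + k)%N; lra.
have hi n k : u (n + k)%N + q (n + k)%N <= u n + q n.
  elim: k => [|k IH]; rewrite ?addn0// addnS (le_trans _ IH)// -qS.
  by have /ler_normlP[] := H (n + k)%N; lra.
have q0 n : 0 <= q n.
  have := le_trans (normr_ge0 _) (H n); rewrite /q -mulrA; lra.
have lohi n p : u n - q n <= u p + q p.
  have := lo n p; have := hi p n; rewrite [(p + n)%N]addnC.
  by have := q0 (n + p)%N; lra.
pose E := range (fun n => u n - q n).
have E0 : E !=set0 by exists (u 0%N - q 0%N), 0%N.
have Eub p : ubound E (u p + q p) by move=> _ [n _ <-].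
exists (sup E) => n; rewrite -/(q n) ler_distlC; apply/andP; split.
  by apply: (@ub_le_sup _ E); [exists (u 0%N + q 0%N); exact: Eub|exists n].
exact: ge_sup.
Qed.

(** Curves that are bounded by b and Lipschitz of constant k: a set of curves
    that is closed under pointwise limits, on which the differential equations
    below are solved. *)
Definition bdd_lip d (b k : R) (a : R -> 'rV[R]_d) :=
  (forall t, `|a t| <= b) /\ (forall s t, `|a s - a t| <= k * `|s - t|).

(** Banach's fixed point theorem for operators on bounded Lipschitz curves.
    The Lipschitz bound survives pointwise limits, so no uniform convergence of
    continuous functions is involved. *)
Lemma curve_fixed_point d (F : (R -> 'rV[R]_d) -> R -> 'rV[R]_d) (b k : R) :
  0 <= b -> 0 <= k ->
  (forall a, bdd_lip b k a -> bdd_lip b k (F a)) ->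
  (forall a a' e, bdd_lip b k a -> bdd_lip b k a' ->
     (forall t, `|a t - a' t| <= e) -> forall t, `|F a t - F a' t| <= e / 2) ->
  exists2 a, bdd_lip b k a & forall t, F a t = a t.
Proof.
move=> b0 k0 FA FC.
pose a n := iter n F (fun=> 0).
have aA n : bdd_lip b k (a n).
  elim: n => [|n]; last exact: FA.
  by split=> [t|s t]; rewrite ?subrr normr0// mulr_ge0.
have step n t : `|a n.+1 t - a n t| <= b / 2 ^+ n.
  elim: n t => [|n IH] t; first by rewrite expr0 divr1 subr0; exact: (aA 1%N).1.
  have -> : b / 2 ^+ n.+1 = b / 2 ^+ n / 2 by rewrite exprSr invfM mulrA.
  exact: (FC (a n.+1) (a n) _ (aA _) (aA _) IH t).
have lim_ex t j : exists l, forall n, `|a n t 0 j - l| <= 2 * b / 2 ^+ n.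
  apply: geometric_limit => n; apply: le_trans (step n t).
  by rewrite -[leLHS](_ : `|(a n.+1 t - a n t) 0 j| = _) ?mxnorm_ub// !mxE.
pose l t : 'rV[R]_d := \row_j sval (cid (lim_ex t j)).
have al n t : `|a n t - l t| <= 2 * b / 2 ^+ n.
  apply: mxnorm_le => [|i j]; first by rewrite divr_ge0 ?mulr_ge0 ?exprn_ge0.
  by rewrite !mxE ord1; case: cid.
clearbody l.
have le_lim (x y c : R) : (forall n, x <= y + c / 2 ^+ n) -> x <= y.
  by move=> H; rewrite -subr_le0; apply: (@le_div_expn2_le0 c) => n; have := H n; lra.
have lA : bdd_lip b k l.
  split=> [t|s t].
    apply: (le_lim _ _ (2 * b)) => n; have := al n t; have := (aA n).1 t.
    by have := ler_normB (a n t) (a n t - l t); rewrite opprB addrC subrK; lra.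
  apply: (le_lim _ _ (4 * b)) => n; have := al n t; have := al n s; have := (aA n).2 s t.
  have -> : l s - l t = (a n s - a n t) - (a n s - l s) + (a n t - l t).
    by apply/matrixP => i j; rewrite !mxE; lra.
  have := ler_normD (a n s - a n t - (a n s - l s)) (a n t - l t).
  have := ler_normB (a n s - a n t) (a n s - l s).
  rewrite -[4 * b / _]/(4 * b * _); lra.
exists l => // t; apply/eqP; rewrite -subr_eq0 -normr_le0.
apply: (@le_div_expn2_le0 (3 * b)) => n.
have H1 := al n.+1 t; have H2 := FC _ _ _ (aA n) lA (al n) t.
have -> : F l t - l t = (a n.+1 t - l t) - (F (a n) t - F l t).
  by rewrite -[F (a n) t]/(a n.+1 t); apply/matrixP => i j; rewrite !mxE; lra.
have := ler_normB (a n.+1 t - l t) (F (a n) t - F l t).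
have E : 2 * b / 2 ^+ n.+1 = b / 2 ^+ n by rewrite exprS; field; rewrite expf_neq0.
have : 0 <= b / 2 ^+ n by rewrite divr_ge0// exprn_ge0.
rewrite E in H1; lra.
Qed.

End FixedPoint.

(** * The spectral theorem for real symmetric matrices *)

Section Spectral.
Context {R : realType}.

Lemma vec_mx_Ck0 m n : @mxCk R _ setT 0 m n (@vec_mx R m n).
Proof.
move=> i j; under eq_fun do rewrite mxE.
by move=> v _; exact: coord_continuous.
Qed.

(** Orthogonal matrices are flattened to row vectors, where bounded closed sets
    are compact. *)
Lemma compact_orthogonal n :
  compact [set v : 'rV[R]_(n * n) | vec_mx v *m (vec_mx v)^T = 1%:M].
Proof.
set O := [set v | _].
apply: bounded_closed_compact.
  exists 1; split=> // x x1 v /= vO; apply: le_trans (ltW x1).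
  apply: mxnorm_le => // i j; rewrite ord1 -[v]vec_mxK.
  case/mxvec_indexP: j => a b; rewrite mxvecE.
  have /matrixP/(_ a a) := vO; rewrite !mxE eqxx (bigD1 b)//= mxE => E.
  rewrite -(@ler_pXn2r _ 2)// ?nnegrE// expr1n real_normK ?num_real// -[leRHS]E expr2.
  by rewrite !mxE lerDl sumr_ge0// => l _; rewrite !mxE -expr2 sqr_ge0.
pose f (v : 'rV[R]_(n * n)) : R :=
  \sum_i \sum_j ((vec_mx v *m (vec_mx v)^T - 1%:M) i j * (vec_mx v *m (vec_mx v)^T - 1%:M) i j).
have fc : continuous f.
  move=> v; have : Ck_on 0 setT f; last by apply.
  have FC : @mxCk R _ setT 0 n n (fun v : 'rV[R]_(n * n) => vec_mx v *m (vec_mx v)^T - 1%:M).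
    apply: mxCkD => //; [exact: openT| |exact: mxCk_cst].
    by apply: (mxCk_mul openT); [|apply: mxCk_tr]; exact: vec_mx_Ck0.
  apply: (Ck_on_sum openT) => i; apply: (Ck_on_sum openT) => j.
  by apply: (Ck_onM openT); exact: FC.
rewrite (_ : O = f @^-1` [set 0]).
  by apply: closed_comp => [v _|]; [exact: fc|exact: closed_eq].
apply/seteqP; split=> v /= H.
  by rewrite /f big1// => i _; rewrite big1// => j _; rewrite H subrr mxE mul0r.
apply/eqP; rewrite -subr_eq0; apply/eqP/matrixP => i j; rewrite [RHS]mxE.
have F0 a b : 0 <= (vec_mx v *m (vec_mx v)^T - 1%:M) a b * (vec_mx v *m (vec_mx v)^T - 1%:M) a b.
  by rewrite -expr2 sqr_ge0.
move/eqP: H; rewrite /f psumr_eq0; last by move=> a _; rewrite sumr_ge0.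
move=> /allP/(_ i); rewrite mem_index_enum => /(_ isT); rewrite psumr_eq0//.
move=> /allP/(_ j); rewrite mem_index_enum => /(_ isT).
by rewrite mulf_eq0 => /orP[] /eqP.
Qed.

Lemma mulmx_rows m n (V : 'M[R]_(m, n)) (M : 'M[R]_n) i j :
  (V *m M *m V^T) i j = (row i V *m M *m (row j V)^T) 0 0.
Proof. by rewrite !mxE; apply: eq_bigr => l _; rewrite -row_mul !mxE. Qed.

Definition givens n (V : 'M[R]_n) (i j : 'I_n) (c s : R) : 'M[R]_n :=
  \matrix_l (if l == i then c *: row i V + s *: row j V
             else if l == j then - s *: row i V + c *: row j V else row l V).

Lemma row_givens n (V : 'M[R]_n) (i j : 'I_n) (c s : R) l :
  row l (givens V i j c s) =
    (if l == i then c *: row i V + s *: row j V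
     else if l == j then - s *: row i V + c *: row j V else row l V).
Proof. by rewrite rowK. Qed.

Lemma bilin_comb n (M : 'M[R]_n) (u v u' v' : 'rV[R]_n) (a b a' b' : R) :
  ((a *: u + b *: v) *m M *m (a' *: u' + b' *: v')^T) 0 0 =
  a * a' * (u *m M *m u'^T) 0 0 + a * b' * (u *m M *m v'^T) 0 0 +
  b * a' * (v *m M *m u'^T) 0 0 + b * b' * (v *m M *m v'^T) 0 0.
Proof.
rewrite linearD !linearZ/= !mulmxDl !mulmxDr -!scalemxAl -!scalemxAr !mxE; ring.
Qed.

Lemma givens_orthogonal n (V : 'M[R]_n) (i j : 'I_n) (c s : R) : i != j ->
  c ^+ 2 + s ^+ 2 = 1 -> V *m V^T = 1%:M ->
  givens V i j c s *m (givens V i j c s)^T = 1%:M.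
Proof.
move=> ij cs VV; apply/matrixP => a b.
have VVE k l : (row k V *m 1%:M *m (row l V)^T) 0 0 = (k == l)%:R.
  by rewrite -mulmx_rows mulmx1 VV mxE.
rewrite -[givens _ _ _ _ _ in X in X *m _]mulmx1 mulmx_rows !row_givens [RHS]mxE.
have E1 (u : 'rV[R]_n) : u = 1 *: u + 0 *: u by rewrite scale1r scale0r addr0.
have ji : (j == i) = false by apply/negbTE; rewrite eq_sym.
have ij' : (i == j) = false by exact/negbTE.
case: (eqVneq a i) => [?|ai]; [subst a|]; (case: (eqVneq b i) => [?|bi]; [subst b|]).
- rewrite bilin_comb !VVE !eqxx ji ij' /= ?mulr1n ?mulr0n; lra.
- case: (eqVneq b j) => [?|bj]; [subst b|].
    rewrite bilin_comb !VVE !eqxx ji ij' /= ?mulr1n ?mulr0n; lra.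
  rewrite [row b V]E1 bilin_comb !VVE ![_ == b]eq_sym.
  by rewrite (negbTE bi) (negbTE bj) /= ?mulr0n; lra.
- case: (eqVneq a j) => [?|aj]; [subst a|].
    rewrite bilin_comb !VVE !eqxx ji ij' /= ?mulr1n ?mulr0n; lra.
  rewrite [row a V]E1 bilin_comb !VVE.
  by rewrite (negbTE ai) (negbTE aj) /= ?mulr0n; lra.
- case: (eqVneq a j) => [?|aj]; [subst a|]; (case: (eqVneq b j) => [?|bj]; [subst b|]).
  + rewrite bilin_comb !VVE !eqxx ji ij' /= ?mulr1n ?mulr0n; lra.
  + rewrite [row b V]E1 bilin_comb !VVE ![_ == b]eq_sym.
    by rewrite (negbTE bi) (negbTE bj) /= ?mulr0n; lra.
  + rewrite [row a V]E1 bilin_comb !VVE.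
    by rewrite (negbTE ai) (negbTE aj) /= ?mulr0n; lra.
  + by rewrite VVE.
Qed.

(** Von Neumann's variational argument: among orthogonal V, let V maximise the
    sum of i (V A V^T)_ii.  Rotating two rows of V cannot increase it, which
    forces V A V^T to be diagonal, and makes its diagonal increasing. *)
Lemma symmetric_spectral n (A : 'M[R]_n) : A^T = A ->
  exists V s, [/\ V *m V^T = 1%:M, A = V^T *m diag_mx s *m V &
    forall i j : 'I_n, (i <= j)%N -> s 0 i <= s 0 j].
Proof.
move=> AT.
pose phi (V : 'M[R]_n) : R := \sum_(l < n) l%:R * (V *m A *m V^T) l l.
have phic : continuous (phi \o @vec_mx R n n).
  move=> v; have : Ck_on 0 setT (phi \o @vec_mx R n n); last by apply.
  have FC : @mxCk R _ setT 0 n n (fun v : 'rV[R]_(n * n) => vec_mx v *m A *m (vec_mx v)^T).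
    apply: (mxCk_mul openT); last by apply: mxCk_tr; exact: vec_mx_Ck0.
    by apply: (mxCk_mul openT); [exact: vec_mx_Ck0|exact: mxCk_cst].
  apply: (Ck_on_sum openT) => i.
  by apply: (Ck_onM openT); [exact: Ck_on_cst|exact: FC].
have [||v] := @EVT_max_rV R _ (phi \o @vec_mx R n n) _ _ (@compact_orthogonal n).
- by exists (mxvec 1%:M); rewrite /= mxvecK trmx1 mulmx1.
- exact: continuous_subspaceT.
rewrite inE/=; set V := vec_mx v => VV Vmax.
have {}Vmax V' : V' *m V'^T = 1%:M -> phi V' <= phi V.
  by move=> V'V'; have := Vmax (mxvec V'); rewrite inE/= mxvecK; apply.
pose B := V *m A *m V^T.
have BT k l : B k l = B l k.
  have : B^T = B by rewrite /B !trmx_mul trmxK AT mulmxA.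
  by move/matrixP/(_ l k); rewrite mxE.
have var (i j : 'I_n) (c s : R) : (i < j)%N -> c ^+ 2 + s ^+ 2 = 1 ->
    0 <= 2 * c * s * B i j + s ^+ 2 * (B j j - B i i).
  move=> ij cs.
  have nij : i != j by apply: contraTneq ij => ->; rewrite ltnn.
  have := Vmax _ (givens_orthogonal nij cs VV).
  rewrite /phi (bigD1 i)//= (bigD1 j) 1?eq_sym//= [leRHS](bigD1 i)//= [in leRHS](bigD1 j) 1?eq_sym//=.
  rewrite [X in _ + (_ + X) <= _](_ : _ = \sum_(l < n | (l != i) && (l != j)) l%:R * B l l); last first.
    apply: eq_bigr => l /andP[li lj]; congr (_ * _).
    by rewrite [LHS]mulmx_rows row_givens (negbTE li) (negbTE lj) -mulmx_rows.
  rewrite -/B ![(givens V i j c s *m _ *m _) _ _]mulmx_rows !row_givens !eqxx eq_sym (negbTE nij) !bilin_comb -!mulmx_rows -/B.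
  rewrite !addrA lerD2r (BT j i) => H.
  have wij : 0 < (j%:R - i%:R :> R) by rewrite subr_gt0 ltr_nat.
  rewrite -(pmulr_rge0 _ wij).
  have c2 : c ^+ 2 = 1 - s ^+ 2 by rewrite -cs addrK.
  have : i%:R * (c * c * B i i + c * s * B i j + s * c * B i j + s * s * B j j) =
         i%:R * (c ^+ 2 * B i i + 2 * c * s * B i j + s ^+ 2 * B j j) by ring.
  move: H => /[swap] ->.
  have -> : j%:R * (- s * - s * B i i + - s * c * B i j + c * - s * B i j + c * c * B j j) =
         j%:R * (s ^+ 2 * B i i - 2 * c * s * B i j + c ^+ 2 * B j j) by ring.
  by rewrite c2; lra.
have le_diag (i j : 'I_n) : (i < j)%N -> B i i <= B j j.
  by move=> ij; have := var i j 0 1 ij; rewrite expr0n expr1n add0r => /(_ erefl); lra.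
have offdiag (i j : 'I_n) : (i < j)%N -> B i j = 0.
  move=> ij; set b := B i j; set e := B j j - B i i.
  have e0 : 0 <= e by rewrite subr_ge0 le_diag.
  (* first variation along the rational parametrisation of the circle *)
  have small t : 0 < t <= 1 / 2 -> `|b| <= 2 * t * e.
    move=> /andP[t0 t1].
    pose D := 1 + t ^+ 2; pose c := (1 - t ^+ 2) / D; pose s := 2 * t / D.
    have Dgt0 : 0 < D by rewrite /D; nra.
    have D0 : D != 0 by exact: lt0r_neq0.
    have cs : c ^+ 2 + s ^+ 2 = 1 by rewrite /c /s; move: D0; rewrite /D => D0; field.
    have cs' : c ^+ 2 + (- s) ^+ 2 = 1 by rewrite sqrrN.
    have := var i j c s ij cs; have := var i j c (- s) ij cs'.
    rewrite -/b -/e.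
    have s0 : 0 < s by rewrite divr_gt0//; lra.
    have -> : 2 * c * - s * b + (- s) ^+ 2 * e =
              s / D * (- (2 * (1 - t ^+ 2) * b) + 2 * t * e) by rewrite /c /s; field.
    have -> : 2 * c * s * b + s ^+ 2 * e =
              s / D * (2 * (1 - t ^+ 2) * b + 2 * t * e) by rewrite /c /s; field.
    have sD := divr_gt0 s0 Dgt0; rewrite !(pmulr_rge0 _ sD) => H1 H2.
    have t2 : 0 <= t ^+ 2 <= 1 / 4 by apply/andP; split; nra.
    have te : 0 <= t * e by rewrite mulr_ge0// ltW.
    by rewrite ler_norml; apply/andP; split; case: (lerP 0 b) => b0; nra.
  apply/eqP; rewrite -normr_le0; apply: (@le_div_expn2_le0 _ e) => m.
  rewrite (le_trans (small (1 / 2 ^+ m.+1) _))//.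
    rewrite divr_gt0 ?exprn_gt0//= ler_pM2l// lef_pV2 ?posrE ?exprn_gt0//.
    by rewrite exprS -[leLHS]mulr1 ler_pM2l// exprn_ege1// ler1n.
  by rewrite exprS le_eqVlt; apply/orP; left; apply/eqP; field; rewrite expf_neq0.
exists V, (\row_l B l l); split=> //.
  have VV' := mulmx1C VV.
  rewrite -[diag_mx _](_ : B = _).
    by rewrite /B !mulmxA VV' mul1mx -mulmxA VV' mulmx1.
  apply/matrixP => i j; rewrite [RHS]mxE [X in _ = X *+ _]mxE.
  have [->|ij] := eqVneq i j; first by rewrite mulr1n.
  rewrite mulr0n; case: (ltngtP i j) => [/offdiag//|/offdiag|/val_inj/eqP].
    by rewrite BT.
  by rewrite (negbTE ij).
move=> i j; rewrite [leLHS]mxE [leRHS]mxE leq_eqVlt => /orP[/eqP/val_inj->//|]; exact: le_diag.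
Qed.

End Spectral.

(** * The spectral sign of an operator close to a reflection *)

Section Sign.
Context {R : realType}.

(** The map (3 s - s^3) / 2 fixes 1 and -1 with vanishing derivative. *)
Lemma sign_newton_le (s : R) (sg : R) : (sg = -1 /\ s < 0) \/ (sg = 1 /\ 0 <= s) ->
  `|sg - 2^-1 * (3 * s - s ^+ 3)| <= (s ^+ 2 - 1) ^+ 2.
Proof.
have pos (a : R) : 0 <= a -> `|1 - 2^-1 * (3 * a - a ^+ 3)| <= (a ^+ 2 - 1) ^+ 2.
  move=> a0; have -> : 1 - 2^-1 * (3 * a - a ^+ 3) = (a - 1) ^+ 2 * ((a + 2) / 2) by field.
  have -> : (a ^+ 2 - 1) ^+ 2 = (a - 1) ^+ 2 * (a + 1) ^+ 2 by ring.
  rewrite normrM ger0_norm ?sqr_ge0// ger0_norm; last by lra.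
  by apply: ler_wpM2l; [exact: sqr_ge0|nra].
move=> [[-> s0]|[-> /pos//]].
have := pos (- s); rewrite sqrrN oppr_ge0 => /(_ (ltW s0)).
rewrite -[X in X <= _]normrN; congr (`|_| <= _); ring.
Qed.

Lemma sign_dist_le (s : R) (sg : R) : (sg = -1 /\ s < 0) \/ (sg = 1 /\ 0 <= s) ->
  `|s - sg| <= `|s ^+ 2 - 1|.
Proof.
move=> [[-> s0]|[-> s0]].
  rewrite (_ : s ^+ 2 - 1 = (s - -1) * (s - 1)); last by ring.
  rewrite normrM ler_peMr// ler0_norm; lra.
rewrite (_ : s ^+ 2 - 1 = (s - 1) * (s + 1)); last by ring.
by rewrite normrM ler_peMr// ger0_norm; lra.
Qed.

Lemma card_ord_lt n i : (i <= n)%N -> #|[set j : 'I_n | (j < i)%N]%SET| = i.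
Proof.
move=> ilen; rewrite -sum1_card.
under eq_bigl do rewrite inE.
by rewrite -(big_ord_widen n (fun=> 1%N) ilen) sum1_card card_ord.
Qed.

(** The trace of an operator with spectrum close to {-1, 1} counts the
    negative eigenvalues. *)
Lemma negative_eigenvalues n k (s : 'rV[R]_n) (e : R) : (k <= n)%N ->
  (forall i, `|(s 0 i) ^+ 2 - 1| <= e) -> n%:R * e <= 1 / 4 ->
  `|\sum_i s 0 i - (n%:R - 2 * k%:R)| < 1 / 2 ->
  (forall i j : 'I_n, (i <= j)%N -> s 0 i <= s 0 j) ->
  forall i : 'I_n, (s 0 i < 0) = (i < k)%N.
Proof.
move=> kn se ne tr ord i.
pose sg (i : 'I_n) : R := if s 0 i < 0 then -1 else 1.
have sgP j : (sg j = -1 /\ s 0 j < 0) \/ (sg j = 1 /\ 0 <= s 0 j).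
  by rewrite /sg; case: ltP; [left|right].
have sum_sg : \sum_i s 0 i - \sum_i sg i = \sum_i (s 0 i - sg i) by rewrite sumrB.
have d1 : `|\sum_i s 0 i - \sum_i sg i| <= 1 / 4.
  rewrite sum_sg (le_trans (ler_norm_sum _ _ _))// (le_trans _ ne)//.
  apply: (@le_trans _ _ (\sum_(i < n) e)).
    by apply: ler_sum => j _; exact: le_trans (sign_dist_le (sgP j)) (se j).
  by rewrite sumr_const card_ord -[leLHS]mulr_natl.
pose N := #|[set j | s 0 j < 0]%SET|.
have sgE : \sum_i sg i = n%:R - 2 * N%:R.
  rewrite (eq_bigr (fun j => 1 - 2 * (s 0 j < 0)%R%:R)); last first.
    by move=> j _; rewrite /sg; case: ifP => _; rewrite ?mulr1n ?mulr0n; lra.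
  rewrite sumrB sumr_const card_ord -mulr_sumr; congr (_ - 2 * _).
  rewrite /N -sum1_card natr_sum big_mkcond [RHS]big_mkcond/=.
  by apply: eq_bigr => j _; rewrite inE; case: ifP.
have NE : N = k.
  apply/eqP; rewrite -(eqr_nat R); apply/negPn/negP => Nk.
  have : 1 <= `|N%:R - k%:R : R|.
    have [Nk'|kN|E] := ltngtP N k; last by rewrite E eqxx in Nk.
      by rewrite distrC ger0_norm ?subr_ge0 ?ler_nat ?(ltnW Nk')// -natrB ?(ltnW Nk')// ler1n subn_gt0.
    by rewrite ger0_norm ?subr_ge0 ?ler_nat ?(ltnW kN)// -natrB ?(ltnW kN)// ler1n subn_gt0.
  move: d1 tr; rewrite sgE ler_norml ltr_norml => /andP[a1 a2] /andP[b1 b2].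
  by rewrite leNgt => /negP; apply; rewrite ltr_norml; apply/andP; split; lra.
have [ik|ki] := ltnP i k.
  apply/negPn/negP; rewrite -leNgt => si.
  have : (N <= i)%N.
    rewrite -(card_ord_lt (ltnW (ltn_ord i))); apply: subset_leq_card.
    apply/fintype.subsetP => j; rewrite !inE ltnNge => sj; apply/negP => /ord.
    by move=> /(le_trans si); rewrite leNgt sj.
  by rewrite NE leqNgt ik.
apply/negbTE/negP => si.
have : (i.+1 <= N)%N.
  rewrite -(card_ord_lt (ltn_ord i)); apply: subset_leq_card.
  by apply/fintype.subsetP => j; rewrite !inE ltnS => /ord /le_lt_trans; apply.
by rewrite NE ltnNge ki.
Qed.

Context {d m : nat}.
Variable c : 'I_m -> 'rV[R]_d -> R.
Implicit Types (x : 'rV[R]_d) (A : 'M[R]_d).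

Lemma tangent_tproj x p (V : 'M[R]_(p, d)) :
  V *m (cgrad c x)^T = 0 -> V *m tproj c x = V.
Proof. by move=> H; rewrite mulmxBr mulmx1 !mulmxA H !mul0mx subr0. Qed.

Definition orthonormal_frame x (V : 'M[R]_(d - m, d)) :=
  [/\ V *m V^T = 1%:M, V *m (cgrad c x)^T = 0 & V^T *m V = tproj c x].

Lemma mxnorm_orthonormal p q (V : 'M[R]_(p, q)) : V *m V^T = 1%:M -> `|V| <= 1.
Proof.
move=> VV; apply: mxnorm_le => // i j.
have /matrixP/(_ i i) := VV; rewrite !mxE eqxx (bigD1 j)//= mxE => E.
rewrite -(@ler_pXn2r _ 2)// ?nnegrE// expr1n real_normK ?num_real// -[leRHS]E expr2.
by rewrite lerDl sumr_ge0// => l _; rewrite mxE -expr2 sqr_ge0.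
Qed.

Lemma mxnorm_conj p q (V : 'M[R]_(p, q)) (D : 'M[R]_p) : V *m V^T = 1%:M ->
  `|V^T *m D *m V| <= p%:R ^+ 2 * `|D|.
Proof.
move=> VV; have V1 := mxnorm_orthonormal VV.
rewrite (le_trans (mxnormM _ _))// expr2 -!mulrA ler_wpM2l//.
rewrite (@le_trans _ _ `|V^T *m D|)//; first by rewrite -[leRHS]mulr1 ler_wpM2l.
rewrite (le_trans (mxnormM _ _))// mxnorm_tr -mulrA ler_wpM2l//.
by rewrite -[leRHS]mul1r ler_wpM2r.
Qed.

Lemma mxnorm_conjT p q (V : 'M[R]_(p, q)) (D : 'M[R]_q) : V *m V^T = 1%:M ->
  `|V *m D *m V^T| <= q%:R ^+ 2 * `|D|.
Proof.
move=> VV; have V1 := mxnorm_orthonormal VV.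
rewrite (le_trans (mxnormM _ _))// mxnorm_tr expr2 -!mulrA ler_wpM2l//.
rewrite (@le_trans _ _ `|V *m D|)//; first by rewrite -[leRHS]mulr1 ler_wpM2l.
rewrite (le_trans (mxnormM _ _))// -mulrA ler_wpM2l//.
by rewrite -[leRHS]mul1r ler_wpM2r.
Qed.

Lemma mxnorm_diag p (s : 'rV[R]_p) (e : R) : 0 <= e ->
  (forall i, `|s 0 i| <= e) -> `|diag_mx s| <= e.
Proof.
move=> e0 se; apply: mxnorm_le => // i j; rewrite mxE.
by case: eqP => _; rewrite ?mulr1n ?mulr0n ?normr0.
Qed.

Lemma diag_conjM p q (V : 'M[R]_(p, q)) (s t : 'rV[R]_p) : V *m V^T = 1%:M ->
  (V^T *m diag_mx s *m V) *m (V^T *m diag_mx t *m V) =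
  V^T *m diag_mx (\row_i (s 0 i * t 0 i)) *m V.
Proof.
move=> VV; rewrite !mulmxA -[_ *m V *m V^T]mulmxA VV mulmx1.
by rewrite -[_ *m _ *m diag_mx t]mulmxA mulmx_diag.
Qed.

(** [orth] agrees with the Newton step (3 A - A^3) / 2 towards the sign of A, up
    to a term that is quadratic in the defect A^2 - P from being an involution
    of the tangent space: on each eigenvalue this is [sign_newton_le].  The
    trace condition makes the k-th spectral gap the one around 0. *)
Lemma orth_estimate (x : 'rV[R]_d) (V0 : 'M[R]_(d - m, d)) A k :
  orthonormal_frame x V0 -> (k <= d - m)%N ->
  A^T = A -> tproj c x *m A = A ->
  d%:R ^+ 2 * `|A *m A - tproj c x| <= 1 / (4 * (d - m).+1%:R) ->
  `|\tr A - ((d - m)%:R - 2 * k%:R)| < 1 / 2 ->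
  `|orth c k x A - 2^-1 *: (3 *: A - A *m A *m A)| <=
    (d - m)%:R ^+ 2 * (d%:R ^+ 2 * `|A *m A - tproj c x|) ^+ 2.
Proof.
set P := tproj c x; set n := (d - m)%N.
move=> [V0V0 V0C V0P] kn AT PA small trA.
have PT : P^T = P by rewrite /P -V0P trmx_mul trmxK.
have AP : A *m P = A by have := congr1 trmx PA; rewrite trmx_mul AT PT.
set q := d%:R ^+ 2 * _ in small *.
have q0 : 0 <= q by rewrite /q mulr_ge0// exprn_ge0.
have dif V s : eigendecomp c x A V s -> forall i, `|(s 0 i) ^+ 2 - 1| <= q.
  move=> [VV VC AE ord] i.
  have E : V *m (A *m A - P) *m V^T = diag_mx (\row_i ((s 0 i) ^+ 2 - 1)).
    rewrite mulmxBr mulmxBl tangent_tproj// VV {1 2}AE diag_conjM//.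
    rewrite !mulmxA VV mul1mx -mulmxA VV mulmx1; apply/matrixP => a b.
    rewrite !mxE; case: eqP => _; rewrite ?mulr1n ?mulr0n ?expr2//.
    by rewrite subr0.
  apply: le_trans (mxnorm_conjT (A *m A - P) VV); rewrite E.
  by apply: le_trans (mxnorm_ub _ i i); rewrite !mxE eqxx mulr1n.
have eig V s : eigendecomp c x A V s -> forall i, (s 0 i < 0) = (i < k)%N.
  move=> dec; have [VV VC AE ord] := dec.
  apply: (@negative_eigenvalues n k s (1 / (4 * n.+1%:R))) => //.
  - by move=> i; apply: le_trans small; exact: dif dec i.
  - rewrite mulrCA ler_pM2l// invfM mulrCA -[leRHS]mulr1 ler_pM2l ?invr_gt0//.
    by rewrite ler_pdivrMr// mul1r ler_nat.
  - move: trA; rewrite AE -mulmxA mxtrace_mulC -mulmxA VV mulmx1.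
    by rewrite mxtrace_diag.
have : (exists B, [set B | exists V s,
    [/\ eigendecomp c x A V s,
        forall i j : 'I_(d - m), (i < k)%N -> (k <= j)%N -> s 0 i < s 0 j &
        B = V^T *m diag_mx (\row_i (if (i < k)%N then -1 else 1)) *m V]] B).
  have VAT : (V0 *m A *m V0^T)^T = V0 *m A *m V0^T.
    by rewrite !trmx_mul trmxK AT mulmxA.
  have [W [s [WW BE ord]]] := symmetric_spectral VAT.
  have dec : eigendecomp c x A (W *m V0) s.
    split=> //.
    - by rewrite trmx_mul mulmxA -[_ *m _ *m V0^T]mulmxA V0V0 mulmx1.
    - by rewrite -mulmxA V0C mulmx0.
    - have -> : (W *m V0)^T *m diag_mx s *m (W *m V0) =
               V0^T *m (W^T *m diag_mx s *m W) *m V0 by rewrite trmx_mul !mulmxA.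
      by rewrite -BE !mulmxA V0P -mulmxA V0P -/P PA AP.
  exists ((W *m V0)^T *m diag_mx (\row_i (if (i < k)%N then -1 else 1)) *m (W *m V0)).
  exists (W *m V0), s; split=> // i j ik kj.
  have := eig _ _ dec i; have := eig _ _ dec j; rewrite ik ltnNge kj/= => /negbT.
  by rewrite -leNgt => sj si; exact: lt_le_trans si sj.
move=> /(xgetPex 0); rewrite -/(orth c k x A) => -[V [s [dec _ ->]]].
have sE := eig _ _ dec; have [VV VC AE _] := dec.
have AAE : A *m A *m A = V^T *m diag_mx (\row_i (s 0 i) ^+ 3) *m V.
  rewrite {1 2 3}AE !diag_conjM//; congr (_ *m diag_mx _ *m _).
  by apply/rowP => i; rewrite !mxE; ring.
pose t := \row_i ((if (i < k)%N then -1 else 1) - 2^-1 * (3 * s 0 i - s 0 i ^+ 3)).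
have -> : V^T *m diag_mx (\row_i (if (i < k)%N then -1 else 1)) *m V -
    2^-1 *: (3 *: A - A *m A *m A) = V^T *m diag_mx t *m V.
  rewrite AAE AE.
  have -> : diag_mx t = diag_mx (\row_i (if (i < k)%N then -1 else 1)) -
      2^-1 *: (3 *: diag_mx s - diag_mx (\row_i (s 0 i) ^+ 3)).
    apply/matrixP => a b; rewrite !mxE.
    by case: eqP => _; rewrite ?mulr1n ?mulr0n//; lra.
  by rewrite !(mulmxBr, mulmxBl, =^~ scalemxAr, =^~ scalemxAl).
apply: le_trans (mxnorm_conj _ VV) _; rewrite ler_wpM2l ?exprn_ge0//.
apply: mxnorm_diag => [|i]; first exact: sqr_ge0.
rewrite mxE; apply: (@le_trans _ _ ((s 0 i ^+ 2 - 1) ^+ 2)).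
  apply: sign_newton_le; rewrite -sE; case: ltP => si; [by left|by right].
rewrite -real_normK ?num_real// lerXn2r ?nnegrE//; exact: dif dec i.
Qed.

End Sign.

(** * Differentials of matrix-valued maps *)

Section MatrixDifferentials.
Context {R : realType} {V : normedModType R}.

Lemma mx_continuous_at (T : topologicalType) m n (F : T -> 'M[R]_(m, n)) p :
  (forall i j, {for p, continuous (fun x => F x i j)}) -> {for p, continuous F}.
Proof.
move=> H; apply/cvgrPdist_le => /= e e0; near=> x.
rewrite /Num.Def.normr/= mx_normrE (bigmax_le _ (ltW e0))//= => i _.
rewrite !mxE; move: i; near: x; apply: filter_forall => /= i.
exact: ((cvgrPdist_le _ _).1 (H i.1 i.2)).
Unshelve. all: by end_near. Qed.

Lemma near_mx_le (T : Type) (G : set_system T) (FG : Filter G) m n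
    (F : T -> 'M[R]_(m, n)) (b : T -> R) :
  (forall x, 0 <= b x) ->
  (forall i j, \forall x \near G, `|F x i j| <= b x) ->
  \forall x \near G, `|F x| <= b x.
Proof.
move=> b0 H; near=> x; apply: mxnorm_le => // i j.
suff : forall k : 'I_m * 'I_n, `|F x k.1 k.2| <= b x by move=> /(_ (i, j)).
near: x; apply: filter_forall => -[i' j']; exact: H.
Unshelve. all: by end_near. Qed.

Lemma is_diff_mxP m n (F : V -> 'M[R]_(m, n)) (p : V) (dF : V -> 'M[R]_(m, n)) :
  (forall i j, is_diff p (fun x => F x i j) (fun v => dF v i j)) ->
  is_diff p F dF.
Proof.
move=> H; have dFE i j v : dF v i j = 'd (fun x => F x i j) p v.
  by case: (H i j) => _ ->.
have dFlin : linear dF.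
  by move=> a u v; apply/matrixP => i j; rewrite !mxE !dFE linearP.
pose D : {linear V -> 'M[R]_(m, n)} :=
  HB.pack dF (GRing.isLinear.Build R V 'M[R]_(m, n) *:%R dF dFlin).
have : is_diff p F D; last by [].
apply: diff_of_littleo => [v|e e0].
  apply: mx_continuous_at => i j.
  have -> : (fun x => D x i j) = 'd (fun x => F x i j) p by apply/funext => x; exact: dFE.
  by have [Fd _] := H i j; exact: (diff_continuous Fd).
apply: near_mx_le => [y|i j]; first by rewrite mulr_ge0// ltW.
have [Fd FdE] := H i j; have := littleo_of_diff Fd e0.
by apply: filterS => y; rewrite !mxE/= dFE.
Qed.

Lemma is_diff_entry m n (F : V -> 'M[R]_(m, n)) (p : V) dF i j :
  is_diff p F dF -> is_diff p (fun x => F x i j) (fun v => dF v i j).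
Proof.
move=> H.
have -> : (fun v => dF v i j) = (fun N : 'M[R]_(m, n) => N i j) \o dF by [].
rewrite -[fun x => F x i j]/((fun N : 'M[R]_(m, n) => N i j) \o F).
apply: is_diff_comp.
have [lin_c] : differentiable (fun N : 'M[R]_(m, n) => N i j) (F p) /\ True.
  by split=> //; exact: differentiable_coord.
move=> _; apply: DiffDef => //.
have clin : linear (fun N : 'M[R]_(m, n) => N i j : R) by move=> a u v; rewrite !mxE.
pose D : {linear 'M[R]_(m, n) -> R^o} :=
  HB.pack (fun N : 'M[R]_(m, n) => N i j : R^o)
    (GRing.isLinear.Build R 'M[R]_(m, n) R^o *:%R _ clin).
have := @diff_lin R _ _ D (F p); apply.
by move=> N; exact: coord_continuous.
Qed.

Lemma is_diff_sum (I : finType) (F dF : I -> V -> R) p :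
  (forall i, is_diff p (F i) (dF i)) ->
  is_diff p (fun x => \sum_i F i x) (fun v => \sum_i dF i v).
Proof.
move=> H.
have E (G : I -> V -> R) : (fun x => \sum_i G i x) = \sum_(i in I) G i.
  by apply/funext => x; rewrite fct_sumE.
rewrite !E.
elim/big_ind2 : _ => // [|f df g dg ? ?]; [exact: is_diff_cst|exact: is_diffD].
Qed.

Lemma is_diff_mulmx m n q (A : V -> 'M[R]_(m, n)) (B : V -> 'M[R]_(n, q)) p dA dB :
  is_diff p A dA -> is_diff p B dB ->
  is_diff p (fun x => A x *m B x) (fun v => dA v *m B p + A p *m dB v).
Proof.
move=> HA HB; apply: is_diff_mxP => i j.
under [X in is_diff _ X _]eq_fun do rewrite mxE.
under [X in is_diff _ _ X]eq_fun do rewrite !mxE -big_split/=.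
apply: is_diff_sum => l.
have := is_diffM (is_diff_entry i l HA) (is_diff_entry l j HB).
move=> H; apply: is_diff_eq H _; apply/funext => v /=.
by rewrite -[LHS]/(A p i l * dB v l j + B p l j * dA v i l) addrC [B p l j * _]mulrC.
Qed.

Lemma is_diff_tr m n (A : V -> 'M[R]_(m, n)) p dA :
  is_diff p A dA -> is_diff p (fun x => (A x)^T) (fun v => (dA v)^T).
Proof.
move=> HA; apply: is_diff_mxP => i j.
under [X in is_diff _ X _]eq_fun do rewrite mxE.
under [X in is_diff _ _ X]eq_fun do rewrite mxE.
exact: is_diff_entry.
Qed.

Lemma is_diff_near (W : normedModType R) (F G : V -> W) p dF :
  {near p, F =1 G} -> is_diff p F dF -> is_diff p G dF.
Proof.
move=> FG [Fd <-].
apply: diff_of_littleo => [|e e0]; first exact: diff_continuous.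
rewrite -(nbhs_singleton FG).
have FG0 : \forall y \near (0 : V), F (y + p) = G (y + p).
  rewrite (near_shift p) /=; near=> y.
  by rewrite sub0r /comp/= subrK; near: y.
by near do rewrite -(near FG0 _)//; exact: littleo_of_diff.
Unshelve. all: by end_near. Qed.

(** A perturbation that is quadratic in a map vanishing at p does not change
    the differential at p. *)
Lemma is_diff_quadratic (W W' : normedModType R) (F G : V -> W) (h : V -> W') p dG dh (C : R) :
  is_diff p G dG -> is_diff p h dh -> h p = 0 ->
  (\forall u \near p, `|F u - G u| <= C * `|h u| ^+ 2) -> is_diff p F dG.
Proof.
move=> [Gd <-] [hd _] h0 H.
have FG : F p = G p.
  have := nbhs_singleton H; rewrite h0 normr0 expr0n mulr0 normr_le0.
  by rewrite subr_eq0 => /eqP.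
apply: diff_of_littleo => [|e e0]; first exact: diff_continuous.
have dhc : continuous ('d h p) by exact: diff_continuous.
have [k k0 hk] := linear_lipschitz dhc.
have C0 : 0 <= `|C| by [].
have H0 : \forall y \near (0 : V), `|F (y + p) - G (y + p)| <= C * `|h (y + p)| ^+ 2.
  rewrite (near_shift p) /=; near=> y.
  by rewrite sub0r /comp/= subrK; near: y.
have G1 : \forall y \near (0 : V), `|G (y + p) - (G p + 'd G p y)| <= e / 2 * `|y|.
  by apply: littleo_of_diff => //; rewrite divr_gt0.
have h1 : \forall y \near (0 : V), `|h (y + p) - (h p + 'd h p y)| <= 1 * `|y|.
  exact: littleo_of_diff.
pose K := (`|C| + 1) * (1 + k) ^+ 2.
have K0 : 0 < K by rewrite mulr_gt0 ?exprn_gt0 ?ltr_wpDl ?ltr_wpDr//; lra.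
have y1 : \forall y \near (0 : V), `|y| <= e / 2 / K.
  by apply: nbhs0_le; rewrite !divr_gt0.
near=> y.
have A1 := near H0 y _; have A2 := near G1 y _; have A3 := near h1 y _; have A4 := near y1 y _.
have {}A1 : `|F (y + p) - G (y + p)| <= C * `|h (y + p)| ^+ 2 by exact: A1.
have {}A2 : `|G (y + p) - (G p + 'd G p y)| <= e / 2 * `|y| by exact: A2.
have {}A3 : `|h (y + p) - (h p + 'd h p y)| <= 1 * `|y| by exact: A3.
have {}A4 : `|y| <= e / 2 / K by exact: A4.
have hy : `|h (y + p)| <= (1 + k) * `|y|.
  rewrite -[h (y + p)](subrK (h p + 'd h p y)) (le_trans (ler_normD _ _))//.
  by rewrite mulrDl lerD// h0 add0r.
have : C * `|h (y + p)| ^+ 2 <= e / 2 * `|y|.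
  apply: (@le_trans _ _ ((`|C| + 1) * ((1 + k) * `|y|) ^+ 2)).
    apply: (@le_trans _ _ ((`|C| + 1) * `|h (y + p)| ^+ 2)).
      by rewrite ler_wpM2r ?sqr_ge0//; have := ler_norm C; lra.
    by rewrite ler_wpM2l ?addr_ge0// lerXn2r ?nnegrE ?mulr_ge0//; lra.
  rewrite exprMn mulrA -/K expr2 mulrA ler_wpM2r//.
  by rewrite -ler_pdivlMl// mulrC.
move=> A5; rewrite FG.
have -> : F (y + p) - (G p + 'd G p y) =
   (F (y + p) - G (y + p)) + (G (y + p) - (G p + 'd G p y)) by rewrite addrA subrK.
rewrite (le_trans (ler_normD _ _))//; lra.
Unshelve. all: by end_near. Qed.

End MatrixDifferentials.

Section LinearMaps.
Context {R : realType}.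

Lemma rowvec_linear_bound (W : normedModType R) N (f : {linear 'rV[R]_N -> W}) :
  forall u, `|f u| <= (\sum_i `|f (delta_mx 0 i)|) * `|u|.
Proof.
move=> u; rewrite {1}[u]row_sum_delta linear_sum (le_trans (ler_norm_sum _ _ _))//.
rewrite mulr_suml; apply: ler_sum => i _.
by rewrite linearZ normrZ mulrC ler_wpM2l// mxnorm_ub.
Qed.

Lemma rowvec_linear_continuous (W : normedModType R) N (f : {linear 'rV[R]_N -> W}) :
  continuous f.
Proof.
apply: bounded_linear_continuous; apply/linear_boundedP.
exists (\sum_i `|f (delta_mx 0 i)|); split; first by rewrite num_real.
move=> x xM u; apply: le_trans (rowvec_linear_bound f u) _.
by rewrite ler_wpM2r// ltW.
Qed.

Lemma is_diff_rowvec_linear (W : normedModType R) N (f : 'rV[R]_N -> W) p :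
  linear f -> is_diff p f f.
Proof.
move=> flin; pose D : {linear 'rV[R]_N -> W} :=
  HB.pack f (GRing.isLinear.Build R 'rV[R]_N W *:%R f flin).
have : is_diff p D D; last by [].
have Dc := @rowvec_linear_continuous W N D.
apply: DiffDef; last exact: diff_lin.
exact: linear_differentiable.
Qed.

End LinearMaps.

(** * Second-order equations with a small quadratic right-hand side *)

Section Clamp.
Context {R : realType}.

(** Freezes time outside [a, b], so that curves and their bounds are global. *)
Definition clamp (a b t : R) := Num.max a (Num.min t b).

Lemma clamp_in a b t : a <= b -> a <= clamp a b t <= b.
Proof. by move=> ab; rewrite /clamp le_max lexx/= ge_max ab ge_min lexx orbT. Qed.

Lemma clamp_id a b t : a <= t <= b -> clamp a b t = t.
Proof. by move=> /andP[a_ t_]; rewrite /clamp min_l// max_r. Qed.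

Lemma clamp_lip a b s t : `|clamp a b s - clamp a b t| <= `|s - t|.
Proof.
rewrite /clamp ler_norml !maxEle !minEle.
have /ler_normlP[] : `|s - t| <= `|s - t| by [].
move=> H1 H2; case: (lerP s b) => ?; case: (lerP t b) => ?;
  case: (lerP a s) => ?; case: (lerP a t) => ?; case: (lerP a b) => ?; lra.
Qed.

End Clamp.

Section Prim.
Context {R : realType} {d : nat}.
Implicit Types a : R -> 'rV[R]_d.

Definition is_prim a (F : R -> 'rV[R]_d) :=
  F 0 = 0 /\ forall t : R, -4 < t -> is_derive t (1 : R) F (a t).

(** A primitive chosen for every curve at once, so that operators on curves are
    plain functions. *)
Definition prim a : R -> 'rV[R]_d :=
  if pselect (exists F, is_prim a F) is left e then sval (cid e) else fun=> 0.

Lemma primP a k : (forall s t, `|a s - a t| <= k * `|s - t|) -> is_prim a (prim a).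
Proof.
move=> alip; rewrite /prim; case: pselect => [e|]; first by case: cid.
case; apply: mx_primitive_ex => i j t; apply/cvgrPdist_le => e e0.
have k0 : 0 < `|k| + 1 by rewrite ltr_wpDl.
near=> s.
have /= -> : a t i j - a s i j = (a t - a s) i j by rewrite !mxE.
apply: le_trans (mxnorm_ub _ _ _) _; apply: le_trans (alip _ _) _.
apply: (@le_trans _ _ ((`|k| + 1) * `|t - s|)).
  by rewrite ler_wpM2r//; have := ler_norm k; lra.
rewrite mulrC -ler_pdivlMr//.
near: s; apply: cvgr_dist_le; last by rewrite divr_gt0.
exact: cvg_id.
Unshelve. all: by end_near. Qed.

Lemma prim_le a k b t : (forall s t, `|a s - a t| <= k * `|s - t|) ->
  (forall s, `|a s| <= b) -> -4 < t -> `|prim a t| <= b * `|t|.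
Proof.
move=> /primP[a0 da] ab t4; rewrite -[prim a t]subr0 -a0 -{2}[t]subr0.
apply: mvt_mx_abs => s // /andP[]; rewrite ge_min => /orP[]s0 _; apply: da => //; lra.
Qed.

Lemma prim_lip a k b s t : (forall s t, `|a s - a t| <= k * `|s - t|) ->
  (forall s, `|a s| <= b) -> -4 < s -> -4 < t ->
  `|prim a s - prim a t| <= b * `|s - t|.
Proof.
move=> /primP[a0 da] ab s4 t4.
apply: mvt_mx_abs => u // /andP[]; rewrite ge_min => /orP[]u0 _; apply: da => //; lra.
Qed.

Lemma prim_dist a a' k k' e t : (forall s t, `|a s - a t| <= k * `|s - t|) ->
  (forall s t, `|a' s - a' t| <= k' * `|s - t|) ->
  (forall s, `|a s - a' s| <= e) -> -4 < t -> `|prim a t - prim a' t| <= e * `|t|.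
Proof.
move=> /primP[a0 da] /primP[a'0 da'] ae t4.
have -> : prim a t - prim a' t = (prim a t - prim a' t) - (prim a 0 - prim a' 0).
  by rewrite a0 a'0 !subr0.
rewrite -{3}[t]subr0.
apply: (@mvt_mx_abs _ _ _ (fun t => prim a t - prim a' t) (fun t => a t - a' t)) => s // /andP[].
rewrite ge_min => /orP[]s0 _.
  by apply: is_deriveB; [apply: da|apply: da']; lra.
by apply: is_deriveB; [apply: da|apply: da']; lra.
Qed.

End Prim.

Section ODE.
Context {R : realType} {d : nat}.
Variables (xs : 'rV[R]_d) (B : 'rV[R]_d -> 'rV[R]_d -> 'M[R]_d) (r Lam : R).
Hypotheses (d_gt0 : (0 < d)%N) (r_gt0 : 0 < r) (Lam_ge1 : 1 <= Lam).
Hypothesis B_bound : forall x w, `|x - xs| <= r -> `|B x w| <= Lam * `|w|.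
Hypothesis B_lip : forall x y w, `|x - xs| <= r -> `|y - xs| <= r ->
  `|B x w - B y w| <= Lam * `|x - y| * `|w|.
Hypothesis B_sub : forall x w1 w2, B x (w1 - w2) = B x w1 - B x w2.

Let D : R := d%:R * Lam.

Let D_ge1 : 1 <= D.
Proof. by rewrite /D -[leLHS]mulr1 ler_pM// ler1n. Qed.

(** The right-hand side w B(x, w) is quadratic in the velocity w: this is what
    makes it negligible on a unit of time for small velocities. *)
Lemma acc_le x w : `|x - xs| <= r -> `|w *m B x w| <= D * `|w| ^+ 2.
Proof.
move=> xr; apply: le_trans (mxnormM _ _) _.
rewrite /D expr2 -!mulrA ler_wpM2l// mulrCA ler_wpM2l//; exact: B_bound.
Qed.

Lemma acc_lip x1 x2 w1 w2 : `|x1 - xs| <= r -> `|x2 - xs| <= r ->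
  `|w1 *m B x1 w1 - w2 *m B x2 w2| <=
  D * (`|w1 - w2| * (`|w1| + `|w2|) + `|x1 - x2| * (`|w1| * `|w2|)).
Proof.
move=> x1r x2r.
have -> : w1 *m B x1 w1 - w2 *m B x2 w2 =
  (w1 - w2) *m B x1 w1 + (w2 *m (B x1 w1 - B x2 w1) + w2 *m B x2 (w1 - w2)).
  by rewrite B_sub !mulmxBr mulmxBl addrA subrKA subrKA.
have H1 : `|(w1 - w2) *m B x1 w1| <= D * (`|w1 - w2| * `|w1|).
  apply: le_trans (mxnormM _ _) _; rewrite /D -!mulrA ler_wpM2l// mulrCA ler_wpM2l//.
  exact: B_bound.
have H2 : `|w2 *m (B x1 w1 - B x2 w1)| <= D * (`|x1 - x2| * (`|w1| * `|w2|)).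
  apply: le_trans (mxnormM _ _) _; rewrite /D -!mulrA ler_wpM2l//.
  apply: le_trans (ler_wpM2l (normr_ge0 _) (B_lip _ x1r x2r)) _.
  by rewrite -!mulrA mulrC -!mulrA.
have H3 : `|w2 *m B x2 (w1 - w2)| <= D * (`|w1 - w2| * `|w2|).
  apply: le_trans (mxnormM _ _) _; rewrite /D -!mulrA ler_wpM2l//.
  apply: le_trans (ler_wpM2l (normr_ge0 _) (B_bound _ x2r)) _.
  by rewrite mulrC -!mulrA.
have := ler_normD ((w1 - w2) *m B x1 w1) (w2 *m (B x1 w1 - B x2 w1) + w2 *m B x2 (w1 - w2)).
have := ler_normD (w2 *m (B x1 w1 - B x2 w1)) (w2 *m B x2 (w1 - w2)).
by move=> K1 K2; rewrite !mulrDr; lra.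
Qed.

Section Existence.
Variables (theta eta : R) (p q : 'rV[R]_d).
Hypotheses (theta01 : 0 <= theta <= 1) (eta_r : 20 * eta <= r) (eta_D : 480 * D * eta <= 1).
Hypotheses (p_near : `|p - xs| <= r / 4) (q_small : `|q| <= eta).

Let I t := clamp (-1) 2 t : R.
Let I_in t : -1 <= I t <= 2. Proof. apply: clamp_in; lra. Qed.
Let P (a : R -> 'rV[R]_d) := prim a.
Let S (a : R -> 'rV[R]_d) := prim (fun t => P a (I t)).
Let dg a t := q + P a t - theta *: S a 1.
Let g a t := p + t *: q + S a t - (theta * t) *: S a 1.
Let F a t := dg a (I t) *m B (g a (I t)) (dg a (I t)).

Let abs_le2 (t : R) : -1 <= t <= 2 -> `|t| <= 2.
Proof. by move=> t_; rewrite ler_norml; lra. Qed.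

Let P_le b k a t : bdd_lip b k a -> -1 <= t <= 2 -> `|P a t| <= 2 * b.
Proof.
move=> [ab ak] t_; have b0 : 0 <= b := le_trans (normr_ge0 _) (ab 0).
apply: (le_trans (prim_le ak ab _)); first by lra.
by rewrite mulrC ler_wpM2r// abs_le2.
Qed.

Let P_lip b k a s t : bdd_lip b k a -> `|P a (I s) - P a (I t)| <= b * `|s - t|.
Proof.
move=> [ab ak]; have b0 : 0 <= b := le_trans (normr_ge0 _) (ab 0).
have := I_in s; have := I_in t => ? ?.
apply: (le_trans (prim_lip ak ab _ _)); [lra..|].
by rewrite ler_wpM2l// clamp_lip.
Qed.

Let PI_le b k a : bdd_lip b k a -> forall s, `|P a (I s)| <= 2 * b.
Proof. by move=> aA s; exact: P_le aA (I_in s). Qed.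

Let S_le b k a t : bdd_lip b k a -> -1 <= t <= 2 -> `|S a t| <= 2 * b * `|t|.
Proof.
move=> aA t_; apply: (prim_le (fun s t => P_lip s t aA) (PI_le aA)); lra.
Qed.

Let S1_le b k a : bdd_lip b k a -> `|theta *: S a 1| <= 2 * b.
Proof.
move=> aA; have := @S_le _ _ a 1 aA; rewrite normr1 mulr1 => H.
have /andP[t0 t1] := theta01; rewrite normrZ (ger0_norm t0).
have {}H : `|S a 1| <= 2 * b by apply: H; lra.
have := normr_ge0 (S a 1); nra.
Qed.

Let S_lip b k a s t : bdd_lip b k a -> -1 <= s <= 2 -> -1 <= t <= 2 ->
  `|S a s - S a t| <= 2 * b * `|s - t|.
Proof.
move=> aA s_ t_; apply: (prim_lip (fun s t => P_lip s t aA) (PI_le aA)); lra.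
Qed.

Let dg_le k a t : bdd_lip `|q| k a -> -1 <= t <= 2 -> `|dg a t| <= 5 * `|q|.
Proof.
move=> aA t_; have := P_le aA t_; have := S1_le aA.
have := ler_normB (q + P a t) (theta *: S a 1); have := ler_normD q (P a t).
rewrite /dg; lra.
Qed.

Let g_in k a t : bdd_lip `|q| k a -> -1 <= t <= 2 -> `|g a t - xs| <= r.
Proof.
move=> aA t_; have t2 := abs_le2 t_.
have H1 := S_le aA t_; have H2 := S1_le aA.
have H3 : `|t *: q| <= 2 * `|q| by rewrite normrZ ler_wpM2r.
have H4 : `|(theta * t) *: S a 1| <= 2 * (2 * `|q|).
  by rewrite mulrC -scalerA normrZ ler_pM.
have q0 : 0 <= `|q| by [].
have H5 : `|S a t| <= 2 * `|q| * 2.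
  by apply: le_trans H1 _; rewrite ler_wpM2l// mulr_ge0.
have -> : g a t - xs = (p - xs) + (t *: q + (S a t - (theta * t) *: S a 1)).
  by apply/matrixP => i j; rewrite /g !mxE; ring.
have := ler_normD (p - xs) (t *: q + (S a t - (theta * t) *: S a 1)).
have := ler_normD (t *: q) (S a t - (theta * t) *: S a 1).
have := ler_normB (S a t) ((theta * t) *: S a 1).
have pn : `|p - xs| <= r / 4 := p_near; have qs : `|q| <= eta := q_small; have er := eta_r.
lra.
Qed.

Let Dq : 480 * D * `|q| <= 1.
Proof.
have H : 0 <= 480 * D by have := D_ge1; lra.
exact: le_trans (ler_wpM2l H q_small) eta_D.
Qed.

Let q_le1 : `|q| <= 1.
Proof. have := normr_ge0 q; have := Dq; have := D_ge1; nra. Qed.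

Let F_adm a : bdd_lip `|q| `|q| a -> bdd_lip `|q| `|q| (F a).
Proof.
move=> aA; have q0 : 0 <= `|q| by []; have DD := D_ge1.
split=> [t|s t].
  apply: le_trans (acc_le _ (g_in aA (I_in t))) _.
  have H : `|dg a (I t)| ^+ 2 <= (5 * `|q|) ^+ 2.
    by rewrite lerXn2r ?nnegrE ?mulr_ge0//; exact: dg_le aA (I_in t).
  apply: le_trans (ler_wpM2l _ H) _; first by lra.
  have -> : D * (5 * `|q|) ^+ 2 = 25 * D * `|q| * `|q| by ring.
  by rewrite -[leRHS]mul1r ler_wpM2r//; have := Dq; nra.
apply: le_trans (acc_lip _ _ (g_in aA (I_in s)) (g_in aA (I_in t))) _.
have h0 := normr_ge0 (s - t).
have e1 : `|dg a (I s) - dg a (I t)| <= `|q| * `|s - t|.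
  have -> : dg a (I s) - dg a (I t) = P a (I s) - P a (I t).
    by apply/matrixP => i j; rewrite /dg !mxE; ring.
  exact: P_lip aA.
have e2 : `|g a (I s) - g a (I t)| <= 5 * `|q| * `|s - t|.
  have -> : g a (I s) - g a (I t) = (I s - I t) *: q + (S a (I s) - S a (I t))
      - (I s - I t) *: (theta *: S a 1).
    by apply/matrixP => i j; rewrite /g !mxE; ring.
  have c_ := clamp_lip (-1) 2 s t.
  have := ler_normB ((I s - I t) *: q + (S a (I s) - S a (I t))) ((I s - I t) *: (theta *: S a 1)).
  have := ler_normD ((I s - I t) *: q) (S a (I s) - S a (I t)).
  have H1 : `|(I s - I t) *: q| <= `|q| * `|s - t| by rewrite normrZ mulrC ler_wpM2l.
  have H2 : `|(I s - I t) *: (theta *: S a 1)| <= 2 * `|q| * `|s - t|.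
    by rewrite normrZ mulrC ler_pM//; exact: S1_le aA.
  have H3 : `|S a (I s) - S a (I t)| <= 2 * `|q| * `|s - t|.
    apply: le_trans (S_lip aA (I_in s) (I_in t)) _.
    by rewrite ler_wpM2l// mulr_ge0.
  lra.
have f1 := dg_le aA (I_in s); have f2 := dg_le aA (I_in t).
apply: (@le_trans _ _ (D * (`|q| * `|s - t| * (10 * `|q|) +
   5 * `|q| * `|s - t| * (5 * `|q| * (5 * `|q|))))).
  rewrite ler_wpM2l; [|lra|] => //.
  rewrite lerD// ler_pM ?addr_ge0 ?mulr_ge0//; first by lra.
  by rewrite ler_pM.
have -> : D * (`|q| * `|s - t| * (10 * `|q|) +
   5 * `|q| * `|s - t| * (5 * `|q| * (5 * `|q|))) =
   (D * `|q| * (10 + 125 * `|q|)) * (`|q| * `|s - t|) by ring.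
rewrite -[leRHS]mul1r ler_wpM2r ?mulr_ge0//.
have Dq0 : 0 <= D * `|q| by rewrite mulr_ge0//; lra.
have := Dq; have := q_le1; nra.
Qed.

Let F_contr a a' e : bdd_lip `|q| `|q| a -> bdd_lip `|q| `|q| a' ->
  (forall t, `|a t - a' t| <= e) -> forall t, `|F a t - F a' t| <= e / 2.
Proof.
move=> aA a'A ae t; have q0 : 0 <= `|q| by []; have DD := D_ge1.
have e0 : 0 <= e := le_trans (normr_ge0 _) (ae 0).
have [ab ak] := aA; have [a'b a'k] := a'A.
apply: le_trans (acc_lip _ _ (g_in aA (I_in t)) (g_in a'A (I_in t))) _.
have P_d s : -1 <= s <= 2 -> `|P a s - P a' s| <= 2 * e.
  move=> s_; apply: (le_trans (prim_dist ak a'k ae _)); first by lra.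
  by rewrite mulrC ler_wpM2r// abs_le2.
have S_d s : -1 <= s <= 2 -> `|S a s - S a' s| <= 2 * e * `|s|.
  move=> s_; apply: (prim_dist (fun s t => P_lip s t aA) (fun s t => P_lip s t a'A)); last by lra.
  by move=> u; exact: P_d (I_in u).
have S1_d : `|theta *: (S a 1 - S a' 1)| <= 2 * e.
  have := S_d 1; rewrite normr1 mulr1 => H.
  have {}H : `|S a 1 - S a' 1| <= 2 * e by apply: H; lra.
  have /andP[t0 t1] := theta01; rewrite normrZ (ger0_norm t0).
  have := normr_ge0 (S a 1 - S a' 1); nra.
have It := I_in t; have I2 := abs_le2 It.
have e1 : `|dg a (I t) - dg a' (I t)| <= 4 * e.
  have -> : dg a (I t) - dg a' (I t) = (P a (I t) - P a' (I t)) - theta *: (S a 1 - S a' 1).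
    by apply/matrixP => i j; rewrite /dg !mxE; ring.
  have := ler_normB (P a (I t) - P a' (I t)) (theta *: (S a 1 - S a' 1)).
  have := P_d _ It; lra.
have e2 : `|g a (I t) - g a' (I t)| <= 8 * e.
  have -> : g a (I t) - g a' (I t) = (S a (I t) - S a' (I t)) - I t *: (theta *: (S a 1 - S a' 1)).
    by apply/matrixP => i j; rewrite /g !mxE; ring.
  have := ler_normB (S a (I t) - S a' (I t)) (I t *: (theta *: (S a 1 - S a' 1))).
  have : `|S a (I t) - S a' (I t)| <= 2 * e * 2.
    by apply: le_trans (S_d _ It) _; rewrite ler_wpM2l ?mulr_ge0.
  have : `|I t *: (theta *: (S a 1 - S a' 1))| <= 2 * (2 * e) by rewrite normrZ ler_pM.
  lra.
have f1 := dg_le aA It; have f2 := dg_le a'A It.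
apply: (@le_trans _ _ (D * (4 * e * (10 * `|q|) + 8 * e * (5 * `|q| * (5 * `|q|))))).
  rewrite ler_wpM2l; [|lra|] => //.
  rewrite lerD// ler_pM ?addr_ge0 ?mulr_ge0//; first by lra.
  by rewrite ler_pM.
have -> : D * (4 * e * (10 * `|q|) + 8 * e * (5 * `|q| * (5 * `|q|))) =
   (D * `|q| * (40 + 200 * `|q|)) * e by ring.
rewrite mulrC ler_wpM2l//.
have Dq0 : 0 <= D * `|q| by rewrite mulr_ge0//; lra.
have := Dq; have := q_le1; nra.
Qed.

(** With theta = 0 this solves the initial value problem for (p, q), with
    theta = 1 the boundary value problem from p to p + q: the solution is
    p + t q plus the double primitive of its acceleration, corrected by a
    multiple of t.  For small q the acceleration is the fixed point of a
    contraction. *)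
Lemma ode_exists : exists (g dg : R -> 'rV[R]_d),
  [/\ forall t : R, -1 <= t <= 2 -> [/\ is_derive t (1 : R) g (dg t),
        is_derive t (1 : R) dg (dg t *m B (g t) (dg t)), `|g t - xs| <= r &
        `|dg t| <= 5 * `|q| /\ `|dg t - q| <= 100 * D * `|q| ^+ 2],
      g 0 = p, (theta = 0 -> dg 0 = q), (theta = 1 -> g 1 = p + q) &
      `|g 1 - (p + q)| <= 100 * D * `|q| ^+ 2].
Proof.
have q0 : 0 <= `|q| by [].
have [a aA Fa] := curve_fixed_point q0 q0 F_adm F_contr.
have [ab ak] := aA.
have [P0 dP] := primP ak.
have [S0 dS] := primP (fun s t => P_lip s t aA).
have {}P0 : P a 0 = 0 by []. have {}S0 : S a 0 = 0 by [].
have a_le t : `|a t| <= 25 * D * `|q| ^+ 2.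
  rewrite -Fa; apply: le_trans (acc_le _ (g_in aA (I_in t))) _.
  have H : `|dg a (I t)| ^+ 2 <= (5 * `|q|) ^+ 2.
    by rewrite lerXn2r ?nnegrE ?mulr_ge0//; exact: dg_le aA (I_in t).
  have D0 : 0 <= D by have := D_ge1; lra.
  by apply: le_trans (ler_wpM2l D0 H) _; rewrite exprMn; lra.
have aA' : bdd_lip (25 * D * `|q| ^+ 2) `|q| a by split.
have b0 : 0 <= 25 * D * `|q| ^+ 2 := le_trans (normr_ge0 _) (a_le 0).
have S1 := S1_le aA'.
exists (g a), (dg a); split.
- move=> t t_; split.
  + have dS' : is_derive t (1 : R) (S a) (P a t).
      by rewrite -[X in P a X](@clamp_id _ (-1) 2 t)//; apply: dS; lra.
    have dlin (v : 'rV[R]_d) : is_derive t (1 : R) (fun t : R => t *: v) v.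
      apply/is_derive_mxP => i j; under [X in is_derive _ _ X _]eq_fun do rewrite mxE.
      rewrite -[fun x : R => _]/((@id R) * (fun=> v i j)).
      by apply: is_derive_eq; rewrite scaler0 add0r /GRing.scale/= mulr1.
    have -> : g a = (fun=> p) + (fun t => t *: q) + S a - (fun t => t *: (theta *: S a 1)).
      by apply/funext => s; rewrite /g [LHS]/= -[RHS]/(p + s *: q + S a s - s *: (theta *: S a 1)) scalerA [s * theta]mulrC.
    have := is_deriveB (is_deriveD (is_deriveD (is_derive_cst p t 1) (dlin q)) dS') (dlin (theta *: S a 1)).
    by rewrite add0r.
  + have -> : dg a t *m B (g a t) (dg a t) = a t.
      by rewrite -[RHS]Fa /F /I clamp_id.
    have -> : dg a = (fun=> q) + P a - (fun=> theta *: S a 1) by [].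
    have dP' : is_derive t (1 : R) (P a) (a t) by apply: dP; lra.
    have := is_deriveB (is_deriveD (is_derive_cst q t 1) dP') (is_derive_cst (theta *: S a 1) t 1).
    by rewrite add0r subr0.
  + exact: g_in aA t_.
  + split; first exact: dg_le aA t_.
    have -> : dg a t - q = P a t - theta *: S a 1.
      by apply/matrixP => i j; rewrite /dg !mxE; ring.
    have := ler_normB (P a t) (theta *: S a 1); have := P_le aA' t_; lra.
- by rewrite /g S0 scale0r mulr0 scale0r !addr0 subr0.
- by move=> th; rewrite /dg P0 th scale0r addr0 subr0.
- by move=> th; rewrite /g th mulr1 !scale1r addrK.
- have -> : g a 1 - (p + q) = S a 1 - theta *: S a 1.
    by apply/matrixP => i j; rewrite /g !mxE; ring.
  have : `|S a 1| <= 2 * (25 * D * `|q| ^+ 2).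
    by have := @S_le _ _ a 1 aA'; rewrite normr1 mulr1; apply; lra.
  have := ler_normB (S a 1) (theta *: S a 1); lra.
Qed.

End Existence.

Lemma within01_continuous (f : R -> R) :
  (forall t : R, 0 <= t <= 1 -> {for t, continuous f}) -> {within `[0, 1], continuous f}.
Proof.
by move=> H; apply: continuous_in_subspaceT => t; rewrite inE/= in_itv/=; exact: H.
Qed.

(** A difference h of two solutions satisfies |h''| <= |h'| / 2 in sup norm,
    and each coordinate of h' vanishes somewhere: at 0 for equal initial
    velocities, and by Rolle's theorem for equal end points. *)
Lemma ode_unique (g1 dg1 g2 dg2 : R -> 'rV[R]_d) (s : R) :
  D * (2 * s + s ^+ 2) <= 1 / 2 ->
  (forall t : R, 0 <= t <= 1 -> [/\ is_derive t (1 : R) g1 (dg1 t),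
     is_derive t (1 : R) dg1 (dg1 t *m B (g1 t) (dg1 t)), `|g1 t - xs| <= r & `|dg1 t| <= s]) ->
  (forall t : R, 0 <= t <= 1 -> [/\ is_derive t (1 : R) g2 (dg2 t),
     is_derive t (1 : R) dg2 (dg2 t *m B (g2 t) (dg2 t)), `|g2 t - xs| <= r & `|dg2 t| <= s]) ->
  g1 0 = g2 0 -> (dg1 0 = dg2 0 \/ g1 1 = g2 1) ->
  forall t : R, 0 <= t <= 1 -> g1 t = g2 t /\ dg1 t = dg2 t.
Proof.
move=> sD H1 H2 g0 bc.
pose h t := g1 t - g2 t; pose dh t := dg1 t - dg2 t.
have dh_ (t : R) : 0 <= t <= 1 -> is_derive t (1 : R) h (dh t).
  by move=> t_; have [? _ _ _] := H1 t t_; have [? _ _ _] := H2 t t_; exact: is_deriveB.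
pose ddh t := dg1 t *m B (g1 t) (dg1 t) - dg2 t *m B (g2 t) (dg2 t).
have ddh_ (t : R) : 0 <= t <= 1 -> is_derive t (1 : R) dh (ddh t).
  by move=> t_; have [_ ? _ _] := H1 t t_; have [_ ? _ _] := H2 t t_; exact: is_deriveB.
have [||t0] := @EVT_max R (fun t => `|dh t|) 0 1; first exact: ler01.
  apply: within01_continuous => t t_.
  exact: (continuous_comp (is_derive_continuous (ddh_ t t_)) (@norm_continuous _ _ _)).
rewrite in_itv/= => t0_ tmax; set M := `|dh t0| in tmax.
have {}tmax (t : R) : 0 <= t <= 1 -> `|dh t| <= M by move=> t_; apply: tmax; rewrite in_itv.
have M0 : 0 <= M by exact: normr_ge0.
have h_le (t : R) : 0 <= t <= 1 -> `|h t| <= M * t.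
  move=> /andP[t0' t1].
  have h0 : h 0 = 0 by rewrite /h g0 subrr.
  rewrite -[h t]subr0 -h0 -{2}[t]subr0; apply: mvt_mx_le => // u /andP[? ?].
    by apply: dh_; lra.
  by apply: tmax; lra.
have h01 : 0 <= (0 : R) <= 1 by rewrite lexx ler01.
have s0 : 0 <= s by have [_ _ _] := H1 0 h01; exact: le_trans.
have ddh_le (t : R) : 0 <= t <= 1 -> `|ddh t| <= M / 2.
  move=> t_; have [_ _ g1r d1s] := H1 t t_; have [_ _ g2r d2s] := H2 t t_.
  apply: le_trans (acc_lip _ _ g1r g2r) _.
  have hM : `|g1 t - g2 t| <= M by apply: le_trans (h_le t t_) _; have := h_le t t_; nra.
  have dhM : `|dg1 t - dg2 t| <= M by exact: tmax.
  apply: (@le_trans _ _ (D * (M * (2 * s) + M * (s * s)))).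
    have D0 : 0 <= D by have := D_ge1; lra.
    have K : `|dg1 t| + `|dg2 t| <= 2 * s by lra.
    rewrite ler_wpM2l// lerD// ler_pM ?addr_ge0 ?mulr_ge0//.
    by rewrite ler_pM.
  have -> : D * (M * (2 * s) + M * (s * s)) = M * (D * (2 * s + s ^+ 2)) by ring.
  by rewrite ler_wpM2l// -[leRHS]mul1r.
have vanish j : exists2 u : R, 0 <= u <= 1 & dh u 0 j = 0.
  case: bc => [d0|g11].
    by exists 0; rewrite ?lexx ?ler01// /dh d0 subrr mxE.
  have hj (t : R) : 0 <= t <= 1 -> is_derive t (1 : R) (fun t => h t 0 j) (dh t 0 j).
    by move=> /dh_/is_derive_mxP.
  have [||||u u_ [_ du]] := @Rolle R (fun t => h t 0 j) 0 1.
  - exact: ltr01.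
  - by move=> u; rewrite in_itv/= => /andP[? ?]; have [|] := hj u; first by lra.
  - by apply: within01_continuous => t /hj/is_derive_continuous.
  - by rewrite /h g0 g11 !subrr.
  rewrite in_itv/= in u_.
  have u01 : 0 <= u <= 1 by lra.
  by exists u => //; have [_ <-] := hj u u01.
have Mle : M <= M / 2.
  apply: mxnorm_le => [|i j]; first by rewrite divr_ge0.
  rewrite ord1; have [u u_ du0] := vanish j.
  have -> : dh t0 0 j = (dh t0 - dh u) 0 j by rewrite [RHS]mxE [X in _ = _ + X]mxE du0 subr0.
  apply: le_trans (mxnorm_ub _ _ _) _.
  have : `|dh t0 - dh u| <= M / 2 * `|t0 - u|.
    apply: (@mvt_mx_abs _ _ _ dh ddh) => v; rewrite ge_min le_max => v_.
      by apply: ddh_; move: v_ => /andP[/orP[]? /orP[]?]; lra.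
    by apply: ddh_le; move: v_ => /andP[/orP[]? /orP[]?]; lra.
  have : `|t0 - u| <= 1 by rewrite ler_norml; lra.
  have := normr_ge0 (t0 - u); nra.
have {}M0 : M = 0 by lra.
move=> t t_; split; apply/eqP; rewrite -subr_eq0 -normr_le0.
  by have := h_le t t_; rewrite M0 mul0r.
by have := tmax t t_; rewrite M0.
Qed.

End ODE.

(** * Linear equations with a small coefficient *)

Section LinearODE.
Context {R : realType} {d : nat}.
Variables (E : R -> 'M[R]_d) (e : R).
Implicit Types (w : 'rV[R]_d).

(** As for the second-order equation, the unknown is the derivative of the
    solution, on which the equation is a contraction. *)
Lemma linear_ode_exists (k : R) w : 0 <= k -> 3 * d%:R * e <= 1 ->
  (forall s t, - 1 / 2 <= s <= 3 / 2 -> - 1 / 2 <= t <= 3 / 2 ->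
     `|E s - E t| <= k * `|s - t|) ->
  (forall t, - 1 / 2 <= t <= 3 / 2 -> `|E t| <= e) ->
  exists X : R -> 'rV[R]_d, X 0 = w /\
    forall t : R, - 1 / 2 <= t <= 3 / 2 -> is_derive t (1 : R) X (X t *m E t).
Proof.
move=> k0 de Elip Ele.
pose J (t : R) := clamp (- 1 / 2) (3 / 2) t.
have J_in t : - 1 / 2 <= J t <= 3 / 2 by apply: clamp_in; lra.
have w0 := normr_ge0 w.
have e0 : 0 <= e.
  have h0 : - 1 / 2 <= (0 : R) <= 3 / 2 by apply/andP; split; lra.
  exact: le_trans (normr_ge0 _) (Ele 0 h0).
pose F (b : R -> 'rV[R]_d) t := (w + prim b (J t)) *m E (J t).
pose K := d%:R * (`|w| * e + 5 / 2 * `|w| * k).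
have K0 : 0 <= K by rewrite mulr_ge0// addr_ge0 ?mulr_ge0//; lra.
have J_le t : `|J t| <= 3 / 2 by have := J_in t; rewrite ler_norml; lra.
have prim_J b t : bdd_lip `|w| K b -> `|w + prim b (J t)| <= 5 / 2 * `|w|.
  move=> [bb bk]; have Jt := J_in t.
  have H : `|prim b (J t)| <= `|w| * `|J t| by apply: (prim_le bk bb); lra.
  have := ler_normD w (prim b (J t)).
  have : `|w| * `|J t| <= `|w| * (3 / 2) by rewrite ler_wpM2l.
  lra.
have FA b : bdd_lip `|w| K b -> bdd_lip `|w| K (F b).
  move=> bA; have [bb bk] := bA; split=> [t|s t].
    apply: le_trans (mxnormM _ _) _.
    apply: (@le_trans _ _ (d%:R * (5 / 2 * `|w|) * e)).
      by rewrite ler_pM ?mulr_ge0 ?ler_wpM2l//; [exact: prim_J|exact: Ele].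
    have -> : d%:R * (5 / 2 * `|w|) * e = (5 / 6 * (3 * d%:R * e)) * `|w| by field.
    rewrite -[leRHS]mul1r ler_wpM2r//; lra.
  have -> : F b s - F b t = (prim b (J s) - prim b (J t)) *m E (J s) +
     (w + prim b (J t)) *m (E (J s) - E (J t)).
    rewrite /F mulmxBr addrA -mulmxDl; congr (_ *m _ - _).
    by apply/matrixP => i j; rewrite !mxE; ring.
  have c_ := clamp_lip (- 1 / 2) (3 / 2) s t.
  have H1 : `|(prim b (J s) - prim b (J t)) *m E (J s)| <= d%:R * (`|w| * `|s - t|) * e.
    apply: le_trans (mxnormM _ _) _; have Js := J_in s; have Jt := J_in t.
    rewrite ler_pM ?mulr_ge0// ?Ele// ler_wpM2l//.
    apply: le_trans (prim_lip bk bb _ _) _; [lra|lra|].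
    by rewrite ler_wpM2l.
  have H2 : `|(w + prim b (J t)) *m (E (J s) - E (J t))| <= d%:R * (5 / 2 * `|w|) * (k * `|s - t|).
    apply: le_trans (mxnormM _ _) _; rewrite ler_pM ?mulr_ge0//.
      by rewrite ler_wpM2l//; exact: prim_J.
    by apply: le_trans (Elip _ _ (J_in s) (J_in t)) _; rewrite ler_wpM2l.
  apply: le_trans (ler_normD _ _) _; apply: le_trans (lerD H1 H2) _.
  rewrite /K le_eqVlt; apply/orP; left; apply/eqP; ring.
have FC b b' e' : bdd_lip `|w| K b -> bdd_lip `|w| K b' ->
    (forall t, `|b t - b' t| <= e') -> forall t, `|F b t - F b' t| <= e' / 2.
  move=> [bb bk] [b'b b'k] bb' t; have e'0 : 0 <= e' := le_trans (normr_ge0 _) (bb' 0).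
  have -> : F b t - F b' t = (prim b (J t) - prim b' (J t)) *m E (J t).
    rewrite /F -mulmxBl; congr (_ *m _).
    by apply/matrixP => i j; rewrite !mxE; ring.
  have Jt := J_in t.
  apply: le_trans (mxnormM _ _) _.
  apply: (@le_trans _ _ (d%:R * (e' * (3 / 2)) * e)).
    rewrite ler_pM ?mulr_ge0// ?Ele// ler_wpM2l//.
    apply: le_trans (prim_dist bk b'k bb' _) _; first by lra.
    by rewrite ler_wpM2l.
  have -> : d%:R * (e' * (3 / 2)) * e = (3 * d%:R * e) * (e' / 2) by field.
  by rewrite -[leRHS]mul1r ler_wpM2r//; lra.
have [b [bb bk] Fb] := curve_fixed_point w0 K0 FA FC.
have [b0 db] := primP bk.
exists (fun t => w + prim b t); split; first by rewrite b0 addr0.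
move=> t t_.
have -> : (w + prim b t) *m E t = b t by rewrite -[RHS]Fb /F /J clamp_id.
have H : is_derive t (1 : R) (prim b) (b t) by apply: db; lra.
by have := is_deriveD (is_derive_cst w t 1) H; rewrite add0r.
Qed.

Lemma linear_ode_unique (X1 X2 : R -> 'rV[R]_d) : 2 * d%:R * e <= 1 ->
  (forall t, 0 <= t <= 1 -> `|E t| <= e) ->
  (forall t : R, 0 <= t <= 1 -> is_derive t (1 : R) X1 (X1 t *m E t)) ->
  (forall t : R, 0 <= t <= 1 -> is_derive t (1 : R) X2 (X2 t *m E t)) ->
  X1 0 = X2 0 -> forall t : R, 0 <= t <= 1 -> X1 t = X2 t.
Proof.
move=> de Ele H1 H2 X0; pose h t := X1 t - X2 t.
have h01 : 0 <= (0 : R) <= 1 by rewrite lexx ler01.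
have e0 : 0 <= e := le_trans (normr_ge0 _) (Ele 0 h01).
have dh (t : R) : 0 <= t <= 1 -> is_derive t (1 : R) h (h t *m E t).
  by move=> t_; rewrite mulmxBl; apply: is_deriveB; [exact: H1|exact: H2].
have [||t0] := @EVT_max R (fun t => `|h t|) 0 1; first exact: ler01.
  apply: within01_continuous => t t_.
  exact: (continuous_comp (is_derive_continuous (dh t t_)) (@norm_continuous _ _ _)).
rewrite in_itv/= => t0_ tmax; set M := `|h t0| in tmax.
have {}tmax (t : R) : 0 <= t <= 1 -> `|h t| <= M by move=> t_; apply: tmax; rewrite in_itv.
have M0 : 0 <= M by exact: normr_ge0.
have dh_le (t : R) : 0 <= t <= 1 -> `|h t *m E t| <= M / 2.
  move=> t_; apply: le_trans (mxnormM _ _) _.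
  apply: (@le_trans _ _ (d%:R * M * e)).
    by rewrite ler_pM ?mulr_ge0 ?ler_wpM2l//; [exact: tmax|exact: Ele].
  have -> : d%:R * M * e = (2 * d%:R * e) * (M / 2) by field.
  by rewrite -[leRHS]mul1r ler_wpM2r//; lra.
have Mle : M <= M / 2.
  have hh : `|h t0 - h 0| <= M / 2 * (t0 - 0).
    apply: (@mvt_mx_le _ _ _ h (fun t => h t *m E t)); first by lra.
      by move=> t t_; apply: dh; lra.
    by move=> t t_; apply: dh_le; lra.
  have h0 : h 0 = 0 by rewrite /h X0 subrr.
  rewrite h0 !subr0 in hh; apply: le_trans hh _; nra.
have {}M0 : M = 0 by lra.
move=> t t_; apply/eqP; rewrite -subr_eq0 -normr_le0.
by have := tmax t t_; rewrite M0.
Qed.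

End LinearODE.

(** * Regularity of the constraint manifold *)

Section LocalLipschitz.
Context {R : realType} {d : nat}.
Implicit Types (x y v : 'rV[R]_d).

Lemma derive_coord (phi : 'rV[R]_d -> R) x v : differentiable phi x ->
  'D_v phi x = \sum_j v 0 j * 'D_(delta_mx 0 j) phi x.
Proof.
move=> dphi; rewrite deriveE// {1}[v]row_sum_delta linear_sum.
by apply: eq_bigr => j _; rewrite linearZ deriveE.
Qed.

Lemma is_derive_line x v (t : R) : is_derive t (1 : R) (fun s : R => x + s *: v) v.
Proof.
apply/is_derive_mxP => i j; under [X in is_derive _ _ X _]eq_fun do rewrite !mxE.
have := is_deriveD (is_derive_cst (x i j) t 1) (is_deriveM (is_derive_id t 1) (is_derive_cst (v i j) t 1)).
by rewrite scaler0 !add0r /GRing.scale/= mulr1.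
Qed.

Definition lip_near m n (xs : 'rV[R]_d) (F : 'rV[R]_d -> 'M[R]_(m, n)) (L : R) :=
  \forall r \near (0 : R)^'+, forall x y, `|x - xs| <= r -> `|y - xs| <= r ->
    `|F x - F y| <= L * `|x - y|.

Lemma Ck_lip (U : set 'rV[R]_d) (phi : 'rV[R]_d -> R) xs : open U -> U xs ->
  Ck_on 1 U phi -> exists L, \forall r \near (0 : R)^'+,
    forall x y, `|x - xs| <= r -> `|y - xs| <= r -> `|phi x - phi y| <= L * `|x - y|.
Proof.
move=> oU Ux [phid phiD].
pose L := \sum_j (`|'D_(delta_mx 0 j) phi xs| + 1).
exists L.
have H : \forall x \near xs, U x /\ forall j : 'I_d, `|'D_(delta_mx 0 j) phi x| <= `|'D_(delta_mx 0 j) phi xs| + 1.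
  have H1 : \forall x \near xs, U x by exact: open_nbhs_nbhs.
  have H2 : \forall x \near xs, forall j : 'I_d, `|'D_(delta_mx 0 j) phi x| <= `|'D_(delta_mx 0 j) phi xs| + 1.
    apply: (@filter_forall _ _ _ _ (nbhs_filter xs)) => j.
    have /cvgrPdist_le/(_ 1 ltr01) := phiD (delta_mx 0 j) xs Ux.
    apply: filterS => x; rewrite distrC.
    by have := lerB_dist ('D_(delta_mx 0 j) phi x) ('D_(delta_mx 0 j) phi xs); lra.
  by near=> x; split; near: x.
have /nbhs_ballP[e /= e0 He] := H.
near=> r => x y xr yr.
have re : r < e by near: r; exact: nbhs_right_lt.
have seg s : 0 <= s <= 1 -> U (x + s *: (y - x)) /\ forall j,
    `|'D_(delta_mx 0 j) phi (x + s *: (y - x))| <= `|'D_(delta_mx 0 j) phi xs| + 1.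
  move=> /andP[s0 s1]; apply: He; rewrite -ball_normE/= distrC.
  have -> : x + s *: (y - x) - xs = (1 - s) *: (x - xs) + s *: (y - xs).
    by apply/matrixP => i j; rewrite !mxE; ring.
  apply: le_lt_trans (ler_normD _ _) _; rewrite !normrZ (ger0_norm s0) ger0_norm ?subr_ge0//.
  have h1 : (1 - s) * `|x - xs| <= (1 - s) * r by rewrite ler_wpM2l// subr_ge0.
  have h2 : s * `|y - xs| <= s * r by rewrite ler_wpM2l.
  lra.
rewrite distrC [`|x - y|]distrC.
have := @mvt_le R (fun s => phi (x + s *: (y - x)))
   (fun s => 'D_(y - x) phi (x + s *: (y - x))) 0 1 (L * `|y - x|) ler01.
rewrite scale0r addr0 scale1r addrCA subrr addr0 subr0 mulr1; apply => s s_.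
  apply: is_derive_along; first by apply: phid; exact: (seg s s_).1.
  exact: is_derive_line.
have [Us bs] := seg s s_.
rewrite derive_coord; last exact: phid.
apply: le_trans (ler_norm_sum _ _ _) _; rewrite mulr_suml; apply: ler_sum => j _.
rewrite normrM [leRHS]mulrC ler_pM//; exact: mxnorm_ub.
Unshelve. all: by end_near. Qed.

Lemma mxCk_lip (U : set 'rV[R]_d) m n (F : 'rV[R]_d -> 'M[R]_(m, n)) xs :
  open U -> U xs -> mxCk U 1 F -> exists2 L, 0 <= L & lip_near xs F L.
Proof.
move=> oU Ux FC.
have H i j := cid (Ck_lip oU Ux (FC i j)).
exists (\sum_i \sum_j `|sval (H i j)|).
  by apply: sumr_ge0 => i _; apply: sumr_ge0.
have H' : \forall r \near (0 : R)^'+, forall ij : 'I_m * 'I_n, forall x y,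
    `|x - xs| <= r -> `|y - xs| <= r ->
    `|F x ij.1 ij.2 - F y ij.1 ij.2| <= sval (H ij.1 ij.2) * `|x - y|.
  by apply: filter_forall => -[i j] /=; exact: (svalP (H i j)).
apply: filterS H' => r Hr x y xr yr; apply: mxnorm_le => [|i j].
  by rewrite mulr_ge0//; apply: sumr_ge0 => i _; apply: sumr_ge0.
rewrite !mxE; apply: le_trans (Hr (i, j) x y xr yr) _ => /=; rewrite ler_wpM2r//.
rewrite (bigD1 i)//= (bigD1 j)//=.
have := ler_norm (sval (H i j)).
have : 0 <= \sum_(l < n | l != j) `|sval (H i l)| by apply: sumr_ge0.
have : 0 <= \sum_(k < m | k != i) \sum_l `|sval (H k l)|.
  by apply: sumr_ge0 => k _; apply: sumr_ge0.
lra.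
Qed.

End LocalLipschitz.

Section Regularity.
Context {R : realType} {d m : nat}.
Variable c : 'I_m -> 'rV[R]_d -> R.
Hypothesis c_smooth : forall i, smooth (c i).
Hypothesis c_licq : licq c.
Implicit Types (x y v w : 'rV[R]_d).
Local Notation C := (cgrad c).

Lemma cgradE x i j : C x i j = 'D_(delta_mx 0 j) (c i) x.
Proof. by rewrite !mxE. Qed.

Lemma c_diff i x : differentiable (c i) x.
Proof. by have [H _] := c_smooth i 1%N; exact: H. Qed.

Lemma cgrad_Ck n : mxCk setT n C.
Proof.
move=> i j; have [_ /(_ (delta_mx 0 j))] := c_smooth i n.+1.
by apply: Ck_on_ext; [exact: openT|] => x _; rewrite cgradE.
Qed.

(** The open set on which [tproj c] is a projection and depends smoothly on the
    point. *)
Definition regular : set 'rV[R]_d := [set x | C x *m (C x)^T \in unitmx].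

Lemma gram_Ck n : mxCk setT n (fun x => C x *m (C x)^T).
Proof. by apply: (mxCk_mul openT); [|apply: mxCk_tr]; exact: cgrad_Ck. Qed.

Lemma open_regular : open regular.
Proof.
have detc : continuous (fun x => \det (C x *m (C x)^T)).
  by move=> x; apply: (Ck_on_det openT (@gram_Ck 0)).
have -> : regular = (fun x => \det (C x *m (C x)^T)) @^-1` [set y | y != 0].
  by apply/seteqP; split=> x /=; rewrite /regular/= unitmxE unitfE.
by apply: open_comp => [x _|]; [exact: detc|exact: open_neq].
Qed.

Lemma mfd_regular x : mfd c x -> regular x.
Proof.
move=> /c_licq/row_free_inj Cfree; rewrite /regular/= -row_free_unit.
apply/inj_row_free => v vCC; apply: Cfree; rewrite mul0mx; apply: dot_eq0.
by rewrite trmx_mul mulmxA -[_ *m C x *m _]mulmxA vCC mul0mx mxE.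
Qed.

Definition cpinv x : 'M[R]_(m, d) := invmx (C x *m (C x)^T) *m C x.

Lemma tprojE x : tproj c x = 1%:M - (C x)^T *m cpinv x.
Proof. by rewrite /tproj /cpinv mulmxA. Qed.

Lemma cpinv_Ck n : mxCk regular n cpinv.
Proof.
apply: (mxCk_mul open_regular); last first.
  by move=> i j; apply: Ck_onS (@cgrad_Ck n i j).
apply: (mxCk_inv open_regular) => // i j; exact: Ck_onS (@gram_Ck n i j).
Qed.

Lemma tproj_Ck n : mxCk regular n (tproj c).
Proof.
have -> : tproj c = fun x => 1%:M - (C x)^T *m cpinv x by apply/funext => x; exact: tprojE.
apply: (mxCkD open_regular); first exact: mxCk_cst.
apply: (mxCkN open_regular); apply: (mxCk_mul open_regular); last exact: cpinv_Ck.
by apply: mxCk_tr => i j; apply: Ck_onS (@cgrad_Ck n i j).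
Qed.

Lemma tproj_tr x : (tproj c x)^T = tproj c x.
Proof.
rewrite /tproj linearB/= trmx1 !trmx_mul trmxK trmx_inv trmx_mul trmxK.
by rewrite !mulmxA.
Qed.

Lemma cgrad_tproj x : regular x -> C x *m tproj c x = 0.
Proof.
by move=> xr; rewrite tprojE mulmxBr mulmx1 mulmxA mulmxA mulmxV// mul1mx subrr.
Qed.

Lemma tproj_cgrad x : regular x -> tproj c x *m (C x)^T = 0.
Proof.
by move=> xr; apply: trmx_inj; rewrite trmx_mul trmxK tproj_tr cgrad_tproj// trmx0.
Qed.

Lemma tproj_idem x : regular x -> tproj c x *m tproj c x = tproj c x.
Proof. by move=> xr; apply: tangent_tproj; exact: tproj_cgrad. Qed.

Lemma normal_tproj x w : regular x -> normal c x w -> w *m tproj c x = 0.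
Proof. by move=> xr /submxP[y ->]; rewrite -mulmxA cgrad_tproj// mulmx0. Qed.

Lemma tproj_tangent x v : regular x -> tangent c x (v *m tproj c x).
Proof. by move=> xr; rewrite /tangent/= -mulmxA tproj_cgrad// mulmx0. Qed.

Lemma tangent_lin x (a : R) v w : tangent c x v -> tangent c x w -> tangent c x (a *: v + w).
Proof. by rewrite /tangent/= => H1 H2; rewrite mulmxDl -scalemxAl H1 H2 scaler0 addr0. Qed.

(** The directional derivative of [cgrad c] along w, written in coordinates so
    that it is linear in w by construction. *)
Definition dcgrad x w : 'M[R]_(m, d) :=
  \matrix_(i, l) \sum_j w 0 j * 'D_(delta_mx 0 j) (fun y => C y i l) x.

Lemma cgrad_entry_diff i l x : differentiable (fun y => C y i l) x.
Proof. exact: (Ck_on_diff (@cgrad_Ck 1 i l)). Qed.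

Lemma is_derive_cgrad (g : R -> 'rV[R]_d) t dg : is_derive t (1 : R) g dg ->
  is_derive t (1 : R) (fun s => C (g s)) (dcgrad (g t) dg).
Proof.
move=> gd; apply/is_derive_mxP => i l; rewrite mxE -derive_coord; last exact: cgrad_entry_diff.
exact: (is_derive_along (cgrad_entry_diff i l (g t)) gd).
Qed.

Lemma is_derive_c (g : R -> 'rV[R]_d) t dg i : is_derive t (1 : R) g dg ->
  is_derive t (1 : R) (fun s => c i (g s)) ((dg *m (C (g t))^T) 0 i).
Proof.
move=> gd; have := is_derive_along (c_diff i (g t)) gd.
rewrite derive_coord; last exact: c_diff.
rewrite [X in is_derive _ _ _ X -> _](_ : _ = (dg *m (C (g t))^T) 0 i)//.
by rewrite mxE; apply: eq_bigr => j _; rewrite [in RHS]mxE cgradE.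
Qed.

(** Transport operator: the derivative of a tangent field X along a curve
    with velocity w is normal exactly when it equals X B(x, w), because the
    identity X C^T = 0 prescribes the normal component of the derivative. *)
Definition transport_op x w : 'M[R]_d := - (dcgrad x w)^T *m cpinv x.
Local Notation B := transport_op.

Lemma transport_op_normal x v w : normal c x (v *m B x w).
Proof. by rewrite /normal/= /B /cpinv !mulmxA submxMl. Qed.

Lemma transport_op_cgrad x w : regular x -> B x w *m (C x)^T = - (dcgrad x w)^T.
Proof. by move=> xr; rewrite /B /cpinv -!mulmxA mulVmx// mulmx1. Qed.

Lemma transport_opE x v w dv : regular x -> normal c x dv ->
  dv *m (C x)^T + v *m (dcgrad x w)^T = 0 -> dv = v *m B x w.
Proof.
move=> xr /submxP[y ->] /eqP; rewrite addr_eq0 => /eqP H.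
have -> : y = y *m (C x *m (C x)^T) *m invmx (C x *m (C x)^T) by rewrite mulmxK.
by rewrite [y *m (C x *m _)]mulmxA H /B /cpinv !mulNmx mulmxN !mulmxA.
Qed.

Lemma dcgradB x w1 w2 : dcgrad x (w1 - w2) = dcgrad x w1 - dcgrad x w2.
Proof.
apply/matrixP => i l; rewrite !mxE -sumrB; apply: eq_bigr => j _.
by rewrite !mxE mulrBl.
Qed.

Lemma transport_opB x w1 w2 : B x (w1 - w2) = B x w1 - B x w2.
Proof. by rewrite /B dcgradB linearB/= -mulmxBl opprB opprK addrC. Qed.

Section Bounds.
Variable xs : 'rV[R]_d.
Hypothesis xs_mfd : mfd c xs.

(** One ball and one constant serve for all the estimates near xs; they exist
    because C^1 maps are locally Lipschitz. *)
Lemma local_bounds : exists r Lam : R, [/\ 0 < r, 1 <= Lam,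
    forall x, `|x - xs| <= r -> regular x,
    forall x w, `|x - xs| <= r -> `|B x w| <= Lam * `|w| &
    (forall x y w, `|x - xs| <= r -> `|y - xs| <= r ->
      `|B x w - B y w| <= Lam * `|x - y| * `|w|) /\
    (forall x y, `|x - xs| <= r -> `|y - xs| <= r ->
      `|tproj c x - tproj c y| <= Lam * `|x - y|)].
Proof.
have xs_reg := mfd_regular xs_mfd.
have [L1 L10 lipK] := mxCk_lip open_regular xs_reg (@cpinv_Ck 1).
have [L2 L20 lipP] := mxCk_lip open_regular xs_reg (@tproj_Ck 1).
pose Dj (j : 'I_d) x : 'M[R]_(m, d) := \matrix_(i, l) 'D_(delta_mx 0 j) (fun y => C y i l) x.
have DjC j : mxCk setT 1 (Dj j).
  move=> i l; under eq_fun do rewrite mxE.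
  by have [_] := @cgrad_Ck 2 i l; apply.
have lipD (j : 'I_d) := cid2 (mxCk_lip openT (I : [set: 'rV[R]_d] xs) (DjC j)).
pose L3 := \sum_j s2val (lipD j).
have L3j j : s2val (lipD j) <= L3.
  rewrite /L3 (bigD1 j)//= lerDl; apply: sumr_ge0 => l _; exact: (s2valP (lipD l)).
have L30 : 0 <= L3 by apply: sumr_ge0 => j _; exact: (s2valP (lipD j)).
have H : \forall r \near (0 : R)^'+, [/\ r <= 1, forall x, `|x - xs| <= r -> regular x,
   forall x y, `|x - xs| <= r -> `|y - xs| <= r -> `|cpinv x - cpinv y| <= L1 * `|x - y|,
   forall x y, `|x - xs| <= r -> `|y - xs| <= r -> `|tproj c x - tproj c y| <= L2 * `|x - y| &
   forall j x y, `|x - xs| <= r -> `|y - xs| <= r -> `|Dj j x - Dj j y| <= L3 * `|x - y|].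
  have /nbhs_ballP[e /= e0 He] : \forall x \near xs, regular x.
    by apply: open_nbhs_nbhs; split=> //; exact: open_regular.
  have HD : \forall r \near (0 : R)^'+, forall (j : 'I_d) x y, `|x - xs| <= r -> `|y - xs| <= r ->
      `|Dj j x - Dj j y| <= s2val (lipD j) * `|x - y|.
    by apply: filter_forall => j; exact: (s2valP' (lipD j)).
  near=> r; split.
  - by near: r; exact: nbhs_right_le.
  - move=> x xr; apply: He; rewrite -ball_normE/= distrC; apply: le_lt_trans xr _.
    by near: r; exact: nbhs_right_lt.
  - by near: r.
  - by near: r.
  - have HDr : forall j x y, `|x - xs| <= r -> `|y - xs| <= r ->
      `|Dj j x - Dj j y| <= s2val (lipD j) * `|x - y| by near: r.
    move=> j x y xr yr; apply: le_trans (HDr j x y xr yr) _.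
    by rewrite ler_wpM2r//; exact: L3j.
have [r [r0 [r1 rreg rK rP rD]]] : exists r, 0 < r /\ [/\ r <= 1, forall x, `|x - xs| <= r -> regular x,
   forall x y, `|x - xs| <= r -> `|y - xs| <= r -> `|cpinv x - cpinv y| <= L1 * `|x - y|,
   forall x y, `|x - xs| <= r -> `|y - xs| <= r -> `|tproj c x - tproj c y| <= L2 * `|x - y| &
   forall j x y, `|x - xs| <= r -> `|y - xs| <= r -> `|Dj j x - Dj j y| <= L3 * `|x - y|].
  have H0 : \forall r \near (0 : R)^'+, 0 < r by exact: nbhs_right_gt.
  by have [r [? ?]] := filter_ex (filterI H0 H); exists r.
have xsr : `|xs - xs| <= r by rewrite subrr normr0 ltW.
pose M1 := `|cpinv xs| + L1; pose M2 := \sum_j `|Dj j xs| + L3.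
have M10 : 0 <= M1 by rewrite addr_ge0.
have M20 : 0 <= M2 by rewrite addr_ge0// sumr_ge0.
have Kle x : `|x - xs| <= r -> `|cpinv x| <= M1.
  move=> xr; rewrite -[cpinv x](subrK (cpinv xs)) addrC (le_trans (ler_normD _ _))//.
  rewrite lerD// (le_trans (rK _ _ xr xsr))// ler_piMr//; exact: le_trans xr r1.
have Dle j x : `|x - xs| <= r -> `|Dj j x| <= M2.
  move=> xr; rewrite -[Dj j x](subrK (Dj j xs)) addrC (le_trans (ler_normD _ _))//.
  rewrite lerD//.
    by rewrite (bigD1 j)//= lerDl sumr_ge0.
  by rewrite (le_trans (rD _ _ _ xr xsr))// ler_piMr//; exact: le_trans xr r1.
have dcE x w : dcgrad x w = \sum_j w 0 j *: Dj j x.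
  apply/matrixP => i l; rewrite mxE summxE; apply: eq_bigr => j _.
  by rewrite !mxE.
have dcle x w : `|x - xs| <= r -> `|dcgrad x w| <= d%:R * (`|w| * M2).
  move=> xr; rewrite dcE (le_trans (ler_norm_sum _ _ _))//.
  apply: (@le_trans _ _ (\sum_(j < d) `|w| * M2)).
    by apply: ler_sum => j _; rewrite normrZ ler_pM//; [exact: mxnorm_ub|exact: Dle].
  by rewrite sumr_const card_ord -[leLHS]mulr_natl.
have dclip x y w : `|x - xs| <= r -> `|y - xs| <= r ->
    `|dcgrad x w - dcgrad y w| <= d%:R * (`|w| * (L3 * `|x - y|)).
  move=> xr yr; rewrite !dcE -sumrB (le_trans (ler_norm_sum _ _ _))//.
  apply: (@le_trans _ _ (\sum_(j < d) `|w| * (L3 * `|x - y|))).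
    apply: ler_sum => j _; rewrite -scalerBr normrZ ler_pM//; first exact: mxnorm_ub.
    exact: rD.
  by rewrite sumr_const card_ord -[leLHS]mulr_natl.
pose La := m%:R * d%:R * M2 * M1; pose Lb := m%:R * d%:R * (L3 * M1 + M2 * L1).
have La0 : 0 <= La by rewrite !mulr_ge0.
have Lb0 : 0 <= Lb by rewrite !mulr_ge0// addr_ge0 ?mulr_ge0.
exists r, (1 + La + Lb + L2); split=> //; first by lra.
- move=> x w xr; apply: (@le_trans _ _ (La * `|w|)); last by rewrite ler_wpM2r//; lra.
  rewrite /B mulNmx normrN (le_trans (mxnormM _ _))// mxnorm_tr.
  apply: (@le_trans _ _ (m%:R * (d%:R * (`|w| * M2)) * M1)).
    by rewrite ler_pM ?mulr_ge0 ?ler_wpM2l//; [exact: dcle|exact: Kle].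
  by rewrite /La le_eqVlt; apply/orP; left; apply/eqP; ring.
split=> [x y w xr yr|x y xr yr]; last first.
  by apply: le_trans (rP x y xr yr) _; rewrite ler_wpM2r//; lra.
apply: (@le_trans _ _ (Lb * `|x - y| * `|w|)); last by rewrite !ler_wpM2r//; lra.
have -> : B x w - B y w = - ((dcgrad x w - dcgrad y w)^T *m cpinv x +
    (dcgrad y w)^T *m (cpinv x - cpinv y)).
  rewrite [(_ - _)^T]linearB/= mulmxBr mulmxBl addrA subrK.
  have opp_sub (M N : 'M[R]_d) : - M - - N = - (M - N) by rewrite opprK opprB addrC.
  have BE z : B z w = - ((dcgrad z w)^T *m cpinv z) by rewrite /transport_op mulNmx.
  by rewrite (BE x) (BE y); exact: opp_sub.
rewrite normrN (le_trans (ler_normD _ _))//.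
apply: (@le_trans _ _ (m%:R * (d%:R * (`|w| * (L3 * `|x - y|))) * M1 +
    m%:R * (d%:R * (`|w| * M2)) * (L1 * `|x - y|))).
  rewrite lerD// (le_trans (mxnormM _ _))// mxnorm_tr ler_pM ?mulr_ge0 ?ler_wpM2l//.
  - exact: dclip.
  - exact: Kle.
  - exact: dcle.
  - exact: rK.
by rewrite /Lb le_eqVlt; apply/orP; left; apply/eqP; ring.
Unshelve. all: by end_near. Qed.

End Bounds.

End Regularity.

(** * Geodesics and parallel fields as solutions of differential equations *)

Section Geodesics.
Context {R : realType} {d m : nat}.
Variable c : 'I_m -> 'rV[R]_d -> R.
Hypothesis c_smooth : forall i, smooth (c i).
Hypothesis c_licq : licq c.
Implicit Types (x y v w : 'rV[R]_d) (g X : R -> 'rV[R]_d).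
Local Notation C := (cgrad c).
Local Notation B := (transport_op c).

Lemma near_itv (a b t : R) : a < t < b -> \forall s \near t, a < s < b.
Proof.
move=> tab; have : t \in `]a, b[ by rewrite in_itv.
by move/near_in_itvoo; apply: filterS => s; rewrite in_itv.
Qed.

Lemma near_is_derive (W : normedModType R) (f h : R -> W) (a b t : R) df : a < t < b ->
  (forall s, a < s < b -> f s = h s) -> is_derive t (1 : R) f df ->
  is_derive t (1 : R) h df.
Proof.
move=> t_ fh; apply: near_eq_is_derive.
by apply: filterS (near_itv t_) => s /fh.
Qed.

Lemma is_derive_uniq (W : normedModType R) (f : R -> W) t df df' :
  is_derive t (1 : R) f df -> is_derive t (1 : R) f df' -> df = df'.
Proof. by move=> [_ <-] [_ <-]. Qed.

(** The derivative of a tangent field is determined by its tangential part; here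
    that part vanishes. *)
Lemma tangent_derivative g X (a b t : R) dg dX : a < t < b ->
  (forall s, a < s < b -> tangent c (g s) (X s)) ->
  is_derive t (1 : R) X dX -> is_derive t (1 : R) g dg ->
  mfd c (g t) -> normal c (g t) dX -> dX = X t *m B (g t) dg.
Proof.
move=> t_ tang dX_ dg_ gM dXn; apply: transport_opE => //.
  exact: (mfd_regular c_licq).
have H := is_derive_mulmx dX_ (is_derive_tr (is_derive_cgrad c_smooth dg_)).
apply: (is_derive_uniq H).
apply: (near_is_derive t_ _ (is_derive_cst (0 : 'rV[R]_m) t 1)) => s /tang.
by rewrite /tangent/= => ->.
Qed.

Lemma geodesicE g : geodesic c g -> exists2 e : R, 0 < e &
  forall t : R, - e < t < 1 + e -> [/\ mfd c (g t), is_derive t (1 : R) g (derive1 g t),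
    is_derive t (1 : R) (derive1 g) (derive1 g t *m B (g t) (derive1 g t)) &
    tangent c (g t) (derive1 g t)].
Proof.
move=> [e e0 H]; exists e; first exact: e0.
have der (t : R) : - e < t < 1 + e -> is_derive t (1 : R) g (derive1 g t).
  by move=> /H[_ gd _ _]; exact: derivable_is_derive1 gd.
have tang (t : R) : - e < t < 1 + e -> tangent c (g t) (derive1 g t).
  move=> t_; apply/rowP => i; rewrite [RHS]mxE.
  apply: (is_derive_uniq (is_derive_c c_smooth i (der t t_))).
  apply: (near_is_derive t_ _ (is_derive_cst (0 : R) t 1)) => s /H[gM _ _ _].
  by rewrite gM.
move=> t t_; have [gM _ gdd gn] := H t t_; split; [exact: gM|exact: der| |exact: tang].
have D2 : is_derive t (1 : R) (derive1 g) (derive1 (derive1 g) t).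
  exact: derivable_is_derive1 gdd.
rewrite -(tangent_derivative t_ tang D2 (der t t_) gM gn); exact: D2.
Qed.

Lemma geodesicI g (dg : R -> 'rV[R]_d) (e : R) : 0 < e ->
  (forall t : R, - e < t < 1 + e -> [/\ mfd c (g t), is_derive t (1 : R) g (dg t) &
    is_derive t (1 : R) dg (dg t *m B (g t) (dg t))]) ->
  geodesic c g /\ forall t, - e < t < 1 + e -> derive1 g t = dg t.
Proof.
move=> e0 H.
have E (t : R) : - e < t < 1 + e -> derive1 g t = dg t by move=> /H[_ /is_derive1].
split; last exact: E.
exists e; first exact: e0.
move=> t t_; have [gM gd gdd] := H t t_.
have D2 : is_derive t (1 : R) (derive1 g) (dg t *m B (g t) (dg t)).
  by apply: (near_is_derive t_ _ gdd) => s /E.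
split; [exact: gM|by case: gd|by case: D2|].
rewrite (is_derive1 D2); exact: transport_op_normal.
Qed.

Lemma normal_tangent_dot x v w : normal c x v -> tangent c x w -> v *m w^T = 0.
Proof.
move=> /submxP[y ->] wt; rewrite -mulmxA; have := congr1 trmx wt.
by rewrite trmx_mul trmxK trmx0 => ->; rewrite mulmx0.
Qed.

(** Derivatives of parallel fields are normal, hence orthogonal to tangent
    fields; applied to the velocity it yields the constant speed of geodesics. *)
Lemma parallel_dot_cst g X Y (dX dY : R -> 'rV[R]_d) (a b s t : R) :
  (forall u : R, a < u < b -> [/\ tangent c (g u) (X u), tangent c (g u) (Y u),
     is_derive u (1 : R) X (dX u), is_derive u (1 : R) Y (dY u) &
     normal c (g u) (dX u) /\ normal c (g u) (dY u)]) ->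
  a < s < b -> a < t < b -> X s *m (Y s)^T = X t *m (Y t)^T.
Proof.
move=> H; apply: (@mvt_mx_cst _ _ _ (fun u => X u *m (Y u)^T) a b) => u /H[Xt Yt Xd Yd [Xn Yn]].
have := is_derive_mulmx Xd (is_derive_tr Yd).
rewrite (normal_tangent_dot Xn Yt) add0r.
have -> : X u *m (dY u)^T = 0; last by [].
by apply: trmx_inj; rewrite trmx_mul trmxK (normal_tangent_dot Yn Xt) trmx0.
Qed.

Lemma geodesic_speed g : geodesic c g -> exists2 e : R, 0 < e &
  forall t : R, - e < t < 1 + e -> enorm (derive1 g t) = enorm (derive1 g 0).
Proof.
move=> /geodesicE[e e0 H]; exists e; first exact: e0.
move=> t t_.
have h0 : - e < 0 < 1 + e by lra.
suff E : derive1 g t *m (derive1 g t)^T = derive1 g 0 *m (derive1 g 0)^T.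
  by rewrite /enorm E.
apply: (parallel_dot_cst (g := g) (X := derive1 g) (Y := derive1 g) _ t_ h0).
move=> u /H[gM gd gdd gt]; split; [exact: gt|exact: gt|exact: gdd|exact: gdd|].
by split; exact: transport_op_normal.
Qed.

Lemma geodesic_length g : geodesic c g -> curve_length g = (enorm (derive1 g 0))%:E.
Proof.
move=> /geodesic_speed[e e0 H]; rewrite /curve_length.
rewrite (eq_integral (fun=> (enorm (derive1 g 0))%:E)); last first.
  by move=> t; rewrite inE/= in_itv/= => t_; rewrite H//; lra.
rewrite integral_cst//= lebesgue_measure_itv/= lte_fin ltr01 oppr0 adde0.
by rewrite mule1.
Qed.

(** A solution of the geodesic equation stays on the manifold, and its
    velocity stays tangent, if it starts tangentially or ends on the
    manifold: along it the constraints are affine functions of time. *)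
Lemma ode_stays g (dg : R -> 'rV[R]_d) (a b : R) : a < 0 -> 1 < b ->
  (forall t : R, a < t < b -> [/\ is_derive t (1 : R) g (dg t),
     is_derive t (1 : R) dg (dg t *m B (g t) (dg t)) & regular c (g t)]) ->
  mfd c (g 0) -> (tangent c (g 0) (dg 0) \/ mfd c (g 1)) ->
  forall t, a < t < b -> mfd c (g t) /\ tangent c (g t) (dg t).
Proof.
move=> a0 b1 H g0 bc.
have t0_ : a < 0 < b by lra.
pose T t := dg t *m (C (g t))^T.
have Tcst t : a < t < b -> T t = T 0.
  move=> t_; apply: (@mvt_mx_cst _ _ _ T a b) => // u /H[gd gdd ureg].
  have := is_derive_mulmx gdd (is_derive_tr (is_derive_cgrad c_smooth gd)).
  by rewrite -mulmxA transport_op_cgrad// mulmxN addNr.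
have caff t i : a < t < b -> c i (g t) = t * T 0 0 i.
  move=> t_; pose f s : 'rV[R]_1 := \row__ (c i (g s) - s * T 0 0 i).
  have : f t = f 0.
    apply: (@mvt_mx_cst _ _ _ f a b) => // u u_; apply/is_derive_mxP => k l.
    under [X in is_derive _ _ X _]eq_fun do rewrite mxE.
    have [gd _ _] := H u u_.
    have H1 := is_derive_c c_smooth i gd.
    rewrite -[_ *m _]/(T u) (Tcst _ u_) in H1.
    have H2 := is_deriveM (is_derive_id u (1 : R)) (is_derive_cst (T 0 0 i) u (1 : R)).
    apply: is_derive_eq (is_deriveB H1 H2) _.
    by rewrite scaler0 add0r [RHS]mxE /GRing.scale/= mulr1 subrr.
  move/matrixP/(_ 0 0); rewrite !mxE mul0r subr0 g0 => /eqP.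
  by rewrite subr_eq0 => /eqP.
have T0 : T 0 = 0.
  case: bc => [//|g1]; apply/rowP => i; rewrite [RHS]mxE.
  by rewrite -[LHS]mul1r -caff ?g1//; lra.
move=> t t_; split; last by rewrite /tangent/= -[LHS]/(T t) Tcst.
by move=> i; rewrite caff// T0 mxE mulr0.
Qed.

Lemma parallel_stays g (dg : R -> 'rV[R]_d) X (a b : R) : a < 0 -> 0 < b ->
  (forall t : R, a < t < b -> [/\ is_derive t (1 : R) g (dg t),
     is_derive t (1 : R) X (X t *m B (g t) (dg t)) & regular c (g t)]) ->
  tangent c (g 0) (X 0) -> forall t, a < t < b -> tangent c (g t) (X t).
Proof.
move=> a0 b1 H X0 t t_.
pose T t := X t *m (C (g t))^T.
rewrite /tangent/= -[LHS]/(T t) -X0 -[RHS]/(T 0).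
apply: (@mvt_mx_cst _ _ _ T a b) => //; last by lra.
move=> u /H[gd Xd ureg].
have := is_derive_mulmx Xd (is_derive_tr (is_derive_cgrad c_smooth gd)).
by rewrite -mulmxA transport_op_cgrad// mulmxN addNr.
Qed.

Lemma parallel_dot g X Y (t : R) : parallel_along c g X -> parallel_along c g Y ->
  0 <= t <= 1 -> X t *m (Y t)^T = X 0 *m (Y 0)^T.
Proof.
move=> [e e0 HX] [e' e'0 HY] t_.
pose e2 := Num.min e e'.
have e20 : 0 < e2 by rewrite lt_min e0 e'0.
have [le1 le2] : e2 <= e /\ e2 <= e' by rewrite /e2 !ge_min !lexx orbT.
have h0 : - e2 < 0 < 1 + e2 by lra.
have ht : - e2 < t < 1 + e2 by lra.
apply: (parallel_dot_cst (g := g) (X := X) (Y := Y) (dX := derive1 X) (dY := derive1 Y) _ ht h0).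
move=> u u_; have [|Xt Xd Xn] := HX u; first by lra.
have [|Yt Yd Yn] := HY u; first by lra.
split; [exact: Xt|exact: Yt| | |by split; [exact: Xn|exact: Yn]].
  exact: derivable_is_derive1 Xd.
exact: derivable_is_derive1 Yd.
Qed.

Lemma parallel_linear_comb g X Y (a : R) : parallel_along c g X -> parallel_along c g Y ->
  parallel_along c g (fun t => a *: X t + Y t).
Proof.
move=> [e e0 HX] [e' e'0 HY].
pose e2 := Num.min e e'.
have e20 : 0 < e2 by rewrite lt_min e0 e'0.
have [le1 le2] : e2 <= e /\ e2 <= e' by rewrite /e2 !ge_min !lexx orbT.
exists e2; first exact: e20.
move=> u u_; have [|Xt Xd Xn] := HX u; first by lra.
have [|Yt Yd Yn] := HY u; first by lra.
have D1 : is_derive u (1 : R) X (derive1 X u) := derivable_is_derive1 Xd.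
have D2 : is_derive u (1 : R) Y (derive1 Y u) := derivable_is_derive1 Yd.
have D3 : is_derive u (1 : R) (fun t => a *: X t + Y t) (a *: derive1 X u + derive1 Y u).
  exact: is_deriveD (is_deriveZ a D1) D2.
split; [exact: tangent_lin|by case: D3|].
rewrite (is_derive1 D3); move: Xn Yn; rewrite /normal/= => /submxP[y ->] /submxP[z ->].
by rewrite scalemxAl -mulmxDl submxMl.
Qed.

(** ** Reversal of time *)

Lemma is_derive_rev (W : normedModType R) (f : R -> W) (t : R) df :
  is_derive (1 - t) (1 : R) f df -> is_derive t (1 : R) (fun s => f (1 - s)) (- df).
Proof.
move=> [fd fE]; have fdiff : differentiable f (1 - t) by apply/derivable1_diffP.
have rd : is_derive t (1 : R) (fun s : R => 1 - s) (-1).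
  by have := is_deriveB (is_derive_cst (1 : R) t 1) (is_derive_id t (1 : R)); rewrite sub0r.
have rdiff : differentiable (fun s : R => 1 - s) t by apply/derivable1_diffP; case: rd.
have cdiff : differentiable (f \o (fun s : R => 1 - s)) t by exact: differentiable_comp.
apply: DeriveDef; first by apply/derivable1_diffP.
rewrite deriveE// diff_comp//= -[X in 'd f _ X](_ : -1 = _).
  by rewrite linearN/= -deriveE// fE.
by case: rd => _ <-; rewrite deriveE.
Qed.

Lemma geodesic_rev g : geodesic c g ->
  geodesic c (fun t => g (1 - t)) /\ derive1 (fun t => g (1 - t)) 0 = - derive1 g 1.
Proof.
move=> gg; have [e e0 H] := geodesicE gg.
have [] := @geodesicI (fun t => g (1 - t)) (fun t => - derive1 g (1 - t)) e e0.
  move=> t t_; have t' : - e < 1 - t < 1 + e by lra.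
  have [gM gd gdd gt] := H _ t'; split; [exact: gM|exact: is_derive_rev|].
  have := is_deriveN (is_derive_rev gdd); rewrite opprK.
  have -> : - derive1 g (1 - t) *m B (g (1 - t)) (- derive1 g (1 - t)) =
     derive1 g (1 - t) *m B (g (1 - t)) (derive1 g (1 - t)); last by [].
  have -> : B (g (1 - t)) (- derive1 g (1 - t)) = - B (g (1 - t)) (derive1 g (1 - t)).
    have := transport_opB c (g (1 - t)) 0 (derive1 g (1 - t)); rewrite sub0r => ->.
    by have := transport_opB c (g (1 - t)) 0 0; rewrite subrr => ->; rewrite subrr sub0r.
  by rewrite mulmxN mulNmx opprK.
move=> rg E; split; first exact: rg.
by rewrite E ?subr0//; lra.
Qed.

Lemma geodesic_length_rev g : geodesic c g ->
  curve_length (fun t => g (1 - t)) = curve_length g.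
Proof.
move=> gg; have [rg rE] := geodesic_rev gg.
rewrite (geodesic_length rg) (geodesic_length gg) rE; congr (_%:E).
have [e e0 /(_ 1) <-] := geodesic_speed gg; last by lra.
by rewrite /enorm linearN/= mulmxN mulNmx opprK.
Qed.

Lemma short_geodesic_rev x y g : short_geodesic c x y g ->
  short_geodesic c y x (fun t => g (1 - t)).
Proof.
move=> [gg g0 g1 gmin]; split; [exact: (geodesic_rev gg).1|by rewrite subr0|by rewrite subrr|].
move=> h hh h0 h1; rewrite (geodesic_length_rev gg) -(geodesic_length_rev hh).
by apply: gmin; [exact: (geodesic_rev hh).1|rewrite subr0|rewrite subrr].
Qed.

Lemma parallel_rev g X : parallel_along c g X ->
  parallel_along c (fun t => g (1 - t)) (fun t => X (1 - t)).
Proof.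
move=> [e e0 H]; exists e; first exact: e0.
move=> t t_; have t' : - e < 1 - t < 1 + e by lra.
have [Xt Xd Xn] := H _ t'.
have D1 : is_derive (1 - t) (1 : R) X (derive1 X (1 - t)).
  exact: derivable_is_derive1 Xd.
have D2 := is_derive_rev D1.
split; [exact: Xt|by case: D2|].
rewrite (is_derive1 D2); have := Xn; rewrite /normal/= => /submxP[y ->].
by rewrite -mulNmx submxMl.
Qed.

End Geodesics.

(** * Exponential map and parallel transport near a point *)

Lemma mulmx_subr0 (R : pzRingType) m n p (N : 'M[R]_(m, n)) (P Q : 'M[R]_(n, p)) :
  N *m Q = 0 -> N *m (P - Q) = N *m P.
Proof. by move=> NQ; rewrite mulmxBr NQ subr0. Qed.

Lemma isometry_inverse (R : comPzRingType) n (U U' P Q : 'M[R]_n) :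
  U *m U^T = P -> U' *m U = Q -> Q *m U^T = U^T -> U' *m P = U' -> U^T = U'.
Proof. by move=> UU U'U QU U'P; rewrite -QU -U'U -mulmxA UU U'P. Qed.

(** What the proof of contraction uses of the geometry: to first order at xs,
    the exponential map and its inverse are translations and parallel
    transport is orthogonal projection, and parallel transport is an
    isometry between tangent spaces. *)
Definition normal_coordinates (R : realType) (d m : nat) (c : 'I_m -> 'rV[R]_d -> R)
    (xs : 'rV[R]_d) (rho K : R) : Prop :=
  [/\ forall v, tangent c xs v -> `|v| <= rho -> mfd c (exp_map c xs v) /\
        `|exp_map c xs v - (xs + v)| <= K * `|v| ^+ 2,
      forall y, mfd c y -> `|y - xs| <= rho ->
        `|exp_inv c xs y - (y - xs)| <= K * `|y - xs| ^+ 2 &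
      forall x y, mfd c x -> mfd c y -> `|x - xs| <= rho -> `|y - xs| <= rho ->
        [/\ (ptransmx c x y)^T = ptransmx c y x,
            ptransmx c x y *m ptransmx c y x = tproj c x,
            ptransmx c x y *m tproj c y = ptransmx c x y,
            `|ptransmx c x y - tproj c x *m tproj c y| <= K * `|y - x| ^+ 2 &
            (geodist c x y <= (K * `|y - x|)%:E)%E]].

Section LocalGeometry.
Context {R : realType} {d m : nat}.
Variable c : 'I_m -> 'rV[R]_d -> R.
Hypothesis c_smooth : forall i, smooth (c i).
Hypothesis c_licq : licq c.
Hypothesis d_gt0 : (0 < d)%N.
Variable xs : 'rV[R]_d.
Hypothesis xs_mfd : mfd c xs.
Variables r Lam : R.
Hypotheses (r_gt0 : 0 < r) (Lam_ge1 : 1 <= Lam).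
Hypothesis r_reg : forall x, `|x - xs| <= r -> regular c x.
Hypothesis B_bound : forall x w, `|x - xs| <= r -> `|transport_op c x w| <= Lam * `|w|.
Hypothesis B_lip : forall x y w, `|x - xs| <= r -> `|y - xs| <= r ->
  `|transport_op c x w - transport_op c y w| <= Lam * `|x - y| * `|w|.
Hypothesis P_lip : forall x y, `|x - xs| <= r -> `|y - xs| <= r ->
  `|tproj c x - tproj c y| <= Lam * `|x - y|.
Implicit Types (x y v w : 'rV[R]_d) (g X : R -> 'rV[R]_d).
Local Notation B := (transport_op c).

Let D : R := d%:R * Lam.
Let D_ge1 : 1 <= D. Proof. by rewrite /D -[leLHS]mulr1 ler_pM// ler1n. Qed.

(* Solutions slower than s0 stay in the ball and satisfy the smallness
   condition of the uniqueness lemma for boundary values. *)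
Let s0 : R := Num.min (r / 2) (1 / (6 * D)).
Let s0_gt0 : 0 < s0.
Proof. by have D1 := D_ge1; rewrite /s0 lt_min !divr_gt0//; lra. Qed.
Let s0_r : 2 * s0 <= r.
Proof. have : s0 <= r / 2 by rewrite /s0 ge_min lexx. lra. Qed.
Let s0_D : D * s0 <= 1 / 6.
Proof.
have D1 := D_ge1; have H : s0 <= 1 / (6 * D) by rewrite /s0 ge_min lexx orbT.
have D0 : 0 < D by lra.
apply: le_trans (ler_wpM2l (ltW D0) H) _.
by rewrite le_eqVlt; apply/orP; left; apply/eqP; field; exact: lt0r_neq0.
Qed.

Let eta : R := s0 / (80 * d%:R).
Let d1 : 1 <= d%:R :> R. Proof. by rewrite ler1n. Qed.
Let d_eta : 80 * d%:R * eta = s0.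
Proof. by rewrite /eta; field; have := d1; lra. Qed.
Let eta_gt0 : 0 < eta.
Proof. by rewrite divr_gt0// mulr_gt0//; have := d1; lra. Qed.
Let eta_s0 : 80 * eta <= s0.
Proof. by rewrite -d_eta; have := d1; have := eta_gt0; nra. Qed.
Let eta_r : 20 * eta <= r. Proof. have := s0_r; have := eta_s0; have := s0_gt0; lra. Qed.
Let eta_D : 480 * D * eta <= 1.
Proof. have := s0_D; have := eta_s0; have := D_ge1; have := eta_gt0; nra. Qed.

Definition geodesic_sol g (dg : R -> 'rV[R]_d) :=
  forall t : R, 0 <= t <= 1 -> [/\ is_derive t (1 : R) g (dg t),
     is_derive t (1 : R) dg (dg t *m B (g t) (dg t)), `|g t - xs| <= r & `|dg t| <= s0].

Lemma sol_unique g1 dg1 g2 dg2 : geodesic_sol g1 dg1 -> geodesic_sol g2 dg2 ->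
  g1 0 = g2 0 -> (dg1 0 = dg2 0 \/ g1 1 = g2 1) ->
  forall t : R, 0 <= t <= 1 -> g1 t = g2 t /\ dg1 t = dg2 t.
Proof.
apply: (ode_unique d_gt0 Lam_ge1 B_bound B_lip (transport_opB c)).
have := s0_D; have := s0_gt0; have := D_ge1; rewrite -/D; nra.
Qed.

(** A geodesic has constant speed, so a slow one does not leave the
    neighbourhood of xs in unit time. *)
Lemma slow_geodesic g : geodesic c g -> `|g 0 - xs| <= r / 4 ->
  enorm (derive1 g 0) <= s0 -> geodesic_sol g (derive1 g).
Proof.
move=> gg g0 gs; have [e e0 H] := geodesicE c_smooth c_licq gg.
have [e' e'0 Hs] := geodesic_speed c_smooth c_licq gg.
have dgs (t : R) : 0 <= t <= 1 -> `|derive1 g t| <= s0.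
  move=> t_; apply: le_trans (mxnorm_le_enorm _) _; rewrite Hs//; lra.
move=> t t_; have t_' : - e < t < 1 + e by lra.
have [gM gd gdd gt] := H t t_'; split; [exact: gd|exact: gdd| |exact: dgs].
have H1 : `|g t - g 0| <= s0 * (t - 0).
  apply: (@mvt_mx_le _ _ _ g (derive1 g)); first by lra.
    by move=> u u_; have [] := H u; first by lra.
  by move=> u u_; apply: dgs; lra.
have H2 := s0_r; have H3 := s0_gt0.
have -> : g t - xs = (g t - g 0) + (g 0 - xs) by rewrite addrA subrK.
apply: le_trans (ler_normD _ _) _; nra.
Qed.

(** What is kept of a solution with data q: it is a geodesic, and it is defined
    beyond [0, 1], as regularity at the end points requires. *)
Definition good_curve g (dg : R -> 'rV[R]_d) q :=
  [/\ forall t : R, -1 <= t <= 2 -> [/\ is_derive t (1 : R) g (dg t),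
        is_derive t (1 : R) dg (dg t *m B (g t) (dg t)), `|g t - xs| <= r &
        `|dg t| <= 5 * `|q|],
      forall t : R, -1 < t < 2 -> mfd c (g t) /\ tangent c (g t) (dg t),
      geodesic c g, derive1 g 0 = dg 0 &
      `|dg 0 - q| <= 100 * D * `|q| ^+ 2].

Lemma good_curve_sol g dg q : `|q| <= eta -> good_curve g dg q -> geodesic_sol g dg.
Proof.
move=> qe [H _ _ _ _] t t_; have [|gd gdd gr gs] := H t; first by lra.
split; [exact: gd|exact: gdd|exact: gr|].
have := eta_s0; have := s0_gt0; lra.
Qed.

Lemma good_curve_speed g dg q : `|q| <= eta -> good_curve g dg q -> enorm (derive1 g 0) <= s0.
Proof.
move=> qe [H _ _ E _]; rewrite E; apply: le_trans (enorm_le_mxnorm _) _.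
have [|_ _ _ gs] := H 0; first by lra.
rewrite -d_eta; apply: (@le_trans _ _ (d%:R * (5 * eta))).
  by rewrite ler_wpM2l//; lra.
have := d1; have := eta_gt0; nra.
Qed.

Lemma good_curve_ex (theta : R) p q : 0 <= theta <= 1 ->
  mfd c p -> `|p - xs| <= r / 4 -> `|q| <= eta ->
  (theta = 0 -> tangent c p q) -> (theta = 1 -> mfd c (p + q)) ->
  theta = 0 \/ theta = 1 ->
  exists g dg, [/\ good_curve g dg q, g 0 = p, (theta = 0 -> dg 0 = q),
    (theta = 1 -> g 1 = p + q) & `|g 1 - (p + q)| <= 100 * D * `|q| ^+ 2].
Proof.
move=> th pM pr qe qt qM th01.
have [g [dg [H g0 gi gb ge]]] := ode_exists d_gt0 Lam_ge1 B_bound B_lip (transport_opB c)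
   th eta_r eta_D pr qe.
have h01 : -1 < (0 : R) /\ 1 < (2 : R) by split; lra.
have stays : forall t, -1 < t < 2 -> mfd c (g t) /\ tangent c (g t) (dg t).
  apply: (ode_stays c_smooth (proj1 _) (proj2 h01)); first by split; [lra|exact: I].
  - move=> t t_; have [|gd gdd gr _] := H t; first by lra.
    by split; [exact: gd|exact: gdd|exact: r_reg].
  - by rewrite g0.
  - case: th01 => [t0|t1]; first by left; rewrite g0 (gi t0); exact: qt.
    by right; rewrite (gb t1); exact: qM.
have [|gg gE] := @geodesicI R d m c g dg 1 ltr01.
  move=> t t_; have [|gd gdd gr _] := H t; first by lra.
  by split; [apply: (stays t _).1; lra|exact: gd|exact: gdd].
exists g, dg; split; [|exact: g0|exact: gi|exact: gb|exact: ge].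
split; [|exact: stays|exact: gg|by apply: gE; lra|].
  by move=> t t_; have [gd gdd gr [gs _]] := H t t_; split; [exact: gd|exact: gdd|exact: gr|exact: gs].
by have [|_ _ _ []] := H 0; first by lra.
Qed.

Lemma ivp_ex p v : mfd c p -> `|p - xs| <= r / 4 -> tangent c p v -> `|v| <= eta ->
  exists g dg, [/\ good_curve g dg v, g 0 = p, dg 0 = v &
    `|g 1 - (p + v)| <= 100 * D * `|v| ^+ 2].
Proof.
move=> pM pr vt ve.
have [|||||||g [dg [H1 H2 H3 _ H4]]] := @good_curve_ex 0 p v.
- by rewrite lexx ler01.
- exact: pM.
- exact: pr.
- exact: ve.
- by [].
- by move/eqP; rewrite eq_sym oner_eq0.
- by left.
by exists g, dg; split; [exact: H1|exact: H2|exact: H3|exact: H4].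
Qed.

Lemma bvp_ex p y : mfd c p -> mfd c y -> `|p - xs| <= r / 4 -> `|y - p| <= eta ->
  exists g dg, [/\ good_curve g dg (y - p), g 0 = p & g 1 = y].
Proof.
move=> pM yM pr ye.
have E : p + (y - p) = y by rewrite addrC subrK.
have [|||||||g [dg [H1 H2 _ H3 _]]] := @good_curve_ex 1 p (y - p).
- by rewrite lexx ler01.
- exact: pM.
- exact: pr.
- exact: ye.
- by move/eqP; rewrite oner_eq0.
- by rewrite E.
- by right.
by exists g, dg; split; [exact: H1|exact: H2|rewrite H3].
Qed.

Let xsr4 : `|xs - xs| <= r / 4. Proof. by rewrite subrr normr0; have := r_gt0; lra. Qed.

(** ** The exponential map at xs *)

Lemma exp_map_eq g : geodesic c g -> g 0 = xs -> enorm (derive1 g 0) <= s0 ->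
  exp_map c xs (derive1 g 0) = g 1.
Proof.
move=> gg g0 gs; rewrite /exp_map.
have : exists y, [set y | exists g', [/\ geodesic c g', g' 0 = xs,
    derive1 g' 0 = derive1 g 0 & g' 1 = y]] y by exists (g 1), g.
move=> /(xgetPex xs) [g' [gg' g'0 g'd <-]].
have h1 : 0 <= (1 : R) <= 1 by rewrite ler01 lexx.
have [] := @sol_unique g' (derive1 g') g (derive1 g) _ _ _ (or_introl g'd) 1 h1; last by [].
- by apply: slow_geodesic; [exact: gg'|rewrite g'0; exact: xsr4|rewrite g'd].
- by apply: slow_geodesic; [exact: gg|rewrite g0; exact: xsr4|].
- by rewrite g'0 g0.
Qed.

Lemma exp_map_near v : tangent c xs v -> `|v| <= eta ->
  mfd c (exp_map c xs v) /\ `|exp_map c xs v - (xs + v)| <= 100 * D * `|v| ^+ 2.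
Proof.
move=> vt ve; have [g [dg [gc g0 dg0 ge]]] := ivp_ex xs_mfd xsr4 vt ve.
have [_ gM gg gE _] := gc.
have -> : exp_map c xs v = g 1.
  by rewrite -dg0 -gE; apply: exp_map_eq; [exact: gg|exact: g0|exact: good_curve_speed gc].
by split; [apply: (gM 1 _).1; lra|exact: ge].
Qed.

(** A small preimage of y under the exponential map is the initial velocity of
    the geodesic that solves the boundary value problem. *)
Lemma exp_map_inj v y g dg : tangent c xs v -> `|v| <= eta -> exp_map c xs v = y ->
  `|y - xs| <= eta -> good_curve g dg (y - xs) -> g 0 = xs -> g 1 = y -> dg 0 = v.
Proof.
move=> vt ve vy ye gc g0 g1; have [h [dh [hc h0 dh0 _]]] := ivp_ex xs_mfd xsr4 vt ve.
have [_ _ hh hE _] := hc.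
have h1 : h 1 = y.
  rewrite -vy -dh0 -hE; apply/esym.
  by apply: exp_map_eq; [exact: hh|exact: h0|exact: good_curve_speed hc].
have h00 : 0 <= (0 : R) <= 1 by rewrite ler01 lexx.
have [] := @sol_unique g dg h dh (good_curve_sol ye gc) (good_curve_sol ve hc) _
  (or_intror _) 0 h00; first by rewrite g0 h0.
  by rewrite g1 h1.
by move=> _ ->.
Qed.

Lemma exp_inv_near y : mfd c y -> `|y - xs| <= eta / (5 * d%:R) ->
  `|exp_inv c xs y - (y - xs)| <= 100 * D * `|y - xs| ^+ 2.
Proof.
move=> yM yn.
have [dd eg] := (d1, eta_gt0).
have yd : d%:R * (5 * `|y - xs|) <= eta.
  apply: (@le_trans _ _ (d%:R * (5 * (eta / (5 * d%:R))))).
    by rewrite !ler_wpM2l.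
  by rewrite le_eqVlt; apply/orP; left; apply/eqP; field; lra.
have y5 : 5 * `|y - xs| <= eta.
  apply: le_trans yd; rewrite -[leLHS]mul1r ler_wpM2r// mulr_ge0//.
have ye : `|y - xs| <= eta by have := normr_ge0 (y - xs); lra.
have [g [dg [gc g0 g1]]] := bvp_ex xs_mfd yM xsr4 ye.
have [H gM gg gE gest] := gc.
have dg5 : `|dg 0| <= 5 * `|y - xs| by have [|_ _ _ H5] := H 0; first by lra.
have dgt : tangent c xs (dg 0) by rewrite -g0; apply: (gM 0 _).2; lra.
have dge : `|dg 0| <= eta by lra.
have edg : exp_map c xs (dg 0) = y.
  by rewrite -gE -g1; apply: exp_map_eq; [exact: gg|exact: g0|exact: good_curve_speed gc].
have dgen : enorm (dg 0) <= eta.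
  apply: le_trans (enorm_le_mxnorm _) _; apply: le_trans yd.
  by rewrite ler_wpM2l.
have small w : tangent c xs w -> exp_map c xs w = y -> enorm w <= enorm (dg 0) -> w = dg 0.
  move=> wt wy ww; apply/esym; apply: (exp_map_inj wt _ wy ye gc g0 g1).
  apply: le_trans (mxnorm_le_enorm _) _; exact: le_trans ww dgen.
suff -> : exp_inv c xs y = dg 0 by [].
rewrite /exp_inv.
have : exists v, [set v | [/\ tangent c xs v, exp_map c xs v = y &
     forall w, tangent c xs w -> exp_map c xs w = y -> enorm v <= enorm w]] v.
  exists (dg 0); split; [exact: dgt|exact: edg|].
  move=> w wt wy; rewrite leNgt; apply/negP => wl.
  by have := small w wt wy (ltW wl) => wE; rewrite wE ltxx in wl.
move=> /(xgetPex 0) [vt vy vmin]; apply: small => //; exact: vmin.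
Qed.

(** ** Short geodesics and parallel transport *)

Section TwoPoints.
Variables x y : 'rV[R]_d.
Hypotheses (x_mfd : mfd c x) (y_mfd : mfd c y).
Hypotheses (x_near : `|x - xs| <= r / 4) (xy_near : `|y - x| <= eta).
Variables (g dg : R -> 'rV[R]_d).
Hypotheses (gc : good_curve g dg (y - x)) (g0 : g 0 = x) (g1 : g 1 = y).

Let gg : geodesic c g. Proof. by case: gc. Qed.

(** A geodesic that is not longer is slow, hence caught by uniqueness: the small
    solution of the boundary value problem is the only shortest geodesic. *)
Lemma shorter_unique h : geodesic c h -> h 0 = x -> h 1 = y ->
  (curve_length h <= curve_length g)%E ->
  forall t : R, 0 <= t <= 1 -> h t = g t /\ derive1 h t = dg t.
Proof.
move=> hh h0 h1; rewrite (geodesic_length c_smooth c_licq hh) (geodesic_length c_smooth c_licq gg).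
rewrite lee_fin => hs.
have gs := good_curve_speed xy_near gc.
apply: sol_unique.
- by apply: slow_geodesic; [exact: hh|rewrite h0; exact: x_near|exact: le_trans hs gs].
- exact: good_curve_sol xy_near gc.
- by rewrite h0 g0.
- by right; rewrite h1 g1.
Qed.

Lemma good_curve_short : short_geodesic c x y g.
Proof.
split; [exact: gg|exact: g0|exact: g1|] => h hh h0 h1.
rewrite leNgt; apply/negP => lt_hg.
have h00 : 0 <= (0 : R) <= 1 by rewrite ler01 lexx.
have [_ E] := shorter_unique hh h0 h1 (ltW lt_hg) h00.
move: lt_hg; rewrite (geodesic_length c_smooth c_licq hh) (geodesic_length c_smooth c_licq gg) E.
by have [_ _ _ -> _] := gc; rewrite ltxx.
Qed.

Lemma short_unique h : short_geodesic c x y h ->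
  forall t : R, 0 <= t <= 1 -> h t = g t /\ derive1 h t = dg t.
Proof.
move=> [hh h0 h1 hmin]; apply: (shorter_unique hh h0 h1).
by apply: hmin; [exact: gg|exact: g0|exact: g1].
Qed.

Let E t := B (g t) (dg t).
Let q := y - x.

Let E_le t : -1 <= t <= 2 -> `|E t| <= 5 * Lam * `|q|.
Proof.
move=> t_; have [H _ _ _ _] := gc; have [_ _ gr gs] := H t t_.
apply: le_trans (B_bound _ gr) _; have := Lam_ge1; rewrite -/q in gs *.
by move=> L1; rewrite -mulrA mulrCA ler_wpM2l//; lra.
Qed.

Let E_small : 3 * d%:R * (5 * Lam * `|q|) <= 1.
Proof.
have := eta_D; have := D_ge1; have := xy_near; rewrite -/q => qe DD De.
have -> : 3 * d%:R * (5 * Lam * `|q|) = 15 * D * `|q| by rewrite /D; ring.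
have := normr_ge0 q; nra.
Qed.

Lemma parallel_linear h X : short_geodesic c x y h -> parallel_along c h X ->
  forall t : R, 0 <= t <= 1 -> is_derive t (1 : R) X (X t *m E t).
Proof.
move=> hs [e e0 H] t t_; have [hh _ _ _] := hs.
have t_' : - e < t < 1 + e by lra.
have [Xt Xd Xn] := H t t_'.
have dX : is_derive t (1 : R) X (derive1 X t) := derivable_is_derive1 Xd.
have [e' e'0 H'] := geodesicE c_smooth c_licq hh.
have [|hM hd _ _] := H' t; first by lra.
have tang (s : R) : - e < s < 1 + e -> tangent c (h s) (X s) by move=> /H[].
have := tangent_derivative c_smooth c_licq t_' tang dX hd hM Xn.
have [-> ->] := short_unique hs t_.
by rewrite -/(E t) => <-.
Qed.

Lemma parallel_ex w : tangent c x w -> exists X, [/\ X 0 = w, parallel_along c g X &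
  forall t : R, 0 <= t <= 1 -> is_derive t (1 : R) X (X t *m E t) /\ tangent c (g t) (X t)].
Proof.
move=> wt; have [H gM _ _ _] := gc.
have q0 := normr_ge0 q; have L0 : 0 <= Lam by have := Lam_ge1; lra.
have D0 : 0 <= D by have := D_ge1; lra.
pose k := Lam * (5 * `|q|) * (5 * `|q|) + Lam * (D * (5 * `|q|) ^+ 2).
have k0 : 0 <= k by rewrite addr_ge0 ?mulr_ge0.
have E_lip s t : - 1 / 2 <= s <= 3 / 2 -> - 1 / 2 <= t <= 3 / 2 ->
    `|E s - E t| <= k * `|s - t|.
  move=> s_ t_; have [|_ _ gsr gss] := H s; first by lra.
  have [|_ _ gtr gts] := H t; first by lra.
  have in12 u : Num.min t s <= u <= Num.max t s -> -1 <= u <= 2.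
    by rewrite ge_min le_max => /andP[/orP[]? /orP[]?]; lra.
  have e1 : `|g s - g t| <= 5 * `|q| * `|s - t|.
    by apply: (@mvt_mx_abs _ _ _ g dg) => u /in12/H[].
  have e2 : `|dg s - dg t| <= D * (5 * `|q|) ^+ 2 * `|s - t|.
    apply: (@mvt_mx_abs _ _ _ dg (fun t => dg t *m B (g t) (dg t))) => u /in12/H[] // _ _ ur us.
    apply: le_trans (acc_le B_bound _ ur) _; rewrite -/D ler_wpM2l//.
    by rewrite lerXn2r ?nnegrE// mulr_ge0.
  have -> : E s - E t = (B (g s) (dg s) - B (g t) (dg s)) + B (g t) (dg s - dg t).
    by rewrite transport_opB addrA subrK.
  apply: le_trans (ler_normD _ _) _; rewrite /k mulrDl lerD//.
    apply: le_trans (B_lip _ gsr gtr) _.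
    have -> : Lam * (5 * `|q|) * (5 * `|q|) * `|s - t| =
       Lam * (5 * `|q| * `|s - t|) * (5 * `|q|) by ring.
    by rewrite ler_pM ?mulr_ge0 ?ler_wpM2l.
  apply: le_trans (B_bound _ gtr) _; rewrite -mulrA ler_wpM2l//.
have E_le' t : - 1 / 2 <= t <= 3 / 2 -> `|E t| <= 5 * Lam * `|q|.
  by move=> t_; apply: E_le; lra.
have [X [X0 dX]] := linear_ode_exists w k0 E_small E_lip E_le'.
have Xt (t : R) : - 1 / 2 < t < 3 / 2 -> tangent c (g t) (X t).
  have a0 : - 1 / 2 < (0 : R) by lra.
  have b0 : 0 < (3 / 2 : R) by lra.
  apply: (parallel_stays c_smooth (dg := dg) a0 b0); last by rewrite g0 X0.
  move=> u u_; have [|gd _ gr _] := H u; first by lra.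
  by split; [exact: gd|apply: dX; lra|exact: r_reg].
exists X; split; first exact: X0.
  exists (1 / 2); first by lra.
  move=> t t_; have t_' : - 1 / 2 <= t <= 3 / 2 by lra.
  have Xd := dX t t_'; split; [by apply: Xt; lra|by case: Xd|].
  rewrite (is_derive1 Xd); exact: transport_op_normal.
by move=> t t_; split; [apply: dX; lra|apply: Xt; lra].
Qed.

Lemma parallel_unique X1 X2 :
  (forall t : R, 0 <= t <= 1 -> is_derive t (1 : R) X1 (X1 t *m E t)) ->
  (forall t : R, 0 <= t <= 1 -> is_derive t (1 : R) X2 (X2 t *m E t)) ->
  X1 0 = X2 0 -> X1 1 = X2 1.
Proof.
move=> H1 H2 X0; apply: (linear_ode_unique (E := E) (e := 5 * Lam * `|q|) _ _ H1 H2 X0).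
- have := E_small; have := normr_ge0 (E 0).
  have := @E_le 0; have : 0 <= d%:R :> R by []; nra.
- by move=> t t_; apply: E_le; lra.
- by rewrite ler01 lexx.
Qed.

Lemma ptrans_eq h X : short_geodesic c x y h -> parallel_along c h X ->
  ptrans c x y (X 0) = X 1.
Proof.
move=> hs hX; rewrite /ptrans.
have : exists w', [set w' | exists g' X', [/\ short_geodesic c x y g',
  parallel_along c g' X', X' 0 = X 0 & X' 1 = w']] w' by exists (X 1), h, X.
move=> /(xgetPex 0) [g' [X' [g's g'X X'0 <-]]].
by apply: parallel_unique X'0; [exact: parallel_linear g's g'X|exact: parallel_linear hs hX].
Qed.

End TwoPoints.

Let near_pair x y := [/\ mfd c x, mfd c y, `|x - xs| <= r / 4 & `|y - x| <= eta].

(** The estimate integrates the derivative of X projected on the tangent space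
    at y: that derivative is normal at the current point, so only the
    difference of two projections remains. *)
Lemma ptrans_family x y : near_pair x y -> exists g, short_geodesic c x y g /\
  forall w, tangent c x w -> exists X, [/\ X 0 = w, parallel_along c g X,
    ptrans c x y w = X 1, tangent c y (X 1) &
    `|X 1 - w *m tproj c y| <= 25 * d%:R ^+ 3 * Lam ^+ 2 * `|y - x| ^+ 2 * `|w|].
Proof.
move=> [xM yM xn xy]; have [g [dg [gc g0 g1]]] := bvp_ex xM yM xn xy.
have gs := good_curve_short xn xy gc g0 g1.
exists g; split; first exact: gs.
move=> w wt; have [X [X0 gX HX]] := parallel_ex xy gc g0 wt.
have h1 : 0 <= (1 : R) <= 1 by rewrite ler01 lexx.
have X1t : tangent c y (X 1) by rewrite -g1; exact: (HX 1 h1).2.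
exists X; split; [exact: X0|exact: gX| |exact: X1t|].
  by rewrite -X0; exact: (ptrans_eq xn xy gc g0 g1 gs gX).
have [H gM _ _ _] := gc; set q := y - x in H *.
have q0 := normr_ge0 q; have L0 : 0 <= Lam by have := Lam_ge1; lra.
have w0 := normr_ge0 w.
have X_le (t : R) : 0 <= t <= 1 -> `|X t| <= d%:R * `|w|.
  move=> t_; apply: le_trans (mxnorm_le_enorm _) _.
  apply: le_trans (enorm_le_mxnorm w); rewrite -X0 /enorm.
  by rewrite (parallel_dot gX gX t_) lexx.
have y_r : `|y - xs| <= r.
  by have [|_ _] := H 1; [lra|rewrite g1].
have := @mvt_mx_le R _ _ (fun t => X t *m tproj c y)
  (fun t => X t *m B (g t) (dg t) *m tproj c y) 0 1
  (25 * d%:R ^+ 3 * Lam ^+ 2 * `|q| ^+ 2 * `|w|) ler01.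
rewrite X0 (tangent_tproj X1t) subr0 mulr1; apply=> t t_.
  exact: is_derive_mulmxr (HX t t_).1.
have [|gd _ gr gv] := H t; first by lra.
have -> : X t *m B (g t) (dg t) *m tproj c y =
    X t *m B (g t) (dg t) *m (tproj c y - tproj c (g t)).
  have Z : X t *m B (g t) (dg t) *m tproj c (g t) = 0.
    by apply: normal_tproj; [exact: r_reg|exact: transport_op_normal].
  by rewrite (mulmx_subr0 _ Z).
have e1 : `|y - g t| <= 5 * `|q|.
  rewrite -g1; have e2 : `|g 1 - g t| <= 5 * `|q| * (1 - t).
    apply: (@mvt_mx_le _ _ _ g dg); first by lra.
      by move=> u u_; have [|] := H u; first by lra.
    by move=> u u_; have [|] := H u; first by lra.
  by apply: le_trans e2 _; nra.
apply: le_trans (mxnormM _ _) _.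
have e2 : `|X t *m B (g t) (dg t)| <= d%:R * (d%:R * `|w|) * (Lam * (5 * `|q|)).
  apply: le_trans (mxnormM _ _) _; rewrite ler_pM ?mulr_ge0//.
    by rewrite ler_wpM2l//; exact: X_le.
  by apply: le_trans (B_bound _ gr) _; rewrite ler_wpM2l.
have e3 : `|tproj c y - tproj c (g t)| <= Lam * (5 * `|q|).
  by apply: le_trans (P_lip y_r gr) _; rewrite ler_wpM2l.
apply: (@le_trans _ _ (d%:R * (d%:R * (d%:R * `|w|) * (Lam * (5 * `|q|))) * (Lam * (5 * `|q|)))).
  by rewrite ler_pM ?mulr_ge0 ?ler_wpM2l.
by rewrite le_eqVlt; apply/orP; left; apply/eqP; ring.
Qed.

Lemma ptrans_any x y g X : near_pair x y -> short_geodesic c x y g ->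
  parallel_along c g X -> ptrans c x y (X 0) = X 1.
Proof.
move=> [xM yM xn xy] gs gX; have [h [dh [hc h0 h1]]] := bvp_ex xM yM xn xy.
exact: (ptrans_eq xn xy hc h0 h1 gs gX).
Qed.

Lemma ptrans_linear x y : near_pair x y ->
  linear (fun v => ptrans c x y (v *m tproj c x)).
Proof.
move=> xy a v w; have [g [gs H]] := ptrans_family xy.
have [xM _ _ _] := xy; have xreg := mfd_regular c_licq xM.
have [X [X0 gX -> _ _]] := H _ (tproj_tangent v xreg).
have [Y [Y0 gY -> _ _]] := H _ (tproj_tangent w xreg).
rewrite mulmxDl -scalemxAl -X0 -Y0.
exact: (ptrans_any xy gs (parallel_linear_comb a gX gY)).
Qed.

Lemma mul_ptransmx x y v : near_pair x y ->
  v *m ptransmx c x y = ptrans c x y (v *m tproj c x).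
Proof.
move=> xy; pose f : {linear 'rV[R]_d -> 'rV[R]_d} :=
  HB.pack (fun v => ptrans c x y (v *m tproj c x))
    (GRing.isLinear.Build R 'rV[R]_d 'rV[R]_d *:%R _ (ptrans_linear xy)).
exact: (mul_rV_lin1 f v).
Qed.

Lemma mulmx_rows_eq p q (M N : 'M[R]_(p, q)) : (forall v : 'rV[R]_p, v *m M = v *m N) -> M = N.
Proof. by move=> H; apply/row_matrixP => i; rewrite !rowE. Qed.

Lemma ptransmx_tproj x y : near_pair x y ->
  ptransmx c x y *m tproj c y = ptransmx c x y /\
  tproj c x *m ptransmx c x y = ptransmx c x y.
Proof.
move=> xy; have [xM yM _ _] := xy; have xreg := mfd_regular c_licq xM.
have [g [gs H]] := ptrans_family xy; split; apply: mulmx_rows_eq => v.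
  rewrite mulmxA mul_ptransmx//.
  have [X [X0 gX -> Xt _]] := H _ (tproj_tangent v xreg).
  exact: tangent_tproj.
by rewrite mulmxA !mul_ptransmx// -mulmxA tproj_idem.
Qed.

Lemma ptransmx_isometry x y : near_pair x y ->
  ptransmx c x y *m (ptransmx c x y)^T = tproj c x.
Proof.
move=> xy; have [xM yM _ _] := xy; have xreg := mfd_regular c_licq xM.
have [g [gs H]] := ptrans_family xy.
have dot v w : v *m (ptransmx c x y *m (ptransmx c x y)^T) *m w^T = v *m tproj c x *m w^T.
  have [X [X0 gX XE _ _]] := H _ (tproj_tangent v xreg).
  have [Y [Y0 gY YE _ _]] := H _ (tproj_tangent w xreg).
  have h1 : 0 <= (1 : R) <= 1 by rewrite ler01 lexx.
  have -> : v *m (ptransmx c x y *m (ptransmx c x y)^T) *m w^T =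
      (v *m ptransmx c x y) *m (w *m ptransmx c x y)^T by rewrite trmx_mul !mulmxA.
  rewrite (mul_ptransmx v xy) (mul_ptransmx w xy) XE YE.
  rewrite (parallel_dot gX gY h1) X0 Y0 trmx_mul tproj_tr !mulmxA.
  by rewrite -[v *m _ *m tproj c x]mulmxA tproj_idem.
apply: mulmx_rows_eq => v; apply: trmx_inj; apply: mulmx_rows_eq => w.
have := congr1 trmx (dot v w); rewrite [LHS]trmx_mul [RHS]trmx_mul.
by rewrite trmxK.
Qed.

Lemma ptransmx_inverse x y : near_pair x y -> near_pair y x ->
  ptransmx c x y *m ptransmx c y x = tproj c x.
Proof.
move=> xy yx; have [xM yM _ _] := xy; have xreg := mfd_regular c_licq xM.
have [g [gs H]] := ptrans_family xy; apply: mulmx_rows_eq => v.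
rewrite mulmxA (mul_ptransmx _ yx) (mul_ptransmx v xy).
have [X [X0 gX -> Xt _]] := H _ (tproj_tangent v xreg).
rewrite (tangent_tproj Xt) -X0.
have gs' := short_geodesic_rev c_smooth c_licq gs.
have gX' := parallel_rev gX.
by have := ptrans_any yx gs' gX'; rewrite subr0 subrr.
Qed.

Lemma tproj_le1 x : regular c x -> `|tproj c x| <= 1.
Proof.
move=> xreg; set P := tproj c x.
have E i : P i i = \sum_j P i j ^+ 2.
  have /matrixP/(_ i i) := tproj_idem xreg; rewrite mxE => <-.
  apply: eq_bigr => j _; rewrite expr2 -/P; congr (_ * _).
  by rewrite -[LHS]/(P j i) -[P in LHS]tproj_tr mxE.
have le_diag i j : P i j ^+ 2 <= P i i.
  by rewrite E (bigD1 j)//= lerDl sumr_ge0// => l _; exact: sqr_ge0.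
apply: mxnorm_le => // i j.
have Pii : P i i <= 1 by have := le_diag i i; have := sqr_ge0 (P i i); nra.
rewrite -(@ler_pXn2r _ 2)// ?nnegrE// expr1n real_normK ?num_real//.
exact: le_trans (le_diag i j) Pii.
Qed.

Lemma ptransmx_near x y : near_pair x y ->
  `|ptransmx c x y - tproj c x *m tproj c y| <= 25 * d%:R ^+ 3 * Lam ^+ 2 * `|y - x| ^+ 2.
Proof.
move=> xy; have [xM yM _ _] := xy; have xreg := mfd_regular c_licq xM.
have [g [gs H]] := ptrans_family xy.
have K0 : 0 <= 25 * d%:R ^+ 3 * Lam ^+ 2 * `|y - x| ^+ 2.
  by rewrite !mulr_ge0 ?exprn_ge0//; have := Lam_ge1; lra.
apply: mxnorm_le => // i j.
have [X [X0 gX XE Xt Xl]] := H _ (tproj_tangent (delta_mx 0 i) xreg).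
have -> : (ptransmx c x y - tproj c x *m tproj c y) i j =
    (X 1 - delta_mx 0 i *m tproj c x *m tproj c y) 0 j.
  by rewrite -XE -(mul_ptransmx _ xy) -mulmxA -mulmxBr -rowE [RHS]mxE.
apply: le_trans (mxnorm_ub _ _ _) _; apply: le_trans Xl _.
rewrite -[leRHS]mulr1 ler_wpM2l// -rowE; apply: le_trans (tproj_le1 xreg).
by apply: mxnorm_le => // k l; rewrite mxE mxnorm_ub.
Qed.

Lemma geodist_le x y : near_pair x y -> (geodist c x y <= (5 * d%:R * `|y - x|)%:E)%E.
Proof.
move=> [xM yM xn xy]; have [g [dg [gc g0 g1]]] := bvp_ex xM yM xn xy.
have [H _ gg gE _] := gc.
apply: (@le_trans _ _ (curve_length g)).
  apply: ereal_inf_lbound; exists g => //.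
  have [e e0 Hg] := geodesicE c_smooth c_licq gg.
  split; [exact: g0|exact: g1|exists e; first exact: e0].
  move=> t /Hg[gM [gd _] gdd _]; split; [exact: gM|exact: gd|].
  exact: is_derive_continuous gdd.
rewrite (geodesic_length c_smooth c_licq gg) lee_fin gE.
apply: le_trans (enorm_le_mxnorm _) _.
have [|_ _ _ gv] := H 0; first by lra.
by rewrite [5 * _]mulrC -mulrA ler_wpM2l.
Qed.

Lemma local_geometry_with_bounds : exists rho K : R, 0 < rho /\ normal_coordinates c xs rho K.
Proof.
have [eg dd] := (eta_gt0, d1).
pose rho := eta / (5 * d%:R).
have rho0 : 0 < rho by rewrite divr_gt0// mulr_gt0//; lra.
have rho_eta : 5 * rho <= eta.
  have E : 5 * d%:R * rho = eta by rewrite /rho; field; lra.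
  by rewrite -E; nra.
pose K := 100 * D + 25 * d%:R ^+ 3 * Lam ^+ 2 + 5 * d%:R.
have L0 : 0 <= Lam by have := Lam_ge1; lra.
have Ka : 0 <= 25 * d%:R ^+ 3 * Lam ^+ 2 by rewrite !mulr_ge0 ?exprn_ge0.
have Kb : 0 <= 100 * D by rewrite mulr_ge0//; have := D_ge1; lra.
have K1 : 100 * D <= K by rewrite /K; lra.
have K3 : 5 * d%:R <= K by rewrite /K; lra.
have K2 : 25 * d%:R ^+ 3 * Lam ^+ 2 <= K by rewrite /K; lra.
exists rho, K; split; first exact: rho0.
split.
- move=> v vt vr; have [|H1 H2] := exp_map_near vt; first by lra.
  by split; [exact: H1|apply: le_trans H2 _; rewrite ler_wpM2r ?sqr_ge0].
- move=> y yM yr; apply: le_trans (exp_inv_near yM yr) _.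
  by rewrite ler_wpM2r ?sqr_ge0.
move=> x y xM yM xr yr.
have [sr es] := (s0_r, eta_s0).
have npair u v : mfd c u -> mfd c v -> `|u - xs| <= rho -> `|v - xs| <= rho -> near_pair u v.
  move=> uM vM ur vr; split; [exact: uM|exact: vM|lra|].
  have -> : v - u = (v - xs) - (u - xs) by rewrite opprB addrA subrK.
  by apply: le_trans (ler_normB _ _) _; lra.
have xy := npair x y xM yM xr yr; have yx := npair y x yM xM yr xr.
have I1 := ptransmx_inverse xy yx; have I2 := ptransmx_inverse yx xy.
have [T1 T2] := ptransmx_tproj xy; have [T3 T4] := ptransmx_tproj yx.
split; [|exact: I1|exact: T1| |].
  have PT' : tproj c y *m (ptransmx c x y)^T = (ptransmx c x y)^T.
    by rewrite -[tproj c y]tproj_tr -trmx_mul T1.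
  exact: isometry_inverse (ptransmx_isometry xy) I2 PT' T3.
  by apply: le_trans (ptransmx_near xy) _; rewrite ler_wpM2r ?sqr_ge0.
by apply: le_trans (geodist_le xy) _; rewrite lee_fin ler_wpM2r.
Qed.

End LocalGeometry.

Lemma local_geometry (R : realType) (d m : nat) (c : 'I_m -> 'rV[R]_d -> R) xs :
  (forall i, smooth (c i)) -> licq c -> (0 < d)%N -> mfd c xs ->
  exists rho K : R, 0 < rho /\ normal_coordinates c xs rho K.
Proof.
move=> c_smooth c_licq d_gt0 xsM.
have [r [Lam [r0 L1 reg Bb [Bl Pl]]]] := local_bounds c_smooth c_licq xsM.
exact: (local_geometry_with_bounds c_smooth c_licq d_gt0 xsM r0 L1 reg Bb Bl Pl).
Qed.

(** * The data at the saddle point *)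

Section Saddle.
Context {R : realType}.

(** P - W^T W is a symmetric idempotent of trace zero, hence zero. *)
Lemma orthonormal_rows_proj n p (P : 'M[R]_p) (W : 'M[R]_(n, p)) :
  P^T = P -> P *m P = P -> W *m W^T = 1%:M -> W *m P = W -> \tr P = n%:R ->
  W^T *m W = P.
Proof.
move=> PT PP WW WP trP.
have PW : P *m W^T = W^T by rewrite -{1}PT -trmx_mul WP.
suff : P - W^T *m W = 0 by move/eqP; rewrite subr_eq0 => /eqP.
apply: sym_idem_trace0.
- by rewrite linearB/= trmx_mul trmxK PT.
- rewrite mulmxBl !mulmxBr PP mulmxA PW -[_ *m P]mulmxA WP.
  by rewrite -mulmxA [W *m (_ *m _)]mulmxA WW mul1mx subrr subr0.
by rewrite linearB/= trP mxtrace_mulC WW mxtrace1 subrr.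
Qed.

Lemma tproj_trace (d m : nat) (c : 'I_m -> 'rV[R]_d -> R) x :
  regular c x -> row_free (cgrad c x) -> \tr (tproj c x) = (d - m)%:R.
Proof.
move=> xr xf.
have md : (m <= d)%N by rewrite -(eqP xf) rank_leq_col.
rewrite /tproj linearB/= mxtrace1 -mulmxA mxtrace_mulC -mulmxA mulVmx//.
by rewrite mxtrace1 natrB.
Qed.

Definition reflection_signs n (k : nat) : 'rV[R]_n :=
  \row_i (if (i < k)%N then -1 else 1).

(** The given eigenvectors need not be rows of V, but they vanish against the
    eigenvectors for positive eigenvalues, so by rank both families span the
    negative eigenspace and define the same reflection. *)
Lemma saddle_data (d m k : nat) (c : 'I_m -> 'rV[R]_d -> R) xs (vs : 'M[R]_(k, d))
    (H V s : _) (mu L : R) :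
  regular c xs -> row_free (cgrad c xs) -> (k <= d - m)%N -> 0 < mu ->
  eigendecomp c xs H V s ->
  (forall i : 'I_(d - m), ((i < k)%N -> - L <= s 0 i <= - mu) /\
           ((k <= i)%N -> mu <= s 0 i <= L)) ->
  vs *m vs^T = 1%:M -> (forall i, tangent c xs (row i vs)) ->
  (forall i, exists2 l : R, l < 0 & row i vs *m H = l *: row i vs) ->
  let sg := reflection_signs (d - m) k in
  [/\ orthonormal_frame c xs V,
      forall i, mu <= sg 0 i * s 0 i <= L &
      tproj c xs - 2 *: \sum_i (row i vs)^T *m row i vs = V^T *m diag_mx sg *m V].
Proof.
move=> xr xf km mu0 [VV VC HE _] sb vv vt ve sg.
have VP := tangent_tproj VC.
have VTV := orthonormal_rows_proj (tproj_tr c xs) (tproj_idem xr) VV VP (tproj_trace xr xf).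
split=> [//|i|].
  rewrite mxE; have [sl sr] := sb i; case: ltnP => ik.
    by have := sl ik; rewrite mulN1r => /andP[a b]; apply/andP; split; lra.
  by rewrite mul1r; exact: sr.
have vP : vs *m tproj c xs = vs.
  by apply: tangent_tproj; apply/row_matrixP => i; rewrite row_mul row0; exact: vt.
pose W := vs *m V^T; pose e : 'rV[R]_(d - m) := \row_i (i < k)%:R.
have WV : W *m V = vs by rewrite /W -mulmxA VTV.
have WW : W *m W^T = 1%:M by rewrite /W trmx_mul trmxK mulmxA -/W WV.
have Ws (i : 'I_k) (j : 'I_(d - m)) : (k <= j)%N -> W i j = 0.
  move=> kj; have [l l0 vl] := ve i.
  have E : row i W *m diag_mx s = l *: row i W.
    have := congr1 (fun u : 'rV[R]_d => u *m V^T) vl.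
    rewrite -{1}WV HE -scalemxAl -!row_mul -/W !mulmxA -[_ *m V *m V^T]mulmxA VV mulmx1.
    by rewrite -[W *m V *m V^T]mulmxA VV mulmx1.
  have := congr1 (fun u : 'rV[R]_(d - m) => u 0 j) E; rewrite mul_mx_diag !mxE => /eqP.
  rewrite mulrC -subr_eq0 -mulrBl mulf_eq0 => /orP[|/eqP//].
  have [_ /(_ kj)/andP[sj _]] := sb j.
  by move/eqP => ?; lra.
have We : W *m diag_mx e = W.
  apply/matrixP => i j; rewrite mul_mx_diag !mxE; case: ltnP => kj; first by rewrite mulr1.
  by rewrite mulr0; have := Ws i j kj; rewrite mxE => ->.
have ee : diag_mx e *m diag_mx e = diag_mx e.
  rewrite mulmx_diag; congr diag_mx; apply/rowP => i; rewrite !mxE.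
  by case: ltnP; rewrite ?mulr1 ?mulr0.
have tre : \tr (diag_mx e) = k%:R.
  rewrite mxtrace_diag -[in RHS](card_ord_lt km) -sum1dep_card natr_sum [RHS]big_mkcond/=.
  by apply: eq_bigr => i _; rewrite mxE; case: ltnP.
have WTW := orthonormal_rows_proj (tr_diag_mx e) ee WW We tre.
have -> : \sum_i (row i vs)^T *m row i vs = vs^T *m vs.
  apply/matrixP => a b; rewrite summxE mxE; apply: eq_bigr => i _.
  by rewrite !mxE big_ord1 !mxE.
rewrite -{1}WV -[in X in _ *: (_ *m X)]WV trmx_mul -VTV.
have -> : V^T *m W^T *m (W *m V) = V^T *m diag_mx e *m V.
  by rewrite mulmxA -[_ *m W]mulmxA WTW.
have -> : diag_mx sg = 1%:M - 2 *: diag_mx e.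
  apply/matrixP => a b; rewrite !mxE; case: eqP => _; rewrite ?mulr0n ?mulr1n ?mulr0 ?subr0//.
  by case: ltnP => _; rewrite ?mulr1 ?mulr0 ?subr0//; lra.
by rewrite mulmxBr mulmx1 mulmxBl -scalemxAr -scalemxAl.
Qed.

End Saddle.

(** * Spectrum and iterates of a triangular linear map *)

Section Spectrum.
Context {R : realType}.

Lemma complex_norm_le (a b B : R) : 0 <= B -> a ^+ 2 + b ^+ 2 <= B ^+ 2 ->
  complex.Re `|Complex a b| <= B.
Proof. by move=> B0 ab; rewrite normc_def /= -(ger0_norm B0) -sqrtr_sqr ler_wsqrtr. Qed.

(** Real and imaginary parts turn a complex eigenvector into a real plane, on
    which real functionals can be evaluated. *)
Lemma eigenvalue_pair n (J : 'M[R]_n) (l : R[i]) :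
  eigenvalue (map_mx (real_complex R) J) l ->
  exists a b : 'rV[R]_n, [/\ ~ (a = 0 /\ b = 0),
    a *m J = complex.Re l *: a - complex.Im l *: b &
    b *m J = complex.Im l *: a + complex.Re l *: b].
Proof.
move=> /eigenvalueP[w wJ w0].
exists (map_mx (@complex.Re R) w), (map_mx (@complex.Im R) w); split.
- move=> [wr wi]; case/eqP: w0; apply/rowP => i.
  have := congr1 (fun u : 'rV[R]_n => u 0 i) wr; have := congr1 (fun u : 'rV[R]_n => u 0 i) wi.
  by rewrite !mxE; case: (w 0 i) => x y /= -> ->.
- apply/rowP => i; have := congr1 (fun u : 'rV[R[i]]_n => complex.Re (u 0 i)) wJ.
  rewrite !mxE raddf_sum => E; rewrite -[RHS]/(complex.Re l * complex.Re (w 0 i) - complex.Im l * complex.Im (w 0 i)).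
  transitivity (complex.Re (l * w 0 i)); last by case: l {E wJ} => ? ?; case: (w 0 i).
  rewrite -E; apply: eq_bigr => j _; rewrite !mxE; case: (w 0 j) => x y /=; ring.
apply/rowP => i; have := congr1 (fun u : 'rV[R[i]]_n => complex.Im (u 0 i)) wJ.
rewrite !mxE raddf_sum => E.
transitivity (complex.Im (l * w 0 i)); last by case: l {E wJ} => ? ?; case: (w 0 i) => ? ? /=; rewrite addrC.
rewrite -E; apply: eq_bigr => j _; rewrite !mxE; case: (w 0 j) => x y /=; ring.
Qed.

Lemma spectral_radius_lt1 n (J : 'M[R]_n) (B : R) : 0 <= B < 1 ->
  (forall l : R[i], eigenvalue (map_mx (real_complex R) J) l ->
     complex.Re l ^+ 2 + complex.Im l ^+ 2 <= B ^+ 2) ->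
  spectral_radius J < 1.
Proof.
move=> /andP[B0 B1] H; rewrite /spectral_radius.
set E := [set _ | _ in _].
have [->|/set0P E0] := eqVneq E set0; first by rewrite sup0.
apply: le_lt_trans B1; apply: ge_sup => // _ [l /H lB <-].
by case: l lB => a b; apply: complex_norm_le.
Qed.

(** A functional that J multiplies by t detects no other eigenvalue than t. *)
Lemma eigen_functional n (J : 'M[R]_n) (x y : R) (phi : 'rV[R]_n -> R)
    (u v : 'rV[R]_n) (t : R) :
  scalar phi -> u *m J = x *: u - y *: v -> v *m J = y *: u + x *: v ->
  phi (u *m J) = t * phi u -> phi (v *m J) = t * phi v ->
  (phi u = 0 /\ phi v = 0) \/ (x = t /\ y = 0).
Proof.
move=> plin uJ vJ pu pv.
have pE a' b' : phi (a' *: u + b' *: v) = a' * phi u + b' * phi v.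
  have p0 : phi 0 = 0 by have := plin (-1) 0 0; rewrite scaler0 addr0 => ->; rewrite mulN1r addNr.
  have pZ w (r : R) : phi (r *: w) = r * phi w by have := plin r w 0; rewrite !addr0 p0 addr0.
  by rewrite plin pZ.
have E1 : x * phi u - y * phi v = t * phi u by rewrite -pu uJ -(scaleNr y v) pE mulNr.
have E2 : y * phi u + x * phi v = t * phi v by rewrite -pv vJ pE.
have [q0|q0] := eqVneq ((x - t) ^+ 2 + y ^+ 2) 0; [right|left].
  have := sqr_ge0 (x - t); have := sqr_ge0 y => h1 h2.
  have /eqP : (x - t) ^+ 2 = 0 by lra.
  have /eqP : y ^+ 2 = 0 by lra.
  by rewrite !sqrf_eq0 subr_eq0 => /eqP -> /eqP ->.
have F1 : ((x - t) ^+ 2 + y ^+ 2) * phi u = 0.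
  have -> : ((x - t) ^+ 2 + y ^+ 2) * phi u = (x - t) * (x * phi u - y * phi v - t * phi u)
    + y * (y * phi u + x * phi v - t * phi v) by ring.
  by rewrite E1 E2 !subrr !mulr0 addr0.
have F2 : ((x - t) ^+ 2 + y ^+ 2) * phi v = 0.
  have -> : ((x - t) ^+ 2 + y ^+ 2) * phi v = (x - t) * (y * phi u + x * phi v - t * phi v)
    - y * (x * phi u - y * phi v - t * phi u) by ring.
  by rewrite E1 E2 !subrr !mulr0 subr0.
by move/eqP: F1; move/eqP: F2; rewrite !mulf_eq0 (negPf q0)/= => /eqP -> /eqP ->.
Qed.

(** The momentum block: its eigenvalues solve z^2 - (1 - h + g) z + g = 0, so
    non-real ones have squared modulus g, and real ones lie between g and
    1 - h. *)
Lemma eigen_momentum n (J : 'M[R]_n) (x y h g B : R) (phi psi : 'rV[R]_n -> R)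
    (u v : 'rV[R]_n) :
  0 < h <= 1 -> 0 < g -> 0 <= B <= 1 -> g <= B ^+ 2 -> 1 - h <= B ->
  scalar phi -> scalar psi -> u *m J = x *: u - y *: v -> v *m J = y *: u + x *: v ->
  (forall w, phi (w *m J) = (1 - h) * phi w + g * psi w) ->
  (forall w, psi (w *m J) = - h * phi w + g * psi w) ->
  [/\ phi u = 0, phi v = 0, psi u = 0 & psi v = 0] \/ x ^+ 2 + y ^+ 2 <= B ^+ 2.
Proof.
move=> /andP[h0 h1] g0 /andP[B0 B1] gB hB plin slin uJ vJ pJ sJ.
have lin (F : 'rV[R]_n -> R) a b : scalar F -> F (a *: u + b *: v) = a * F u + b * F v.
  move=> Flin; have F0 : F 0 = 0.
    by have := Flin (-1) 0 0; rewrite scaler0 addr0 => ->; rewrite mulN1r addNr.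
  by rewrite Flin; have := Flin b v 0; rewrite !addr0 F0 addr0 => ->.
have A1 : x * phi u - y * phi v = (1 - h) * phi u + g * psi u.
  by rewrite -pJ uJ -(scaleNr y v) lin// mulNr.
have A2 : y * phi u + x * phi v = (1 - h) * phi v + g * psi v by rewrite -pJ vJ lin.
have B1' : x * psi u - y * psi v = - h * phi u + g * psi u.
  by rewrite -sJ uJ -(scaleNr y v) lin// mulNr.
have B2' : y * psi u + x * psi v = - h * phi v + g * psi v by rewrite -sJ vJ lin.
pose p1 := x ^+ 2 - y ^+ 2 - (1 - h + g) * x + g; pose p2 := y * (2 * x - (1 - h + g)).
have [/andP[/eqP P1 /eqP P2]|P] := boolP ((p1 == 0) && (p2 == 0)); [right|left].
  move: P2 => /eqP; rewrite mulf_eq0 => /orP[/eqP y0|/eqP xT].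
    have xq : (x - (1 - h)) * (x - g) = - (g * h).
      by move: P1; rewrite /p1 y0; nra.
    have gh : 0 < g * h by rewrite mulr_gt0.
    have gB' : g <= B by nra.
    have [x0|x0] := ltP x 0; first by nra.
    have [xB|xB] := ltP B x; first by nra.
    by rewrite y0 expr0n addr0 lerXn2r.
  by move: P1; rewrite /p1; nra.
have q0 : 0 < p1 ^+ 2 + p2 ^+ 2.
  rewrite lt0r addr_ge0 ?sqr_ge0// andbT paddr_eq0 ?sqr_ge0// !sqrf_eq0.
  exact: P.
have key (Y Z : R) : p1 * Y - p2 * Z = 0 -> p2 * Y + p1 * Z = 0 -> Y = 0 /\ Z = 0.
  move=> C1 C2.
  have F1 : (p1 ^+ 2 + p2 ^+ 2) * Y = 0.
    have -> : (p1 ^+ 2 + p2 ^+ 2) * Y = p1 * (p1 * Y - p2 * Z) + p2 * (p2 * Y + p1 * Z) by ring.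
    by rewrite C1 C2 !mulr0 addr0.
  have F2 : (p1 ^+ 2 + p2 ^+ 2) * Z = 0.
    have -> : (p1 ^+ 2 + p2 ^+ 2) * Z = p1 * (p2 * Y + p1 * Z) - p2 * (p1 * Y - p2 * Z) by ring.
    by rewrite C1 C2 !mulr0 subr0.
  by move/eqP: F1; move/eqP: F2; rewrite !mulf_eq0 (gt_eqF q0)/= => /eqP -> /eqP ->.
have [-> ->] : phi u = 0 /\ phi v = 0.
  apply: key.
    transitivity ((x - g) * (x * phi u - y * phi v - ((1 - h) * phi u + g * psi u))
      - y * (y * phi u + x * phi v - ((1 - h) * phi v + g * psi v))
      + g * (x * psi u - y * psi v - (- h * phi u + g * psi u))); first by rewrite /p1 /p2; ring.
    by rewrite A1 A2 B1' !subrr; ring.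
  transitivity (y * (x * phi u - y * phi v - ((1 - h) * phi u + g * psi u))
      + (x - g) * (y * phi u + x * phi v - ((1 - h) * phi v + g * psi v))
      + g * (y * psi u + x * psi v - (- h * phi v + g * psi v))); first by rewrite /p1 /p2; ring.
  by rewrite A1 A2 B2' !subrr; ring.
have [-> ->] : psi u = 0 /\ psi v = 0; last by [].
apply: key.
  transitivity ((x - (1 - h)) * (x * psi u - y * psi v - (- h * phi u + g * psi u))
    - y * (y * psi u + x * psi v - (- h * phi v + g * psi v))
    - h * (x * phi u - y * phi v - ((1 - h) * phi u + g * psi u))); first by rewrite /p1 /p2; ring.
  by rewrite A1 B1' B2' !subrr; ring.
transitivity (y * (x * psi u - y * psi v - (- h * phi u + g * psi u))
    + (x - (1 - h)) * (y * psi u + x * psi v - (- h * phi v + g * psi v))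
    - h * (y * phi u + x * phi v - ((1 - h) * phi v + g * psi v))); first by rewrite /p1 /p2; ring.
by rewrite A2 B1' B2' !subrr; ring.
Qed.

Lemma affine_recurrence_cvg0 (a b : nat -> R) (t : R) : 0 <= t < 1 ->
  (forall n, a n.+1 = t * a n + b n) -> b n @[n --> \oo] --> 0 ->
  a n @[n --> \oo] --> 0.
Proof.
move=> /andP[t0 t1] aE b0; apply/cvgr0Pnorm_le => e e0.
have e1 : 0 < (1 - t) * (e / 2) by rewrite mulr_gt0 ?divr_gt0 ?subr_gt0.
have [N _ HN] := (cvgr0Pnorm_le b).1 b0 _ e1.
have aN n : `|a (n + N)%N| <= t ^+ n * `|a N| + e / 2.
  elim: n => [|n IH]; first by rewrite add0n expr0 mul1r lerDl divr_ge0// ltW.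
  rewrite addSn aE (le_trans (ler_normD _ _))// normrM (ger0_norm t0).
  have := HN (n + N)%N (leq_addl _ _) => /= bn.
  have : t * `|a (n + N)%N| <= t * (t ^+ n * `|a N| + e / 2) by rewrite ler_wpM2l.
  by rewrite exprS; lra.
have t_cvg : t ^+ n * `|a N| @[n --> \oo] --> 0.
  rewrite -[X in _ --> X](mul0r `|a N|); apply: cvgMr_tmp; apply: cvg_expr.
  by rewrite ger0_norm.
have e2 : 0 < e / 2 by rewrite divr_gt0.
have [M _ HM] := (cvgr0Pnorm_le _).1 t_cvg _ e2.
exists (M + N)%N => // n /= MNn.
have -> : n = ((n - N) + N)%N by rewrite subnK// (leq_trans _ MNn)// leq_addl.
apply: le_trans (aN _) _.
have Mn : (M <= n - N)%N by rewrite leq_subRL ?(leq_trans _ MNn) ?leq_addl// addnC.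
have H := HM (n - N)%N Mn; rewrite /= in H; have := ler_norm (t ^+ (n - N) * `|a N|); lra.
Qed.

End Spectrum.

Lemma cvg_sum0 (R : realType) (W : normedModType R) (I : Type) (r : seq I) (F : I -> nat -> W) :
  (forall i, F i k @[k --> \oo] --> (0 : W)) -> \sum_(i <- r) F i k @[k --> \oo] --> (0 : W).
Proof.
move=> F0; elim: r => [|i r IH].
  by under eq_fun do rewrite big_nil; exact: cvg_cst.
under eq_fun do rewrite big_cons.
by have := cvgD (F0 i) IH; rewrite addr0; apply.
Qed.

Section LinearStep.
Context {R : realType} {N n : nat}.
Variable J : 'M[R]_N.
Variables (y z : 'I_n -> 'rV[R]_N -> R) (s : 'I_n -> 'I_n -> 'rV[R]_N -> R).
Hypothesis y_lin : forall i, scalar (y i).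
Hypothesis z_lin : forall i, scalar (z i).
Hypothesis s_lin : forall i j, scalar (s i j).
Variables (h : 'I_n -> R) (t : 'I_n -> 'I_n -> R) (B : R).
Hypothesis B_bound : 0 <= B < 1.
Hypothesis h_bound : forall i, 0 < h i <= 1.
Hypothesis h_B : forall i, 1 - h i <= B.
Hypothesis t_bound : forall i j, 0 <= t i j <= B.

(** Off the diagonal blocks nothing is assumed: an eigenvector is read by the
    first block on which it does not vanish. *)
Lemma momentum_spectral_radius (g : R) : 0 < g -> g <= B ^+ 2 ->
  (forall u, (forall i, y i u = 0) -> (forall i, z i u = 0) -> (forall i j, s i j u = 0) -> u = 0) ->
  (forall i u, y i (u *m J) = (1 - h i) * y i u + g * z i u) ->
  (forall i u, z i (u *m J) = - h i * y i u + g * z i u) ->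
  (forall i j u, (forall i, y i u = 0) -> (forall i, z i u = 0) ->
     s i j (u *m J) = t i j * s i j u) ->
  spectral_radius J < 1.
Proof.
move=> g0 gB sep yJ zJ sJ; apply: (spectral_radius_lt1 B_bound) => l.
have [B0 B1] := andP B_bound.
move=> /eigenvalue_pair[u [v [uv uJ vJ]]].
set x := complex.Re l in uJ vJ *; set w := complex.Im l in uJ vJ *.
have [//|lB] := boolP (x ^+ 2 + w ^+ 2 <= B ^+ 2); case: uv.
have YZ i : [/\ y i u = 0, y i v = 0, z i u = 0 & z i v = 0].
  have B1' : 0 <= B <= 1 by rewrite B0 ltW.
  have [//|] := eigen_momentum (h_bound i) g0 B1' gB (h_B i) (y_lin i) (z_lin i) uJ vJ (yJ i) (zJ i).
  by rewrite (negPf lB).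
have yu i : y i u = 0 by case: (YZ i). have yv i : y i v = 0 by case: (YZ i).
have zu i : z i u = 0 by case: (YZ i). have zv i : z i v = 0 by case: (YZ i).
have S i j : s i j u = 0 /\ s i j v = 0.
  have [//|[xt w0]] := eigen_functional (s_lin i j) uJ vJ (sJ i j u yu zu) (sJ i j v yv zv).
  case/negP: lB; rewrite xt w0 expr0n addr0; have /andP[t0 tB] := t_bound i j.
  by rewrite lerXn2r.
by split; apply: sep => // i j; case: (S i j).
Qed.

Hypothesis yJ : forall i u, y i (u *m J) = (1 - h i) * y i u.
Hypothesis sJ : forall i j u, (forall i, y i u = 0) -> s i j (u *m J) = t i j * s i j u.

Lemma csd_spectral_radius :
  (forall u, (forall i, y i u = 0) -> (forall i j, s i j u = 0) -> u = 0) ->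
  spectral_radius J < 1.
Proof.
move=> sep; apply: (spectral_radius_lt1 B_bound) => l.
have [B0 B1] := andP B_bound.
move=> /eigenvalue_pair[u [v [uv uJ vJ]]].
set x := complex.Re l in uJ vJ *; set w := complex.Im l in uJ vJ *.
have [//|lB] := boolP (x ^+ 2 + w ^+ 2 <= B ^+ 2); case: uv.
have Y i : y i u = 0 /\ y i v = 0.
  have [//|[xt w0]] := eigen_functional (y_lin i) uJ vJ (yJ i u) (yJ i v).
  case/negP: lB; rewrite xt w0 expr0n addr0; have /andP[h0 h1] := h_bound i.
  by rewrite lerXn2r// nnegrE subr_ge0.
have yu i : y i u = 0 by case: (Y i). have yv i : y i v = 0 by case: (Y i).
have S i j : s i j u = 0 /\ s i j v = 0.
  have [//|[xt w0]] := eigen_functional (s_lin i j) uJ vJ (sJ i j yu) (sJ i j yv).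
  case/negP: lB; rewrite xt w0 expr0n addr0; have /andP[t0 tB] := t_bound i j.
  by rewrite lerXn2r.
by split; apply: sep => // i j; case: (S i j).
Qed.

(** The y-components decay geometrically and force the s-components through
    the coupling, which thus solve contracting recurrences with vanishing
    inhomogeneity. *)
Lemma csd_iterates_cvg0 (e : 'I_n -> 'rV[R]_N) (e2 : 'I_n -> 'I_n -> 'rV[R]_N) :
  (forall u, u = \sum_i y i u *: e i + \sum_i \sum_j s i j u *: e2 i j) ->
  (forall l i j, y l (e2 i j) = 0) ->
  forall u, iter k (fun v => v *m J) u @[k --> \oo] --> (0 : 'rV[R]_N).
Proof.
move=> recon ye2 u; pose U k := iter k (fun v => v *m J) u.
have US k : U k.+1 = U k *m J by [].
have lin (F : 'rV[R]_N -> R) : scalar F -> F 0 = 0 /\ forall I (r : seq I) (G : I -> R) v,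
    F (\sum_(i <- r) G i *: v i) = \sum_(i <- r) G i * F (v i).
  move=> Flin; have F0 : F 0 = 0.
    by have := Flin (-1) 0 0; rewrite scaler0 addr0 => ->; rewrite mulN1r addNr.
  split=> // I r G v; elim: r => [|i r IH]; first by rewrite !big_nil.
  by rewrite !big_cons Flin IH.
have FD F v w : scalar F -> F (v + w) = F v + F w.
  by move=> /(_ 1 v w); rewrite scale1r mul1r.
have y_cvg i : y i (U k) @[k --> \oo] --> 0.
  have yU k : y i (U k) = (1 - h i) ^+ k * y i u.
    elim: k => [|k IH]; first by rewrite expr0 mul1r.
    by rewrite US yJ IH exprS mulrA.
  have -> : (fun k => y i (U k)) = (fun k => (1 - h i) ^+ k * y i u) by apply/funext.
  rewrite -[X in _ --> X](mul0r (y i u)); apply: cvgMr_tmp; apply: cvg_expr.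
  by have /andP[h0 h1] := h_bound i; rewrite ger0_norm; lra.
pose b i j v := \sum_l y l v * (s i j (e l *m J) - t i j * s i j (e l)).
have sU i j v : s i j (v *m J) = t i j * s i j v + b i j v.
  have [_ sS] := lin _ (s_lin i j).
  pose v2 := \sum_i \sum_j s i j v *: e2 i j.
  have yv2 l : y l v2 = 0.
    have [y0 yS] := lin _ (y_lin l).
    rewrite /v2 (eq_bigr (fun i => 1 *: \sum_j s i j v *: e2 i j)) => [|? _]; last by rewrite scale1r.
    rewrite yS big1// => i' _; rewrite yS mul1r big1// => j' _.
    by rewrite ye2 mulr0.
  have E1 : v = \sum_l y l v *: e l + v2 by exact: recon.
  have E2 : v *m J = \sum_l y l v *: (e l *m J) + v2 *m J.
    rewrite {1}E1 mulmxDl mulmx_suml; congr (_ + _).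
    by apply: eq_bigr => l _; rewrite scalemxAl.
  have bE : b i j v = \sum_l y l v * s i j (e l *m J) - t i j * \sum_l y l v * s i j (e l).
    by rewrite mulr_sumr -sumrB; apply: eq_bigr => l _; ring.
  have F1 : s i j v = \sum_l y l v * s i j (e l) + s i j v2 by rewrite -sS -FD// -E1.
  have F2 : s i j (v *m J) = \sum_l y l v * s i j (e l *m J) + t i j * s i j v2.
    by rewrite -(sJ i j yv2) -sS -FD// -E2.
  by rewrite F2 F1 bE; ring.
have s_cvg i j : s i j (U k) @[k --> \oo] --> 0.
  have [t0 tB] := andP (t_bound i j); have [B0 B1] := andP B_bound.
  apply: (@affine_recurrence_cvg0 _ _ (fun k => b i j (U k)) (t i j)).
  - by rewrite t0 (le_lt_trans tB).
  - by move=> k; rewrite US sU.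
  apply: cvg_sum0 => l.
  rewrite -[X in _ --> X](mul0r (s i j (e l *m J) - t i j * s i j (e l))).
  by apply: cvgMr_tmp; exact: y_cvg.
have UE : (fun k => U k) =
    (fun k => \sum_i y i (U k) *: e i + \sum_i \sum_j s i j (U k) *: e2 i j).
  by apply/funext => k; exact: recon.
rewrite -[fun k => iter _ _ _]/(fun k => U k) UE -[X in _ --> X](addr0 (0 : 'rV[R]_N)).
apply: cvgD.
  apply: cvg_sum0 => i; rewrite -[X in _ --> X](scale0r (e i)).
  by apply: cvgZr_tmp; exact: y_cvg.
apply: cvg_sum0 => i; apply: cvg_sum0 => j; rewrite -[X in _ --> X](scale0r (e2 i j)).
by apply: cvgZr_tmp; exact: s_cvg.
Qed.

End LinearStep.

(** * Coordinates in a basis *)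

Section BasisCoordinates.
Context {R : realType} {W : vectType R}.
Variable E : {vspace W}.

Lemma basis_coord_linear : linear (basis_coord E).
Proof. by move=> a u v; apply/rowP => i; rewrite !mxE linearP. Qed.

Lemma basis_point_linear : linear (@basis_point R W E).
Proof.
move=> a u v; rewrite /basis_point scaler_sumr -big_split; apply: eq_bigr => i _.
by rewrite !mxE scalerDl scalerA.
Qed.

Lemma basis_point_in u : @basis_point R W E u \in E.
Proof. by apply: memv_suml => i _; apply: memvZ; rewrite vbasis_mem// mem_nth// size_tuple. Qed.

Lemma basis_coordK w : w \in E -> basis_point (basis_coord E w) = w.
Proof.
move=> wE; rewrite [RHS](coord_vbasis wE); apply: eq_bigr => i _.
by rewrite mxE.
Qed.

Lemma basis_pointK u : basis_coord E (basis_point u) = u.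
Proof.
apply/rowP => i; rewrite mxE /basis_point.
by rewrite coord_sum_free// (basis_free (vbasisP E)).
Qed.

End BasisCoordinates.

Lemma linear_is_diff (R : realType) (V : normedModType R) (p : V) m n N
    (F : 'M[R]_(m, n) -> 'rV[R]_N) (T dT : V -> 'M[R]_(m, n)) :
  linear F -> is_diff p T dT -> is_diff p (fun u => F (T u)) (fun u => F (dT u)).
Proof.
move=> Flin Td.
have FE M l : F M 0 l = \sum_i \sum_j M i j * F (delta_mx i j) 0 l.
  pose D : {linear 'M[R]_(m, n) -> 'rV[R]_N} :=
    HB.pack F (GRing.isLinear.Build R 'M[R]_(m, n) 'rV[R]_N *:%R F Flin).
  rewrite -[F M]/(D M) {1}[M]matrix_sum_delta linear_sum summxE; apply: eq_bigr => i _.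
  rewrite linear_sum summxE; apply: eq_bigr => j _.
  by rewrite linearZ mxE.
apply: is_diff_mxP => o l; rewrite (ord1 o).
under [X in is_diff _ X _]eq_fun do rewrite FE.
under [X in is_diff _ _ X]eq_fun do rewrite FE.
apply: is_diff_sum => i; apply: is_diff_sum => j.
have := is_diffM (is_diff_entry i j Td) (is_diff_cst (F (delta_mx i j) 0 l) p).
move=> H; apply: is_diff_eq H _; apply/funext => v /=.
rewrite -[LHS]/(T p i j * 0 + F (delta_mx i j) 0 l * dT v i j).
by rewrite mulr0 add0r mulrC.
Qed.

(** * The linearised step in an eigenframe *)

Section FrameCoordinates.
Context {R : realType} {n d : nat}.
Variables (k : nat) (V : 'M[R]_(n, d)) (P H Rs : 'M[R]_d) (s : 'rV[R]_n) (mu L dt : R).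
Local Notation sg := (@reflection_signs R n k).
Hypothesis VV : V *m V^T = 1%:M.
Hypothesis VTV : V^T *m V = P.
Hypothesis HE : H = V^T *m diag_mx s *m V.
Hypothesis RsE : Rs = V^T *m diag_mx sg *m V.
Hypothesis mu_gt0 : 0 < mu.
Hypothesis s_bound : forall i, mu <= sg 0 i * s 0 i <= L.
Hypothesis dt_gt0 : 0 < dt.
Hypothesis dt_lt : dt < 1 / (2 * L).

(** The eigenvalues of dt |H| and the factors of the matrix block of the
    linearised step. *)
Definition rate i : R := dt * (sg 0 i * s 0 i).
Definition coupling i j : R := (1 - sg 0 i * sg 0 j) / 2 * (1 - rate i - rate j).

Lemma rate_bound i : dt * mu <= rate i < 1 / 2.
Proof.
have /andP[a b] := s_bound i; rewrite /rate; have := mu_gt0; have := dt_gt0.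
have := dt_lt => t1 t0 m0.
have L0 : 0 < L by lra.
have tL : dt * L < 1 / 2 by move: t1; rewrite ltr_pdivlMr; lra.
by apply/andP; split; nra.
Qed.

Lemma reflection_signs_cases i : sg 0 i = 1 \/ sg 0 i = -1.
Proof. by rewrite mxE; case: ltnP; [right|left]. Qed.

Lemma coupling_bound i j : 0 <= coupling i j <= 1 - dt * mu.
Proof.
have /andP[ri1 ri2] := rate_bound i; have /andP[rj1 rj2] := rate_bound j.
have tm : 0 < dt * mu by rewrite mulr_gt0.
rewrite /coupling; case: (reflection_signs_cases i) => ->;
  case: (reflection_signs_cases j) => ->; apply/andP; split; lra.
Qed.

Let conjM (D E : 'M[R]_n) :
  (V^T *m D *m V) *m (V^T *m E *m V) = V^T *m (D *m E) *m V.
Proof. by rewrite !mulmxA -[_ *m V *m V^T]mulmxA VV mulmx1. Qed.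

Let HRs : H *m Rs = V^T *m diag_mx (\row_i (sg 0 i * s 0 i)) *m V.
Proof.
rewrite HE RsE conjM mulmx_diag.
by congr (_ *m diag_mx _ *m _); apply/rowP => i; rewrite !mxE mulrC.
Qed.

Lemma frame_reflection_comm : Rs *m H = H *m Rs.
Proof.
rewrite HRs HE RsE conjM mulmx_diag.
by congr (_ *m diag_mx _ *m _); apply/rowP => i; rewrite !mxE.
Qed.

Lemma frame_reflection_sym : Rs^T = Rs.
Proof. by rewrite RsE !trmx_mul trmxK tr_diag_mx mulmxA. Qed.

Lemma frame_reflection_invol : Rs *m Rs = P.
Proof.
rewrite {1 2}RsE conjM mulmx_diag -VTV.
rewrite (_ : \row_i _ = const_mx 1) ?diag_const_mx ?mulmx1//.
apply/rowP => i; rewrite [LHS]mxE [RHS]mxE.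
by case: (reflection_signs_cases i) => ->; rewrite ?mulrNN mulr1.
Qed.

Lemma frame_reflection_proj : Rs *m P = Rs.
Proof. by rewrite RsE -VTV -!mulmxA [V *m (V^T *m V)]mulmxA VV mul1mx. Qed.

Lemma frame_reflection_trace : (k <= n)%N -> \tr Rs = n%:R - 2 * k%:R.
Proof.
move=> kn; rewrite RsE mxtrace_mulC mulmxA VV mul1mx mxtrace_diag.
rewrite (eq_bigr (fun i : 'I_n => 1 - 2 * (i < k)%:R)); last first.
  by move=> i _; rewrite mxE; case: ltnP => _; rewrite ?mulr1 ?mulr0 ?subr0//; lra.
rewrite sumrB sumr_const card_ord -mulr_sumr; congr (_ - _ * _).
rewrite -[in RHS](card_ord_lt kn) -sum1dep_card natr_sum [RHS]big_mkcond/=.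
by apply: eq_bigr => i _; case: ltnP.
Qed.

Definition tcoord i (u : 'rV[R]_d) : R := (u *m V^T) 0 i.
Definition ocoord i j (A : 'M[R]_d) : R := (V *m A *m V^T) i j.

Lemma tcoord_linear i : scalar (tcoord i).
Proof. by move=> a u v; rewrite /tcoord mulmxDl -scalemxAl !mxE. Qed.

Lemma ocoord_linear i j : scalar (ocoord i j).
Proof. by move=> a A B; rewrite /ocoord mulmxDr mulmxDl -scalemxAr -scalemxAl !mxE. Qed.

Lemma tcoord_expand u : u *m P = u -> u = \sum_i tcoord i u *: row i V.
Proof.
move=> uP; rewrite -{1}uP -VTV mulmxA; apply/rowP => j.
rewrite mxE summxE; apply: eq_bigr => i _.
by rewrite [RHS]mxE [row i V 0 j]mxE.
Qed.

Let sym_proj A : A^T = A -> A *m P = A -> P *m A = A.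
Proof.
move=> AT AP; have PT : P^T = P by rewrite -VTV trmx_mul trmxK.
by rewrite -{1}AT -PT -trmx_mul AP AT.
Qed.

Lemma ocoord_expand A : A^T = A -> A *m P = A ->
  A = \sum_i \sum_j ocoord i j A *: ((row i V)^T *m row j V).
Proof.
move=> AT AP.
have PA : P *m A = A by exact: sym_proj.
have E : A = V^T *m ((V *m A *m V^T) *m V) by rewrite !mulmxA VTV PA -mulmxA VTV AP.
rewrite {1}E; apply/matrixP => a b; rewrite mxE summxE; apply: eq_bigr => i _.
rewrite [(V *m A *m V^T *m V) i b]mxE summxE mulr_sumr; apply: eq_bigr => j _.
rewrite [RHS]mxE [(_ *m row j V) a b]mxE big_ord1 /ocoord.
by rewrite [row j V 0 b]mxE [(row i V)^T a 0]mxE [row i V 0 a]mxE [V^T a i]mxE; ring.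
Qed.

(** Symmetrised, so that it lies in the space of coordinates. *)
Definition frame_sym i j : 'M[R]_d :=
  2^-1 *: ((row i V)^T *m row j V + (row j V)^T *m row i V).

Lemma frame_symT i j : (frame_sym i j)^T = frame_sym i j.
Proof. by rewrite /frame_sym linearZ/= linearD/= !trmx_mul !trmxK addrC. Qed.

Lemma ocoord_expand_sym A : A^T = A -> A *m P = A ->
  A = \sum_i \sum_j ocoord i j A *: frame_sym i j.
Proof.
move=> AT AP; have AE := ocoord_expand AT AP; set F := BIG_F in AE.
have AE' : A = \sum_i \sum_j ocoord i j A *: ((row j V)^T *m row i V).
  rewrite -{1}AT {1}AE linear_sum; apply: eq_bigr => i _; rewrite linear_sum.
  by apply: eq_bigr => j _; rewrite linearZ/= trmx_mul trmxK.
have -> : \sum_i \sum_j ocoord i j A *: frame_sym i j =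
   2^-1 *: (\sum_i \sum_j ocoord i j A *: ((row i V)^T *m row j V) +
            \sum_i \sum_j ocoord i j A *: ((row j V)^T *m row i V)).
  rewrite -big_split scaler_sumr; apply: eq_bigr => i _ /=.
  rewrite -big_split scaler_sumr; apply: eq_bigr => j _ /=.
  by rewrite -scalerDr scalerA mulrC -scalerA.
rewrite -AE -AE'; apply/matrixP => a b; rewrite !mxE; lra.
Qed.

Let tcoord_HRs u i : tcoord i (u *m H *m Rs) = sg 0 i * s 0 i * tcoord i u.
Proof.
rewrite /tcoord -[u *m H *m Rs]mulmxA HRs !mulmxA -[_ *m V *m V^T]mulmxA VV mulmx1.
by rewrite mul_mx_diag mxE [(\row_i _) 0 i]mxE mulrC.
Qed.

Lemma tcoord_momentum u v (g : R) i :
  tcoord i (- dt *: (u *m H *m Rs) + g *: v) = - rate i * tcoord i u + g * tcoord i v.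
Proof.
have Z w (a : R) : tcoord i (a *: w) = a * tcoord i w by rewrite /tcoord -scalemxAl mxE.
by rewrite tcoord_linear Z tcoord_HRs /rate; ring.
Qed.

Lemma tcoord_step u v (g : R) i :
  tcoord i (u + (- dt *: (u *m H *m Rs) + g *: v)) =
    (1 - rate i) * tcoord i u + g * tcoord i v.
Proof.
have := tcoord_linear i 1 u (- dt *: (u *m H *m Rs) + g *: v).
by rewrite scale1r mul1r tcoord_momentum => ->; ring.
Qed.

(** Orthogonalisation keeps of a perturbation X the part that anticommutes with
    Rs, whose entries pair eigenvectors of opposite signs; on these the step in
    R contracts by 1 - h_i - h_j. *)
Lemma ocoord_step A i j : A^T = A -> A *m P = A ->
  let X := A - dt *: (A *m H *m Rs + Rs *m H *m A) in
  ocoord i j (2^-1 *: (X - Rs *m X *m Rs)) = coupling i j * ocoord i j A.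
Proof.
move=> AT AP X.
have PA : P *m A = A by exact: sym_proj.
pose D := diag_mx (\row_i (sg 0 i * s 0 i)) : 'M[R]_n.
pose M := V *m A *m V^T.
have XE : V *m X *m V^T = M - dt *: (M *m D + D *m M).
  have -> : X = A - dt *: (A *m (H *m Rs) + H *m Rs *m A).
    by rewrite /X frame_reflection_comm mulmxA.
  have E1 : V *m (A *m (H *m Rs)) *m V^T = M *m D.
    by rewrite HRs /M !mulmxA -[_ *m V *m V^T]mulmxA VV mulmx1.
  have E2 : V *m (H *m Rs *m A) *m V^T = D *m M.
    by rewrite HRs /M !mulmxA VV mul1mx.
  by rewrite mulmxBr mulmxBl -scalemxAr -scalemxAl mulmxDr mulmxDl E1 E2.
have VRs : V *m Rs = diag_mx sg *m V by rewrite RsE !mulmxA VV mul1mx.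
have RsV : Rs *m V^T = V^T *m diag_mx sg by rewrite RsE -!mulmxA VV mulmx1.
have E : V *m (2^-1 *: (X - Rs *m X *m Rs)) *m V^T =
   2^-1 *: (V *m X *m V^T - diag_mx sg *m (V *m X *m V^T) *m diag_mx sg).
  rewrite -scalemxAr -scalemxAl mulmxBr mulmxBl; congr (_ *: (_ - _)).
  by rewrite !mulmxA VRs -[_ *m Rs *m _]mulmxA RsV !mulmxA.
have dr (N : 'M[R]_n) w a b : (N *m diag_mx w) a b = N a b * w 0 b.
  by rewrite mul_mx_diag mxE.
have dl (N : 'M[R]_n) w a b : (diag_mx w *m N) a b = w 0 a * N a b.
  by rewrite mul_diag_mx mxE.
have ZE (a : R) (N : 'M[R]_n) : (a *: N) i j = a * N i j by rewrite mxE.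
have BE (N1 N2 : 'M[R]_n) : (N1 - N2) i j = N1 i j - N2 i j by rewrite !mxE.
have DE (N1 N2 : 'M[R]_n) : (N1 + N2) i j = N1 i j + N2 i j by rewrite mxE.
rewrite /ocoord E XE -/M /coupling /rate ZE BE dr dl !BE ZE DE dr dl.
rewrite ![(\row_a (sg 0 a * s 0 a)) 0 _]mxE.
by field.
Qed.

End FrameCoordinates.

(** * The spaces of coordinates *)

Section CoordinateSpaces.
Context {R : realType} {d m : nat}.
Variables (c : 'I_m -> 'rV[R]_d -> R) (x : 'rV[R]_d).
Local Notation C := (cgrad c x).

Lemma mem_lker_linfun (U W : vectType R) (F : U -> W) z : linear F ->
  (z \in lker (linfun F)) = (F z == 0).
Proof.
move=> Flin; pose D : {linear U -> W} := HB.pack F (GRing.isLinear.Build R U W *:%R F Flin).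
by rewrite memv_ker -[linfun F]/(linfun D) lfunE.
Qed.

Lemma mem_csd_space z : (z \in csd_space c x) <->
  [/\ tangent c x z.1, z.2 *m C^T = 0 & z.2^T = z.2].
Proof.
rewrite /csd_space mem_lker_linfun; last first.
  move=> a u v; rewrite /= !mulmxDl -!scalemxAl; congr (_, _, _).
  by apply/matrixP => i j; rewrite !mxE; ring.
split=> [/eqP[E1 E2 /eqP]|[E1 E2 E3]].
  by rewrite subr_eq0 => /eqP E3; split.
by apply/eqP; congr (_, _, _); rewrite ?E3 ?subrr.
Qed.

Lemma mem_mcsd_space z : (z \in mcsd_space c x) <->
  [/\ tangent c x z.1.1, tangent c x z.1.2, z.2 *m C^T = 0 & z.2^T = z.2].
Proof.
rewrite /mcsd_space mem_lker_linfun; last first.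
  move=> a u v; rewrite /= !mulmxDl -!scalemxAl; congr (_, _, _, _).
  by apply/matrixP => i j; rewrite !mxE; ring.
split=> [/eqP[E1 E2 E3 /eqP]|[E1 E2 E3 E4]].
  by rewrite subr_eq0 => /eqP E4; split.
by apply/eqP; congr (_, _, _, _); rewrite ?E4 ?subrr.
Qed.

End CoordinateSpaces.

Lemma linear_comb (R : pzRingType) (U W : lmodType R) (F : U -> W) : linear F ->
  forall I (r : seq I) (a : I -> R) (v : I -> U),
  F (\sum_(i <- r) a i *: v i) = \sum_(i <- r) a i *: F (v i).
Proof.
move=> Flin I r a v; have F0 : F 0 = 0.
  by have := Flin (-1) 0 0; rewrite scaler0 addr0 => ->; rewrite scaleN1r addNr.
elim: r => [|i r IH]; first by rewrite !big_nil.
by rewrite !big_cons Flin IH.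
Qed.

(** * Smoothness of the gradient and of the Hessian *)

Section ObjectiveSmooth.
Context {R : realType} {d m : nat}.
Variable c : 'I_m -> 'rV[R]_d -> R.
Hypothesis c_smooth : forall i, smooth (c i).
Variable f : 'rV[R]_d -> R.
Hypothesis f_smooth : smooth f.
Implicit Types (x v : 'rV[R]_d).
Local Notation reg := (regular c).

Lemma mxCk_is_diff (U : set 'rV[R]_d) n p (F : 'rV[R]_d -> 'M[R]_(n, p)) x :
  mxCk U 1 F -> U x -> is_diff x F (fun v => \matrix_(i, j) 'd (fun y => F y i j) x v).
Proof.
move=> FC Ux; apply: is_diff_mxP => i j.
have Fd : differentiable (fun y => F y i j) x by exact: Ck_on_diff (FC i j) Ux.
by apply: (is_diff_eq (differentiableP Fd)); apply/funext => v; rewrite mxE.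
Qed.

Lemma egrad_Ck n : mxCk setT n (egrad f).
Proof.
move=> i j; have [_ /(_ (delta_mx 0 j))] := f_smooth n.+1.
by apply: Ck_on_ext; [exact: openT|] => x _; rewrite mxE.
Qed.

Lemma rgrad_Ck n : mxCk reg n (rgrad c f).
Proof.
apply: (mxCk_mul (open_regular c_smooth)); last exact: tproj_Ck.
by move=> i j; apply: Ck_onS (@egrad_Ck n i j).
Qed.

Lemma jacobian_entry x i j : reg x ->
  'J (rgrad c f) x i j = 'D_(delta_mx 0 i) (fun y => rgrad c f y 0 j) x.
Proof.
move=> xr; have [_ dE] := mxCk_is_diff (@rgrad_Ck 1) xr.
rewrite /jacobian mxE dE mxE deriveE//.
exact: Ck_on_diff (@rgrad_Ck 1 0 j) xr.
Qed.

Lemma jacobian_Ck n : mxCk reg n (fun x => 'J (rgrad c f) x).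
Proof.
move=> i j; have [_ /(_ (delta_mx 0 i))] := @rgrad_Ck n.+1 0 j.
by apply: (Ck_on_ext (open_regular c_smooth)) => x xr; rewrite jacobian_entry.
Qed.

Lemma rhess_Ck n : mxCk reg n (rhess c f).
Proof.
have oU := open_regular c_smooth.
apply: (mxCk_mul oU); last exact: tproj_Ck.
by apply: (mxCk_mul oU); [exact: tproj_Ck|exact: jacobian_Ck].
Qed.

Lemma rgrad_is_diff x : reg x -> is_diff x (rgrad c f) (fun v => v *m 'J (rgrad c f) x).
Proof.
move=> xr; have [dF dE] := mxCk_is_diff (@rgrad_Ck 1) xr.
apply: DiffDef => //; apply/funext => v.
by rewrite -[LHS](mul_rV_lin1 ('d (rgrad c f) x)).
Qed.

(** At a critical point the gradient is tangent to first order, so its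
    derivative along a tangent vector is the Hessian. *)
Lemma rgrad_critical_is_diff x : reg x -> rgrad c f x = 0 ->
  forall v, tangent c x v -> v *m 'J (rgrad c f) x = v *m rhess c f x.
Proof.
move=> xr x0 v vt.
have D1 := rgrad_is_diff xr.
have D2 := is_diff_mulmx D1 (mxCk_is_diff (@tproj_Ck _ _ _ c c_smooth 1) xr).
have D3 : is_diff x (rgrad c f) (fun v => v *m 'J (rgrad c f) x *m tproj c x).
  apply: (is_diff_near _ (is_diff_eq D2 _)).
    have : \forall y \near x, reg y.
      by apply: open_nbhs_nbhs; split=> //; exact: open_regular.
    by apply: filterS => y yr; rewrite /rgrad -mulmxA tproj_idem.
  by apply/funext => u; rewrite x0 mul0mx addr0.
have E : (fun v => v *m 'J (rgrad c f) x) = (fun v => v *m 'J (rgrad c f) x *m tproj c x).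
  by case: D1 => _ <-; case: D3 => _ <-.
by rewrite [LHS](congr1 (fun F => F v) E) /rhess !mulmxA (tangent_tproj vt).
Qed.

End ObjectiveSmooth.

(** * Differential of the scheme in normal coordinates *)

Section Charts.
Context {R : realType} {d m : nat}.
Variable c : 'I_m -> 'rV[R]_d -> R.
Hypothesis c_smooth : forall i, smooth (c i).
Hypothesis c_licq : licq c.
Variable xs : 'rV[R]_d.
Hypothesis xs_mfd : mfd c xs.
Variables rho K : R.
Hypothesis rho_gt0 : 0 < rho.
Hypothesis xs_chart : normal_coordinates c xs rho K.
Local Notation reg := (regular c).
Local Notation P0 := (tproj c xs).

Let xs_reg : reg xs. Proof. exact: mfd_regular. Qed.
Let exp_near := let: And3 H _ _ := xs_chart in H.
Let exp_inv_near := let: And3 _ H _ := xs_chart in H.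
Let ptrans_near := let: And3 _ _ H := xs_chart in H.

Section Along.
Variables (V : normedModType R) (p : V).

Lemma near_small (W : normedModType R) (h : V -> W) dh : is_diff p h dh -> h p = 0 ->
  \forall u \near p, `|h u| <= rho.
Proof.
move=> [hd _] h0; have /cvgrPdist_le/(_ rho rho_gt0) := differentiable_continuous hd.
by apply: filterS => u; rewrite h0 sub0r normrN.
Qed.

Lemma exp_map_is_diff (xi dxi : V -> 'rV[R]_d) : is_diff p xi dxi -> xi p = 0 ->
  (forall u, tangent c xs (xi u)) ->
  [/\ is_diff p (fun u => exp_map c xs (xi u)) dxi, exp_map c xs (xi p) = xs &
     \forall u \near p, mfd c (exp_map c xs (xi u)) /\ `|exp_map c xs (xi u) - xs| <= rho].
Proof.
move=> xid xi0 xit; have near_xi := near_small xid xi0.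
have E0 : exp_map c xs (xi p) = xs.
  have [|_ H] := exp_near (xit p); first by rewrite xi0 normr0 ltW.
  apply/eqP; rewrite -subr_eq0 -normr_le0; move: H.
  by rewrite xi0 normr0 expr0n mulr0 addr0.
have D1 : is_diff p (fun u => exp_map c xs (xi u)) dxi.
  apply: (is_diff_quadratic (G := fun u => xs + xi u) (h := xi) (C := K) _ xid xi0).
    by apply: is_diff_eq (is_diffD (is_diff_cst xs p) xid) _; rewrite add0r.
  by apply: filterS near_xi => u /(exp_near (xit u))[].
split; [exact: D1|exact: E0|].
have D2 : is_diff p (fun u => exp_map c xs (xi u) - xs) dxi.
  by apply: is_diff_eq (is_diffB D1 (is_diff_cst xs p)) _; rewrite subr0.
have := near_small D2; rewrite E0 subrr => /(_ erefl) H.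
near=> u; split; last by near: u.
have [] := @exp_near (xi u) (xit u) _ => //; by near: u.
Unshelve. all: by end_near. Qed.

Lemma exp_inv_is_diff (y : V -> 'rV[R]_d) dy : is_diff p y dy -> y p = xs ->
  (\forall u \near p, mfd c (y u)) ->
  is_diff p (fun u => exp_inv c xs (y u)) dy /\ exp_inv c xs (y p) = 0.
Proof.
move=> yd y0 yM.
have D2 : is_diff p (fun u => y u - xs) dy.
  by apply: is_diff_eq (is_diffB yd (is_diff_cst xs p)) _; rewrite subr0.
have y00 : y p - xs = 0 by rewrite y0 subrr.
have near_y := near_small D2 y00.
split.
  apply: (is_diff_quadratic (h := fun u => y u - xs) (C := K) D2 D2 y00).
  by apply: filterS (filterI yM near_y) => u [uM ur]; exact: exp_inv_near.
have := exp_inv_near (nbhs_singleton yM); rewrite y00 normr0 => /(_ (ltW rho_gt0)).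
by rewrite expr0n mulr0 subr0 normr_le0 => /eqP.
Qed.

Lemma comp_is_diff n q (F : 'rV[R]_d -> 'M[R]_(n, q)) dF (x : V -> 'rV[R]_d) dx :
  is_diff xs F dF -> is_diff p x dx -> x p = xs ->
  is_diff p (fun u => F (x u)) (fun v => dF (dx v)).
Proof.
move=> FD xd x0; apply: (@is_diff_comp _ _ _ _ x dx F dF p xd).
by rewrite x0.
Qed.

Lemma ptransmx_is_diff (x y : V -> 'rV[R]_d) dx dy dP :
  is_diff xs (tproj c) dP -> is_diff p x dx -> is_diff p y dy ->
  x p = xs -> y p = xs ->
  (\forall u \near p, mfd c (x u) /\ `|x u - xs| <= rho) ->
  (\forall u \near p, mfd c (y u) /\ `|y u - xs| <= rho) ->
  is_diff p (fun u => ptransmx c (x u) (y u))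
    (fun v => dP (dx v) *m P0 + P0 *m dP (dy v)) /\
  ptransmx c (x p) (y p) = P0.
Proof.
move=> PD xd yd x0 y0 xM yM; split.
  have D1 := is_diff_mulmx (comp_is_diff PD xd x0) (comp_is_diff PD yd y0).
  rewrite x0 y0 in D1.
  have xy0 : y p - x p = 0 by rewrite x0 y0 subrr.
  apply: (is_diff_quadratic (h := fun u => y u - x u) (C := K) D1 (is_diffB yd xd) xy0).
  by apply: filterS (filterI xM yM) => u [[? ?] [? ?]]; have [] := @ptrans_near (x u) (y u).
have [xpM xpr] := nbhs_singleton xM; have [ypM ypr] := nbhs_singleton yM.
have [_ _ _ + _] := ptrans_near xpM ypM xpr ypr.
rewrite x0 y0 subrr normr0 expr0n mulr0 normr_le0 tproj_idem// subr_eq0.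
by move/eqP.
Qed.

End Along.

(** The retraction is only smooth along the tangent bundle, so its local
    extension g is differentiated instead.  The differential of g at (xs, 0) is
    read on the two curves t |-> (exp (t a), 0) and t |-> (xs, t a) of the
    bundle, and linearity gives it on their sums. *)
Lemma retraction_is_diff (Ret : 'rV[R]_d -> 'rV[R]_d -> 'rV[R]_d)
    (V : normedModType R) (p : V) (x v : V -> 'rV[R]_d) dx dv :
  smooth_retraction c Ret -> is_diff p x dx -> is_diff p v dv -> x p = xs -> v p = 0 ->
  (\forall u \near p, mfd c (x u)) -> (\forall u \near p, tangent c (x u) (v u)) ->
  (forall w, tangent c xs (dx w)) -> (forall w, tangent c xs (dv w)) ->
  is_diff p (fun u => Ret (x u) (v u)) (fun w => dx w + dv w).
Proof.
move=> [_ Ret0 Retd Rets] xd vd x0 v0 xM vt dxt dvt.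
have [U [g [oU U0 gC gE]]] : exists (U : set ('rV[R]_d * 'rV[R]_d)) g,
    [/\ open U, U (xs, 0), forall n, Ck_on n U g &
        forall y, U y -> tangent_bundle c y -> Ret y.1 y.2 = g y].
  by apply: Rets; split=> //=; rewrite /tangent/= mul0mx.
have gd : differentiable g (xs, 0) by have [H _] := gC 1%N; exact: H.
have pairD (W : normedModType R) (q : W) (y w : W -> 'rV[R]_d) dy dw :
    is_diff q y dy -> is_diff q w dw -> y q = xs -> w q = 0 ->
    is_diff q (fun u => g (y u, w u)) (fun u => 'd g (xs, 0) (dy u, dw u)).
  move=> yd wd y0 w0; have D := is_diff_pair yd wd.
  apply: (@is_diff_comp _ _ _ _ (fun u => (y u, w u)) (fun u => (dy u, dw u)) g _ _ D).
  by rewrite y0 w0; exact: differentiableP.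
have near_U (W : normedModType R) (q : W) (y w : W -> 'rV[R]_d) dy dw :
    is_diff q y dy -> is_diff q w dw -> y q = xs -> w q = 0 -> \forall u \near q, U (y u, w u).
  move=> yd wd y0 w0; have [D _] : is_diff q (fun u => (y u, w u)) (fun u => (dy u, dw u)).
    exact: is_diff_pair.
  apply: (differentiable_continuous D).
  have -> : (y q, w q) = (xs, 0) by rewrite y0 w0.
  by apply: open_nbhs_nbhs; split.
have dlin (a : 'rV[R]_d) : is_diff (0 : R) (fun t : R => t *: a) (fun t => t *: a).
  exact: is_diff_scalel.
have dcst : is_diff (0 : R) (fun t : R => 0 : 'rV[R]_d) (fun t => 0) by exact: is_diff_cst.
have d_base a : tangent c xs a -> 'd g (xs, 0) (a, 0) = a.
  move=> at_.
  have ta (t : R) : tangent c xs (t *: a).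
    by rewrite /tangent/= -scalemxAl at_ scaler0.
  have [D1 E1 M1] := exp_map_is_diff (dlin a) (scale0r a) ta.
  have D2 := pairD _ _ _ _ _ _ D1 dcst E1 erefl.
  have D3 : is_diff (0 : R) (fun t : R => exp_map c xs (t *: a)) (fun t => 'd g (xs, 0) (t *: a, 0)).
    apply: is_diff_near D2; have HU := near_U _ _ _ _ _ _ D1 dcst E1 erefl.
    apply: filterS (filterI HU M1) => t [tU [tM _]].
    rewrite -gE//= ?Ret0//; split=> //=; by rewrite /tangent/= mul0mx.
  have E : (fun t : R => 'd g (xs, 0) (t *: a, 0)) = (fun t => t *: a).
    by case: D3 => _ <-; case: D1 => _ <-.
  by have := congr1 (fun F => F 1) E; rewrite /= scale1r.
have d_fibre a : tangent c xs a -> 'd g (xs, 0) (0, a) = a.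
  move=> at_.
  have ta (t : R) : tangent c xs (t *: a).
    by rewrite /tangent/= -scalemxAl at_ scaler0.
  have dxs : is_diff (0 : R) (fun t : R => xs) (fun t => 0) by exact: is_diff_cst.
  have D2 := pairD _ _ _ _ _ _ dxs (dlin a) erefl (scale0r a).
  have D3 : is_diff (0 : R) (fun t : R => Ret xs (t *: a)) (fun t => 'd g (xs, 0) (0, t *: a)).
    apply: is_diff_near D2; have HU := near_U _ _ _ _ _ _ dxs (dlin a) erefl (scale0r a).
    by apply: filterS HU => t tU; rewrite -gE//=; split=> //=; exact: ta.
  have [_ RE] := Retd xs a xs_mfd at_.
  have [D4 D4E] := D3; rewrite deriveE// D4E scale1r in RE; exact: RE.
have D := pairD _ _ _ _ _ _ xd vd x0 v0.
have {}D : is_diff p (fun u => g (x u, v u)) (fun w => dx w + dv w).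
  apply: is_diff_eq D _; apply/funext => w.
  have -> : (dx w, dv w) = (dx w, 0) + (0, dv w) by rewrite /GRing.add/= /add_pair/= addr0 add0r.
  by rewrite linearD/= d_base// d_fibre.
apply: is_diff_near D; have HU := near_U _ _ _ _ _ _ xd vd x0 v0.
near=> u; have uU : U (x u, v u) by near: u.
rewrite -gE//=; split=> /=; by near: u.
Unshelve. all: by end_near. Qed.


Variables (f : 'rV[R]_d -> R) (Ret : 'rV[R]_d -> 'rV[R]_d -> 'rV[R]_d).
Variables (k : nat) (dt gamma : R) (Vf : 'M[R]_(d - m, d)) (Rs : 'M[R]_d).
Hypothesis f_smooth : smooth f.
Hypothesis f_crit : rgrad c f xs = 0.
Hypothesis Ret_retr : smooth_retraction c Ret.
Hypothesis k_le : (k <= d - m)%N.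
Hypothesis Vf_frame : orthonormal_frame c xs Vf.
Hypothesis hess_sym : \forall x \near xs, mfd c x -> (rhess c f x)^T = rhess c f x.
Local Notation H0 := (rhess c f xs).
Local Notation sg := (reflection_signs (d - m) k).
Variables (ev : 'rV[R]_(d - m)) (lmin lmax : R).
Hypothesis lmin_gt0 : 0 < lmin.
Hypothesis ev_bound : forall i, lmin <= sg 0 i * ev 0 i <= lmax.
Hypothesis H0E : H0 = Vf^T *m diag_mx ev *m Vf.
Hypothesis RsE : Rs = Vf^T *m diag_mx sg *m Vf.
Hypothesis dt_gt0 : 0 < dt.
Hypothesis dt_lt : dt < 1 / (2 * lmax).

Let VfVf : Vf *m Vf^T = 1%:M. Proof. by case: Vf_frame. Qed.
Let VfTVf : Vf^T *m Vf = P0. Proof. by case: Vf_frame. Qed.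
Let Rs_sym : Rs^T = Rs. Proof. exact: frame_reflection_sym RsE. Qed.
Let Rs_invol : Rs *m Rs = P0. Proof. exact: frame_reflection_invol VfVf VfTVf RsE. Qed.
Let Rs_tangent : Rs *m P0 = Rs. Proof. exact: frame_reflection_proj VfVf VfTVf RsE. Qed.
Let Rs_tr : \tr Rs = (d - m)%:R - 2 * k%:R.
Proof. exact: frame_reflection_trace VfVf RsE k_le. Qed.
Let Rs_comm : Rs *m H0 = H0 *m Rs. Proof. exact: frame_reflection_comm VfVf H0E RsE. Qed.

Let P0_Rs : P0 *m Rs = Rs.
Proof. by rewrite -{1}Rs_sym -[P0]tproj_tr -trmx_mul Rs_tangent Rs_sym. Qed.

Let tr_le n (N : 'M[R]_n) : `|\tr N| <= n%:R * `|N|.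
Proof.
rewrite (le_trans (ler_norm_sum _ _ _))// mulr_natl.
apply: (le_trans (ler_sum _ (fun i _ => mxnorm_ub N i i))).
by rewrite sumr_const card_ord.
Qed.

Let tproj_rhess x : reg x -> tproj c x *m rhess c f x = rhess c f x.
Proof. by move=> xr; rewrite /rhess !mulmxA tproj_idem. Qed.

Let rhess_tproj x : reg x -> rhess c f x *m tproj c x = rhess c f x.
Proof. by move=> xr; rewrite /rhess -!mulmxA tproj_idem. Qed.

Let riccati_sym (A H : 'M[R]_d) : A^T = A -> H^T = H ->
  (A + dt *: (H - A *m H *m A))^T = A + dt *: (H - A *m H *m A).
Proof. by move=> AT HT; rewrite linearD/= linearZ/= linearB/= !trmx_mul AT HT mulmxA. Qed.

Let riccati_proj (P A H : 'M[R]_d) : P *m A = A -> P *m H = H ->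
  P *m (A + dt *: (H - A *m H *m A)) = A + dt *: (H - A *m H *m A).
Proof. by move=> PA PH; rewrite mulmxDr PA -scalemxAr mulmxBr !mulmxA PA PH. Qed.

Let riccati_diff_proj (P A H D : 'M[R]_d) : P *m D = D -> P *m A = A ->
  P *m (D - dt *: (D *m H *m A + A *m H *m D)) = D - dt *: (D *m H *m A + A *m H *m D).
Proof. by move=> PD PA; rewrite mulmxBr PD -scalemxAr mulmxDr !mulmxA PD PA. Qed.

Let riccati_diff_projr (P A H D : 'M[R]_d) : D *m P = D -> A *m P = A ->
  (D - dt *: (D *m H *m A + A *m H *m D)) *m P = D - dt *: (D *m H *m A + A *m H *m D).
Proof. by move=> DP AP; rewrite mulmxBl DP -scalemxAl mulmxDl -!mulmxA DP AP. Qed.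

Let newton_diff (X : 'M[R]_d) : P0 *m X = X -> X *m P0 = X ->
  P0 *m (P0 *m (2^-1 *: (3 *: X - ((X *m Rs + Rs *m X) *m Rs + Rs *m Rs *m X))) *m P0) *m P0 =
  2^-1 *: (X - Rs *m X *m Rs).
Proof.
have tE := Rs_invol; have PR := P0_Rs; have RP := Rs_tangent.
move: (P0) tE PR RP => P tE PR RP PX XP.
have -> : 2^-1 *: (3 *: X - ((X *m Rs + Rs *m X) *m Rs + Rs *m Rs *m X)) =
    2^-1 *: (X - Rs *m X *m Rs).
  rewrite mulmxDl -mulmxA tE XP PX; apply/matrixP => i j; rewrite !mxE; lra.
have PZ : P *m (X - Rs *m X *m Rs) = X - Rs *m X *m Rs by rewrite mulmxBr !mulmxA PX PR.
have ZP : (X - Rs *m X *m Rs) *m P = X - Rs *m X *m Rs by rewrite mulmxBl -!mulmxA XP RP.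
by rewrite -!scalemxAr -!scalemxAl -!scalemxAr -!scalemxAl PZ ZP PZ ZP.
Qed.

Let conj_proj (U S W P : 'M[R]_d) : W *m P = W -> U *m S *m W *m P = U *m S *m W.
Proof. by move=> WP; rewrite -mulmxA WP. Qed.

Lemma orth_sym n x A : (orth c n x A)^T = orth c n x A.
Proof.
rewrite /orth; case: xgetP => [B -> [W [s [_ _ ->]]]|_]; last by rewrite trmx0.
by rewrite !trmx_mul trmxK tr_diag_mx mulmxA.
Qed.

Let conj_sym (U S W : 'M[R]_d) : U^T = W -> W^T = U -> S^T = S -> (U *m S *m W)^T = U *m S *m W.
Proof. by move=> UT WT ST; rewrite !trmx_mul UT WT ST mulmxA. Qed.

Let tangent_sum (x v w : 'rV[R]_d) (a b : R) : tangent c x v -> tangent c x w ->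
  tangent c x (a *: v + b *: w).
Proof. by rewrite /tangent/= => vt wt; rewrite mulmxDl -!scalemxAl vt wt !scaler0 addr0. Qed.

Section Diffs.
Variables (V : normedModType R) (p : V).

Lemma near_ball_le (W : normedModType R) (h : V -> W) dh (e : R) : is_diff p h dh ->
  0 < e -> \forall u \near p, `|h u - h p| <= e.
Proof.
move=> [hd _] e0; have /cvgrPdist_le/(_ e e0) := differentiable_continuous hd.
by apply: filterS => u; rewrite distrC.
Qed.

(** Tangent spaces at nearby points have frames, as [orth_estimate] requires,
    because parallel transport is isometric. *)
Lemma transported_frame x : mfd c x -> `|x - xs| <= rho ->
  orthonormal_frame c x (Vf *m ptransmx c xs x).
Proof.
move=> xM xr; have xr0 : `|xs - xs| <= rho by rewrite subrr normr0 ltW.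
have [T I PQ _ _] := ptrans_near xs_mfd xM xr0 xr.
have [_ I' QP _ _] := ptrans_near xM xs_mfd xr xr0.
have [VV VC VP] := Vf_frame.
split.
- rewrite trmx_mul T mulmxA -(mulmxA Vf) I.
  by rewrite tangent_tproj.
- by rewrite -PQ -!mulmxA (tproj_cgrad (mfd_regular c_licq xM)) !mulmx0.
- by rewrite trmx_mul T mulmxA -[_ *m Vf^T *m Vf]mulmxA VP QP.
Qed.

(** By [orth_estimate] the difference to the Newton step is quadratic in
    B^2 - P, which vanishes at Rs, so both have the same differential there. *)
Lemma orth_is_diff (x : V -> 'rV[R]_d) dx (B : V -> 'M[R]_d) dB :
  is_diff p x dx -> x p = xs -> (\forall u \near p, mfd c (x u) /\ `|x u - xs| <= rho) ->
  is_diff p B dB -> B p = Rs ->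
  (\forall u \near p, (B u)^T = B u /\ tproj c (x u) *m B u = B u) ->
  is_diff p (fun u => orth c k (x u) (B u))
    (fun v => 2^-1 *: (3 *: dB v -
       ((dB v *m Rs + Rs *m dB v) *m Rs + Rs *m Rs *m dB v))) /\
  orth c k (x p) (B p) = Rs.
Proof.
move=> xd x0 xM Bd B0 BT.
have PD := mxCk_is_diff (@tproj_Ck _ _ _ c c_smooth 1) xs_reg.
have Pd := comp_is_diff PD xd x0.
have BBd := is_diff_mulmx Bd Bd.
have BBBd := is_diff_mulmx BBd Bd.
have Gd := is_diffZ 2^-1 (is_diffB (is_diffZ 3 Bd) BBBd).
have hd := is_diffB BBd Pd.
pose G u := 2^-1 *: (3 *: B u - B u *m B u *m B u).
pose h u := B u *m B u - tproj c (x u).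
have h0 : h p = 0 by rewrite /h B0 x0 Rs_invol subrr.
have near_est : \forall u \near p, `|orth c k (x u) (B u) - G u| <=
    ((d - m)%:R ^+ 2 * (d%:R ^+ 2) ^+ 2) * `|h u| ^+ 2.
  have e0 : 0 < 1 / (4 * (d - m).+1%:R) / (d%:R ^+ 2 + 1) :> R.
    by rewrite !divr_gt0 ?mulr_gt0 ?ltr0n// ltr_wpDl ?exprn_ge0.
  have e1 : 0 < 1 / (4 * (d%:R + 1)) :> R by rewrite divr_gt0 ?mulr_gt0 ?ltr_wpDl.
  have N1 := near_ball_le hd e0; have N2 := near_ball_le Bd e1.
  apply: filterS (filterI xM (filterI BT (filterI N1 N2))).
  move=> u [[uM ur] [[uT uP] [u1 u2]]].
  rewrite -mulrA -exprMn.
  have {}u1 : `|h u| <= 1 / (4 * (d - m).+1%:R) / (d%:R ^+ 2 + 1).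
    by rewrite -[h u]subr0 -h0; exact: u1.
  rewrite B0 in u2.
  apply: (orth_estimate (transported_frame uM ur)) => //.
    move: u1; rewrite ler_pdivlMr ?ltr_wpDl ?exprn_ge0// => u1.
    apply: le_trans u1; rewrite mulrC ler_wpM2l//; lra.
  rewrite -Rs_tr -linearB/=; apply: le_lt_trans (tr_le _) _.
  apply: (@le_lt_trans _ _ (d%:R * (1 / (4 * (d%:R + 1))))).
    by rewrite ler_wpM2l.
  have d0 : 0 <= d%:R :> R by [].
  rewrite mulrA mulr1 ltr_pdivrMr; lra.
split.
  apply: is_diff_eq (is_diff_quadratic Gd hd h0 near_est) _.
  by apply/funext => v; rewrite B0.
apply/eqP; rewrite -subr_eq0 -normr_le0.
have := nbhs_singleton near_est; rewrite h0 normr0 expr0n mulr0 /G B0 Rs_invol P0_Rs.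
suff -> : 2^-1 *: (3 *: Rs - Rs) = Rs by [].
by apply/matrixP => i j; rewrite !mxE; lra.
Qed.

(** The product rule gives the derivative; its values along the matrix
    directions form the last diagonal block of a block triangular Jacobian. *)
Lemma R_update_is_diff (x y : V -> 'rV[R]_d) dx dy (A : V -> 'M[R]_d) dA :
  is_diff p x dx -> x p = xs -> (\forall u \near p, mfd c (x u) /\ `|x u - xs| <= rho) ->
  is_diff p y dy -> y p = xs -> (\forall u \near p, mfd c (y u) /\ `|y u - xs| <= rho) ->
  is_diff p A dA -> A p = Rs ->
  (\forall u \near p, (A u)^T = A u /\ tproj c (x u) *m A u = A u) ->
  (exists2 L, is_diff p (fun u => op_ptrans c (y u) xs (R_update c f k dt (x u) (A u) (y u))) L &
    forall v, dx v = 0 -> dy v = 0 -> P0 *m dA v = dA v -> dA v *m P0 = dA v ->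
      let X := dA v - dt *: (dA v *m H0 *m Rs + Rs *m H0 *m dA v) in
      L v = 2^-1 *: (X - Rs *m X *m Rs)) /\
  (forall L, is_diff p (fun u => op_ptrans c (y u) xs (R_update c f k dt (x u) (A u) (y u))) L ->
    forall v, (L v)^T = L v /\ L v *m P0 = L v) /\
  R_update c f k dt (x p) (A p) (y p) = Rs.
Proof.
move=> xd x0 xM yd y0 yM Ad A0 AT.
have [dP PD dP0] : exists2 dP, is_diff xs (tproj c) dP & dP 0 = 0.
  have PD := mxCk_is_diff (@tproj_Ck _ _ _ c c_smooth 1) xs_reg.
  by exists ('d (tproj c) xs); [case: PD => ? _; exact: differentiableP|exact: linear0].
have [dH HD dH0] : exists2 dH, is_diff xs (rhess c f) dH & dH 0 = 0.
  have HD := mxCk_is_diff (@rhess_Ck _ _ _ c c_smooth f f_smooth 1) xs_reg.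
  by exists ('d (rhess c f) xs); [case: HD => ? _; exact: differentiableP|exact: linear0].
have Hd := comp_is_diff HD xd x0.
pose B u := A u + dt *: (rhess c f (x u) - A u *m rhess c f (x u) *m A u).
have [dB Bd dBE] : exists2 dB, is_diff p B dB & forall v, dx v = 0 ->
    dB v = dA v - dt *: (dA v *m H0 *m Rs + Rs *m H0 *m dA v).
  have AHd := is_diff_mulmx (is_diff_mulmx Ad Hd) Ad.
  eexists; first exact: is_diffD Ad (is_diffZ dt (is_diffB Hd AHd)).
  move=> v dxv.
  rewrite -[LHS]/(dA v + dt *: (dH (dx v) - ((dA v *m rhess c f (x p) + A p *m dH (dx v)) *m A p
    + A p *m rhess c f (x p) *m dA v))) dxv dH0 x0 A0 (mulmx0 _ Rs) addr0 sub0r scalerN.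
  by [].
have PH := tproj_rhess xs_reg; have HP := rhess_tproj xs_reg.
have RHR : Rs *m H0 *m Rs = H0 by rewrite Rs_comm -mulmxA Rs_invol HP.
have B0 : B p = Rs by rewrite /B A0 x0 RHR subrr scaler0 addr0.
have near_sym : \forall u \near p, (rhess c f (x u))^T = rhess c f (x u).
  have [xdd _] := xd.
  have near_x : \forall u \near p, mfd c (x u) -> (rhess c f (x u))^T = rhess c f (x u).
    have xc : x u @[u --> p] --> xs by rewrite -[X in _ --> X]x0; exact: differentiable_continuous xdd.
    exact: (xc _ hess_sym).
  by apply: filterS (filterI near_x xM) => u [uH [uM _]]; exact: uH.
have BT : \forall u \near p, (B u)^T = B u /\ tproj c (x u) *m B u = B u.
  apply: filterS (filterI xM (filterI AT near_sym)) => u [[uM _] [[uT uP] uS]].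
  have ur : regular c (x u) by exact: mfd_regular.
  split; first exact: riccati_sym.
  exact: (riccati_proj uP (tproj_rhess ur)).
have [Jd J0] := orth_is_diff xd x0 xM Bd B0 BT.
have [Qd Q0] := ptransmx_is_diff PD xd yd x0 y0 xM yM.
have [Qd' Q0'] := ptransmx_is_diff PD yd xd y0 x0 yM xM.
have xsd : is_diff p (fun _ : V => xs) (fun _ => 0) by exact: is_diff_cst.
have xsM : \forall u \near p, mfd c xs /\ `|xs - xs| <= rho.
  by apply: nearW => u; rewrite subrr normr0; split; [exact: xs_mfd|exact: ltW].
have [Td T0] := ptransmx_is_diff PD xsd yd erefl y0 xsM yM.
have [Td' T0'] := ptransmx_is_diff PD yd xsd y0 erefl yM xsM.
have Rd := is_diff_mulmx (is_diff_mulmx Qd' Jd) Qd.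
have Fd := is_diff_mulmx (is_diff_mulmx Td Rd) Td'.
have R0 : R_update c f k dt (x p) (A p) (y p) = Rs.
  rewrite /R_update /op_ptrans -/(B p) J0 Q0 Q0' P0_Rs; exact: Rs_tangent.
split; last split; last exact: R0; last first.
  move=> L LD v.
  have near_L : \forall u \near p,
      let F := op_ptrans c (y u) xs (R_update c f k dt (x u) (A u) (y u)) in
      F^T = F /\ F *m P0 = F.
    apply: filterS (filterI xM yM) => u [[uM ur] [vM vr]].
    have xr0 : `|xs - xs| <= rho by rewrite subrr normr0 ltW.
    have [T1 _ _ _ _] := ptrans_near xs_mfd vM xr0 vr.
    have [T2 _ Q2 _ _] := ptrans_near vM xs_mfd vr xr0.
    have [T3 _ _ _ _] := ptrans_near uM vM ur vr.
    have [T4 _ _ _ _] := ptrans_near vM uM vr ur.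
    split; last exact: (conj_proj _ _ Q2).
    by apply: (conj_sym T1 T2); apply: (conj_sym T4 T3); exact: orth_sym.
  have D1 := is_diff_tr LD.
  have D2 := is_diff_mulmx LD (is_diff_cst P0 p).
  have E1 : (fun v => (L v)^T) = L.
    have : is_diff p (fun u => op_ptrans c (y u) xs (R_update c f k dt (x u) (A u) (y u)))
      (fun v => (L v)^T) by apply: is_diff_near D1; apply: filterS near_L => u [].
    by case: LD => _ <- [_ <-].
  have E2 : (fun v => L v *m P0) = L.
    have : is_diff p (fun u => op_ptrans c (y u) xs (R_update c f k dt (x u) (A u) (y u)))
      (fun v => L v *m P0).
      apply: is_diff_near (is_diff_eq D2 _); first by apply: filterS near_L => u [].
      by apply/funext => w; rewrite /= mulmx0 addr0.
    by case: LD => _ {3}<- [_ <-].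
  split; first exact: (congr1 (fun F => F v) E1).
  exact: (congr1 (fun F => F v) E2).
eexists; first exact: Fd.
move=> v dxv dyv PdA dAP X.
have dPx : dP (dx v) *m P0 + P0 *m dP (dy v) = 0.
  by rewrite dxv dyv dP0 mul0mx mulmx0 addr0.
have dPy : dP (dy v) *m P0 + P0 *m dP (dx v) = 0.
  by rewrite dxv dyv dP0 mul0mx mulmx0 addr0.
have dP1 : dP 0 *m P0 + P0 *m dP (dy v) = 0.
  by rewrite dyv dP0 mul0mx mulmx0 addr0.
have dP2 : dP (dy v) *m P0 + P0 *m dP 0 = 0.
  by rewrite dyv dP0 mul0mx mulmx0 addr0.
rewrite /= dPx dPy dP1 dP2 !mul0mx !mulmx0 !add0r !addr0 T0 T0' Q0 Q0'.
rewrite (dBE _ dxv) -/X; apply: newton_diff.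
  exact: (@riccati_diff_proj P0 Rs H0 (dA v) PdA P0_Rs).
exact: (@riccati_diff_projr P0 Rs H0 (dA v) dAP Rs_tangent).
Qed.

(** Along a path of tangent vectors the exponential map and the retraction
    move to first order like translations, and parallel transport does
    not contribute, so the linearised step is that of a flat space. *)
Lemma mcsd_is_diff (xi r : V -> 'rV[R]_d) dxi dr (S : V -> 'M[R]_d) dS :
  is_diff p xi dxi -> xi p = 0 -> (forall u, tangent c xs (xi u)) ->
  (forall v, tangent c xs (dxi v)) ->
  is_diff p r dr -> r p = 0 -> (forall u, tangent c xs (r u)) ->
  (forall v, tangent c xs (dr v)) ->
  is_diff p S dS -> S p = Rs -> (forall u, (S u)^T = S u) ->
  let drb v := - dt *: (dxi v *m H0 *m Rs) + gamma *: dr v in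
  let Z u := mcsd_coords c xs
    (mcsd_step c f Ret k dt gamma (mcsd_chart c xs (xi u, r u, S u))) in
  [/\ is_diff p (fun u => (Z u).1.1) (fun v => dxi v + drb v),
      is_diff p (fun u => (Z u).1.2) drb &
      exists L, [/\ is_diff p (fun u => (Z u).2) L,
      forall v, (L v)^T = L v /\ L v *m P0 = L v &
      forall v, dxi v = 0 -> dr v = 0 -> P0 *m dS v = dS v -> dS v *m P0 = dS v ->
      let X := dS v - dt *: (dS v *m H0 *m Rs + Rs *m H0 *m dS v) in
      L v = 2^-1 *: (X - Rs *m X *m Rs)]].
Proof.
move=> xid xi0 xit dxit rd r0 rt drt Sd S0 ST drb Z.
have [dP PD dP0] : exists2 dP, is_diff xs (tproj c) dP & dP 0 = 0.
  have PD := mxCk_is_diff (@tproj_Ck _ _ _ c c_smooth 1) xs_reg.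
  by exists ('d (tproj c) xs); [case: PD => ? _; exact: differentiableP|exact: linear0].
pose x u := exp_map c xs (xi u).
have [xd x0 xM] := exp_map_is_diff xid xi0 xit.
rewrite -/(x p) in x0.
have xsd : is_diff p (fun _ : V => xs) (fun _ => 0) by exact: is_diff_cst.
have xsM : \forall u \near p, mfd c xs /\ `|xs - xs| <= rho.
  by apply: nearW => u; rewrite subrr normr0; split; [exact: xs_mfd|exact: ltW].
have [Qd Q0] := ptransmx_is_diff PD xsd xd erefl x0 xsM xM.
have [Qd' Q0'] := ptransmx_is_diff PD xd xsd x0 erefl xM xsM.
pose A u := op_ptrans c xs (x u) (S u).
have A0 : A p = Rs by rewrite /A /op_ptrans S0 -/(x p) Q0 Q0' P0_Rs; exact: Rs_tangent.
have [dA Ad dAE] : exists2 dA, is_diff p A dA &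
    forall v, dxi v = 0 -> P0 *m dS v = dS v -> dS v *m P0 = dS v -> dA v = dS v.
  eexists; first exact: is_diff_mulmx (is_diff_mulmx Qd' Sd) Qd.
  move=> v xiv PS SP.
  by rewrite /= xiv dP0 !mul0mx !mulmx0 !addr0 !mul0mx !add0r mulmx0 addr0 Q0 Q0' PS SP.
have AT : \forall u \near p, (A u)^T = A u /\ tproj c (x u) *m A u = A u.
  apply: filterS xM => u [uM ur].
  have xr0 : `|xs - xs| <= rho by rewrite subrr normr0 ltW.
  have [T _ PQ _ _] := ptrans_near xs_mfd uM xr0 ur.
  have [T' _ _ _ _] := ptrans_near uM xs_mfd ur xr0.
  have PQ' : tproj c (x u) *m ptransmx c (x u) xs = ptransmx c (x u) xs.
    by rewrite -T -[tproj c (x u)]tproj_tr -trmx_mul PQ.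
  split; first exact: (conj_sym T' T (ST u)).
  by rewrite /A /op_ptrans !mulmxA PQ'.
pose r1 u := r u *m ptransmx c xs (x u).
have r1d : is_diff p r1 dr.
  apply: is_diff_eq (is_diff_mulmx rd Qd) _; apply/funext => v.
  rewrite r0 mul0mx addr0 Q0; exact: tangent_tproj (drt v).
pose rb u := - dt *: (rgrad c f (x u) *m A u) + gamma *: r1 u.
have x_crit : rgrad c f (x p) = 0 by rewrite x0.
have rbd : is_diff p rb drb.
  have gd := comp_is_diff (rgrad_is_diff c_smooth f_smooth xs_reg) xd x0.
  apply: is_diff_eq (is_diffD (is_diffZ (- dt) (is_diff_mulmx gd Ad)) (is_diffZ gamma r1d)) _.
  apply/funext => v.
  rewrite -[LHS]/(- dt *: (dxi v *m 'J (rgrad c f) xs *m A p + rgrad c f (x p) *m dA v) +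
     gamma *: dr v) x_crit A0 mul0mx addr0.
  by rewrite (rgrad_critical_is_diff c_smooth f_smooth xs_reg f_crit (dxit v)).
have rb0 : rb p = 0 by rewrite /rb /r1 x_crit r0 !mul0mx !scaler0 addr0.
have rbt : \forall u \near p, tangent c (x u) (rb u).
  apply: filterS (filterI xM AT) => u [[uM ur] [uT uP]].
  have ureg : regular c (x u) by exact: mfd_regular.
  have xr0 : `|xs - xs| <= rho by rewrite subrr normr0 ltW.
  have [_ _ PQ _ _] := ptrans_near xs_mfd uM xr0 ur.
  have AP : A u *m tproj c (x u) = A u.
    by rewrite -{1}uT -[tproj c (x u)]tproj_tr -trmx_mul uP uT.
  apply: tangent_sum.
    by rewrite -AP mulmxA; exact: tproj_tangent.
  by rewrite /r1 -PQ mulmxA; exact: tproj_tangent.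
have drbt v : tangent c xs (drb v).
  apply: tangent_sum; last exact: drt.
  by rewrite -Rs_tangent mulmxA; exact: tproj_tangent.
pose y u := Ret (x u) (rb u).
have xM' : \forall u \near p, mfd c (x u) by apply: filterS xM => u [].
have yd : is_diff p y (fun v => dxi v + drb v).
  exact: (retraction_is_diff Ret_retr xd rbd x0 rb0 xM' rbt dxit drbt).
have y0 : y p = xs.
  by rewrite /y rb0 x0; case: Ret_retr => _ -> //; exact: xs_mfd.
have yM : \forall u \near p, mfd c (y u) /\ `|y u - xs| <= rho.
  have := near_ball_le yd rho_gt0; rewrite y0 => near_y.
  have [RetM _ _ _] := Ret_retr.
  apply: filterS (filterI near_y (filterI xM' rbt)) => u [uy [uM ut]].
  by split; [exact: RetM|exact: uy].
split.
- have yM' : \forall u \near p, mfd c (y u) by apply: filterS yM => u [].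
  by have [] := exp_inv_is_diff yd y0 yM'.
- have [Td T0] := ptransmx_is_diff PD xd yd x0 y0 xM yM.
  have [Td' T0'] := ptransmx_is_diff PD yd xsd y0 erefl yM xsM.
  apply: is_diff_eq (is_diff_mulmx (is_diff_mulmx rbd Td) Td') _.
  apply/funext => v; rewrite rb0 !mul0mx !addr0 T0 T0'.
  by rewrite (tangent_tproj (drbt v)) (tangent_tproj (drbt v)).
have [[L Ld LE] [LT _]] := R_update_is_diff xd x0 xM yd y0 yM Ad A0 AT.
exists L; split; [exact: Ld|exact: LT Ld|].
move=> v xiv rv PS SP X; have dAv := dAE v xiv PS SP.
rewrite (LE v xiv) ?dAv//.
by rewrite xiv /drb xiv rv !mul0mx !scaler0 !addr0.
Qed.

Lemma R_update_fixed : R_update c f k dt xs Rs xs = Rs.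
Proof.
have xsM : \forall u \near p, mfd c xs /\ `|xs - xs| <= rho.
  by apply: nearW => u; rewrite subrr normr0; split; [exact: xs_mfd|exact: ltW].
have xsd : is_diff p (fun _ : V => xs) (fun _ => 0) by exact: is_diff_cst.
have Rsd : is_diff p (fun _ : V => Rs) (fun _ => 0) by exact: is_diff_cst.
have RsT : \forall u \near p, Rs^T = Rs /\ P0 *m Rs = Rs.
  by apply: nearW => u; split; [exact: Rs_sym|exact: P0_Rs].
by have [_ [_ RE]] := R_update_is_diff xsd erefl xsM xsd erefl xsM Rsd erefl RsT.
Qed.

End Diffs.

Lemma mcsd_step_fixed : mcsd_step c f Ret k dt gamma (xs, 0, Rs) = (xs, 0, Rs).
Proof.
have RE := R_update_fixed (0 : 'rV[R]_1).
rewrite /mcsd_step f_crit mul0mx !scaler0 addr0 mul0mx.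
have [_ -> // _ _] := Ret_retr.
by rewrite RE.
Qed.

(** The scheme without momentum is the momentum scheme started with r = 0, for
    any gamma, if r is reset at each step: its differential comes for free. *)
Lemma csd_step_mcsd z : csd_step c f Ret k dt z =
  let w := mcsd_step c f Ret k dt gamma (z.1, 0, z.2) in (w.1.1, w.2).
Proof. by case: z => x A; rewrite /= scaler0 addr0. Qed.

Lemma csd_step_fixed : csd_step c f Ret k dt (xs, Rs) = (xs, Rs).
Proof. by rewrite csd_step_mcsd mcsd_step_fixed. Qed.

Lemma coords_saddle : mcsd_coords c xs (xs, 0, Rs) = (0, 0, Rs).
Proof.
have xr : `|xs - xs| <= rho by rewrite subrr normr0 ltW.
have := exp_inv_near xs_mfd xr; rewrite subrr normr0 expr0n mulr0 subr0 normr_le0 => /eqP E.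
have [_ _ _ + _] := ptrans_near xs_mfd xs_mfd xr xr.
rewrite subrr normr0 expr0n mulr0 normr_le0 subr_eq0 tproj_idem// => /eqP Q.
by rewrite /mcsd_coords/= E Q mul0mx /op_ptrans Q P0_Rs Rs_tangent.
Qed.




(** * Contraction at the saddle point *)

Let frame_tangent i : tangent c xs (row i Vf).
Proof. by case: Vf_frame => _ VC _; rewrite /tangent/= -row_mul VC row0. Qed.

Let frame_sym_cgrad i j : frame_sym Vf i j *m (cgrad c xs)^T = 0.
Proof.
rewrite /frame_sym -scalemxAl mulmxDl -!mulmxA.
by rewrite (frame_tangent i : _ = 0) (frame_tangent j : _ = 0) !mulmx0 addr0 scaler0.
Qed.

Let tangent_mx0 n (A : 'M[R]_(n, d)) : A *m P0 = A -> A *m (cgrad c xs)^T = 0.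
Proof. by move=> <-; rewrite -mulmxA tproj_cgrad ?mulmx0. Qed.

Let rate_pos i : 0 < rate k ev dt i <= 1.
Proof.
have /andP[a b] := rate_bound lmin_gt0 ev_bound dt_gt0 dt_lt i.
have : 0 < dt * lmin by rewrite mulr_gt0.
by move=> ?; apply/andP; split; lra.
Qed.

Let rate_le i : 1 - rate k ev dt i <= 1 - dt * lmin.
Proof. by have /andP[a b] := rate_bound lmin_gt0 ev_bound dt_gt0 dt_lt i; lra. Qed.

Let step_tangent u v : tangent c xs u -> tangent c xs v ->
  tangent c xs (- dt *: (u *m H0 *m Rs) + gamma *: v).
Proof.
move=> ut vt; apply: tangent_sum => //.
by apply: tangent_mx0; rewrite -mulmxA Rs_tangent.
Qed.

Let tangentD u v : tangent c xs u -> tangent c xs v -> tangent c xs (u + v).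
Proof. by move=> ut vt; have := tangent_sum 1 1 ut vt; rewrite !scale1r. Qed.

Let csd_map_mcsd z :
  csd_coords c xs (csd_step c f Ret k dt (csd_chart c xs z)) =
  let Z := mcsd_coords c xs
    (mcsd_step c f Ret k dt gamma (mcsd_chart c xs (z.1, 0, z.2))) in (Z.1.1, Z.2).
Proof. by rewrite csd_step_mcsd [in RHS]/mcsd_chart mul0mx. Qed.

Hypothesis contraction : 0 <= 1 - dt * lmin < 1.

Section Csd.
Local Notation E := (csd_space c xs).
Local Notation N := (\dim E).
Local Notation w := (@basis_point R _ E).
Let F : 'rV[R]_N -> 'rV[R]_N :=
  local_map (csd_chart c xs) (csd_coords c xs) (csd_step c f Ret k dt).
Let p : 'rV[R]_N := local_point E (csd_coords c xs) (xs, Rs).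

Let xi u := (w u).1.
Let S u := (w u).2.

Let xi_lin : linear xi. Proof. by move=> a u v; rewrite /xi basis_point_linear. Qed.
Let S_lin : linear S. Proof. by move=> a u v; rewrite /S basis_point_linear. Qed.

Let wP u : [/\ tangent c xs (xi u), S u *m (cgrad c xs)^T = 0 & (S u)^T = S u].
Proof. by apply/mem_csd_space; exact: basis_point_in. Qed.

Let w_p : w p = (0, Rs).
Proof.
rewrite /p /local_point.
have -> : csd_coords c xs (xs, Rs) = (0, Rs).
  by have := coords_saddle; rewrite /mcsd_coords/= => -[H1 _ H2]; rewrite /csd_coords/= H1 H2.
apply: basis_coordK; apply/mem_csd_space; split=> /=; last exact: Rs_sym.
  by rewrite /tangent/= mul0mx.
exact: tangent_mx0.
Qed.

(** The derivative factors through a map G with values in E, where taking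
    coordinates in the basis of E loses nothing. *)
Let linearised : exists G : 'rV[R]_N -> 'rV[R]_d * 'M[R]_d,
  [/\ is_diff p F (fun u => basis_coord E (G u)), forall u, G u \in E,
      forall u, (G u).1 = xi u + (- dt *: (xi u *m H0 *m Rs) + gamma *: 0) &
      forall u, xi u = 0 ->
        let X := S u - dt *: (S u *m H0 *m Rs + Rs *m H0 *m S u) in
        (G u).2 = 2^-1 *: (X - Rs *m X *m Rs)].
Proof.
have xit u : tangent c xs (xi u) by case: (wP u).
have ST u : (S u)^T = S u by case: (wP u).
have SP u : S u *m P0 = S u by apply: tangent_tproj; case: (wP u).
have PS u : P0 *m S u = S u by rewrite -{1}ST -[P0]tproj_tr -trmx_mul SP.
have z_tan (u : 'rV[R]_N) : tangent c xs (0 : 'rV[R]_d) by rewrite /tangent/= mul0mx.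
have zd : is_diff p (fun _ : 'rV[R]_N => 0 : 'rV[R]_d) (fun _ => 0) by exact: is_diff_cst.
have xi_p : xi p = 0 by rewrite /xi w_p.
have S_p : S p = Rs by rewrite /S w_p.
pose Z u := mcsd_coords c xs
  (mcsd_step c f Ret k dt gamma (mcsd_chart c xs (xi u, 0, S u))).
have [D1 _ [L1 [LD LT LE]]] := mcsd_is_diff (is_diff_rowvec_linear p xi_lin) xi_p xit xit
  zd erefl z_tan z_tan (is_diff_rowvec_linear p S_lin) S_p ST.
pose G u := (xi u + (- dt *: (xi u *m H0 *m Rs) + gamma *: 0), L1 u).
exists G; split=> [|u|//|u xi0].
- pose A (v : 'rV[R]_d) := basis_coord E (v, 0).
  pose B (M : 'M[R]_d) := basis_coord E (0, M).
  have AB v M : basis_coord E (v, M) = A v + B M.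
    have := basis_coord_linear E 1 (v, 0) (0, M); rewrite !scale1r => <-.
    by congr (basis_coord E _); congr (_, _); rewrite /= ?addr0 ?add0r.
  have Alin : linear A.
    move=> a u v; rewrite /A -basis_coord_linear; congr (basis_coord E (_, _)).
    by rewrite /= scaler0 addr0.
  have Blin : linear B.
    move=> a u v; rewrite /B -basis_coord_linear; congr (basis_coord E (_, _)).
    by rewrite /= scaler0 addr0.
  have D := is_diffD (linear_is_diff Alin D1) (linear_is_diff Blin LD).
  have -> : F = (fun u => A (Z u).1.1) + (fun u => B (Z u).2).
    apply/funext => u; rewrite -[RHS]/(A (Z u).1.1 + B (Z u).2) -AB.
    by rewrite /F /local_map csd_map_mcsd.
  by apply: is_diff_eq D _; apply/funext => u; rewrite /G AB.
- apply/mem_csd_space; have [T1 T2] := LT u; split; [|exact: tangent_mx0 T2|exact: T1].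
  by apply: (tangentD (xit u)); exact: step_tangent (xit u) (z_tan u).
exact: (LE u xi0 erefl (PS u) (SP u)).
Qed.

Let J : 'M[R]_N := 'J F p.
Let y i u := tcoord Vf i (xi u).
Let s i j u := ocoord Vf i j (S u).

Let y_lin i : scalar (y i).
Proof. by move=> a u v; rewrite /y xi_lin tcoord_linear. Qed.

Let s_lin i j : scalar (s i j).
Proof. by move=> a u v; rewrite /s S_lin ocoord_linear. Qed.

Let e i := basis_coord E (row i Vf, 0).
Let e2 i j := basis_coord E (0, frame_sym Vf i j).

Let recon u : u = \sum_i y i u *: e i + \sum_i \sum_j s i j u *: e2 i j.
Proof.
have [xit SC ST] := wP u.
have SP : S u *m P0 = S u by exact: tangent_tproj.
pose A (v : 'rV[R]_d) := basis_coord E (v, 0).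
pose B (M : 'M[R]_d) := basis_coord E (0, M).
have Alin : linear A.
  move=> a u' v; rewrite /A -basis_coord_linear; congr (basis_coord E (_, _)).
  by rewrite /= scaler0 addr0.
have Blin : linear B.
  move=> a u' v; rewrite /B -basis_coord_linear; congr (basis_coord E (_, _)).
  by rewrite /= scaler0 addr0.
have -> : \sum_i y i u *: e i = A (xi u).
  by rewrite [in RHS](tcoord_expand VfTVf (tangent_tproj xit)) (linear_comb Alin).
have -> : \sum_i \sum_j s i j u *: e2 i j = B (S u).
  rewrite [in RHS](ocoord_expand_sym VfTVf ST SP).
  rewrite (eq_bigr (fun i => 1 *: \sum_j ocoord Vf i j (S u) *: frame_sym Vf i j)).
    by rewrite (linear_comb Blin); apply: eq_bigr => i _; rewrite scale1r (linear_comb Blin).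
  by move=> i _; rewrite scale1r.
rewrite -[LHS]basis_pointK /A /B.
have := basis_coord_linear E 1 (xi u, 0) (0, S u); rewrite !scale1r => <-.
congr (basis_coord E _); rewrite -[RHS]/(xi u + 0, 0 + S u) addr0 add0r.
by rewrite [LHS]surjective_pairing.
Qed.

Let y_e2 l i j : y l (e2 i j) = 0.
Proof.
rewrite /y /xi basis_coordK/=; first by rewrite /tcoord mul0mx mxE.
apply/mem_csd_space; split=> /=; [|exact: frame_sym_cgrad|exact: frame_symT].
by rewrite /tangent/= mul0mx.
Qed.

Let csd_conclusion : [/\ differentiable F p,
  forall i u, y i (u *m J) = (1 - rate k ev dt i) * y i u &
  forall i j u, (forall i, y i u = 0) -> s i j (u *m J) = coupling k ev dt i j * s i j u].
Proof.
have [G [[Fd FE] GE G1 G2]] := linearised.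
have wJ u : w (u *m J) = G u.
  by rewrite -(basis_coordK (GE u)) mul_rV_lin1 FE.
split; first exact: Fd.
  move=> i u; rewrite /y /xi wJ G1 (tcoord_step dt VfVf H0E RsE) -/xi.
  by rewrite {2}/tcoord mul0mx mxE mulr0 addr0.
move=> i j u y0.
have [xit SC ST] := wP u.
have xi0 : xi u = 0.
  by rewrite (tcoord_expand VfTVf (tangent_tproj xit)) big1// => l _; rewrite -/(y l u) y0 scale0r.
rewrite /s {1}/S wJ (G2 _ xi0).
exact: (ocoord_step dt VfVf VfTVf H0E RsE _ _ ST (tangent_tproj SC)).
Qed.

Lemma csd_contractive_stable :
  locally_contractive E (csd_chart c xs) (csd_coords c xs) (csd_step c f Ret k dt) (xs, Rs) /\
  asymptotically_linearly_stable E (csd_chart c xs) (csd_coords c xs)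
    (csd_step c f Ret k dt) (xs, Rs).
Proof.
have [Fd yJ sJ] := csd_conclusion.
have cb i j := coupling_bound lmin_gt0 ev_bound dt_gt0 dt_lt i j.
split; split; [exact: csd_step_fixed|exact: Fd| |exact: csd_step_fixed|exact: Fd|].
  apply: (csd_spectral_radius y_lin s_lin contraction rate_pos rate_le cb yJ sJ).
  move=> u y0 s0; rewrite [u]recon !big1 ?addr0// => i _; last by rewrite y0 scale0r.
  by rewrite big1// => j _; rewrite s0 scale0r.
exact: (csd_iterates_cvg0 y_lin s_lin contraction rate_pos cb yJ sJ recon y_e2).
Qed.

End Csd.

Section Mcsd.
Hypothesis gamma_gt0 : 0 < gamma.
Hypothesis gamma_lt1 : gamma < 1.
Local Notation E := (mcsd_space c xs).
Local Notation N := (\dim E).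
Local Notation w := (@basis_point R _ E).
Let F : 'rV[R]_N -> 'rV[R]_N :=
  local_map (mcsd_chart c xs) (mcsd_coords c xs) (mcsd_step c f Ret k dt gamma).
Let p : 'rV[R]_N := local_point E (mcsd_coords c xs) (xs, 0, Rs).

Let xi u := (w u).1.1.
Let r u := (w u).1.2.
Let S u := (w u).2.

Let xi_lin : linear xi. Proof. by move=> a u v; rewrite /xi basis_point_linear. Qed.
Let r_lin : linear r. Proof. by move=> a u v; rewrite /r basis_point_linear. Qed.
Let S_lin : linear S. Proof. by move=> a u v; rewrite /S basis_point_linear. Qed.

Let wP u : [/\ tangent c xs (xi u), tangent c xs (r u), S u *m (cgrad c xs)^T = 0 &
  (S u)^T = S u].
Proof. by apply/mem_mcsd_space; exact: basis_point_in. Qed.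

Let w_p : w p = (0, 0, Rs).
Proof.
rewrite /p /local_point coords_saddle.
apply: basis_coordK; apply/mem_mcsd_space; split=> /=; last exact: Rs_sym.
- by rewrite /tangent/= mul0mx.
- by rewrite /tangent/= mul0mx.
exact: tangent_mx0.
Qed.

Let linearised : exists G : 'rV[R]_N -> 'rV[R]_d * 'rV[R]_d * 'M[R]_d,
  [/\ is_diff p F (fun u => basis_coord E (G u)), forall u, G u \in E,
      forall u, (G u).1 = (xi u + (- dt *: (xi u *m H0 *m Rs) + gamma *: r u),
                           - dt *: (xi u *m H0 *m Rs) + gamma *: r u) &
      forall u, xi u = 0 -> r u = 0 ->
        let X := S u - dt *: (S u *m H0 *m Rs + Rs *m H0 *m S u) in
        (G u).2 = 2^-1 *: (X - Rs *m X *m Rs)].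
Proof.
have xit u : tangent c xs (xi u) by case: (wP u).
have rt u : tangent c xs (r u) by case: (wP u).
have ST u : (S u)^T = S u by case: (wP u).
have SP u : S u *m P0 = S u by apply: tangent_tproj; case: (wP u).
have PS u : P0 *m S u = S u by rewrite -{1}ST -[P0]tproj_tr -trmx_mul SP.
have xi_p : xi p = 0 by rewrite /xi w_p.
have r_p : r p = 0 by rewrite /r w_p.
have S_p : S p = Rs by rewrite /S w_p.
pose Z u := mcsd_coords c xs
  (mcsd_step c f Ret k dt gamma (mcsd_chart c xs (xi u, r u, S u))).
have [D1 D2 [L1 [LD LT LE]]] := mcsd_is_diff (is_diff_rowvec_linear p xi_lin) xi_p xit xit
  (is_diff_rowvec_linear p r_lin) r_p rt rt (is_diff_rowvec_linear p S_lin) S_p ST.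
pose G u := (xi u + (- dt *: (xi u *m H0 *m Rs) + gamma *: r u),
  - dt *: (xi u *m H0 *m Rs) + gamma *: r u, L1 u).
exists G; split=> [|u|//|u xi0 r0].
- pose A (v : 'rV[R]_d) := basis_coord E (v, 0, 0).
  pose B (v : 'rV[R]_d) := basis_coord E (0, v, 0).
  pose C (M : 'M[R]_d) := basis_coord E (0, 0, M).
  have ABC v v' M : basis_coord E (v, v', M) = A v + (B v' + C M).
    have bD a b : basis_coord E (a + b) = basis_coord E a + basis_coord E b.
      by have := basis_coord_linear E 1 a b; rewrite !scale1r.
    rewrite /A /B /C -!bD; congr (basis_coord E _).
    by rewrite -[RHS]/(v + (0 + 0), 0 + (v' + 0), 0 + (0 + M)) !addr0 !add0r.
  have Alin : linear A.
    move=> a u v; rewrite /A -basis_coord_linear; congr (basis_coord E _).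
    by rewrite -[RHS]/(a *: u + v, a *: 0 + 0, a *: 0 + 0) !scaler0 !addr0.
  have Blin : linear B.
    move=> a u v; rewrite /B -basis_coord_linear; congr (basis_coord E _).
    by rewrite -[RHS]/(a *: 0 + 0, a *: u + v, a *: 0 + 0) !scaler0 !addr0.
  have Clin : linear C.
    move=> a u v; rewrite /C -basis_coord_linear; congr (basis_coord E _).
    by rewrite -[RHS]/(a *: 0 + 0, a *: 0 + 0, a *: u + v) !scaler0 !addr0.
  have D := is_diffD (linear_is_diff Alin D1)
    (is_diffD (linear_is_diff Blin D2) (linear_is_diff Clin LD)).
  have -> : F = (fun u => A (Z u).1.1) + ((fun u => B (Z u).1.2) + (fun u => C (Z u).2)).
    apply/funext => u; rewrite -[RHS]/(A (Z u).1.1 + (B (Z u).1.2 + C (Z u).2)) -ABC.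
    by rewrite /F /local_map /Z /xi /r /S -!surjective_pairing.
  by apply: is_diff_eq D _; apply/funext => u; rewrite /G ABC.
- apply/mem_mcsd_space; have [T1 T2] := LT u.
  split; [| |exact: tangent_mx0 T2|exact: T1].
    by apply: (tangentD (xit u)); exact: step_tangent (xit u) (rt u).
  exact: step_tangent (xit u) (rt u).
exact: (LE u xi0 r0 (PS u) (SP u)).
Qed.

Let J : 'M[R]_N := 'J F p.
Let y i u := tcoord Vf i (xi u).
Let z i u := tcoord Vf i (r u).
Let s i j u := ocoord Vf i j (S u).

Let y_lin i : scalar (y i).
Proof. by move=> a u v; rewrite /y xi_lin tcoord_linear. Qed.

Let z_lin i : scalar (z i).
Proof. by move=> a u v; rewrite /z r_lin tcoord_linear. Qed.

Let s_lin i j : scalar (s i j).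
Proof. by move=> a u v; rewrite /s S_lin ocoord_linear. Qed.

Let tangent_eq0 u : tangent c xs u -> (forall i, tcoord Vf i u = 0) -> u = 0.
Proof.
move=> ut u0; rewrite (tcoord_expand VfTVf (tangent_tproj ut)) big1// => l _.
by rewrite u0 scale0r.
Qed.

Let separated u : (forall i, y i u = 0) -> (forall i, z i u = 0) ->
  (forall i j, s i j u = 0) -> u = 0.
Proof.
move=> y0 z0 s0; have [xit rt SC ST] := wP u.
have SP : S u *m P0 = S u by exact: tangent_tproj.
have E1 : xi u = 0 by exact: tangent_eq0.
have E2 : r u = 0 by exact: tangent_eq0.
have E3 : S u = 0.
  rewrite (ocoord_expand VfTVf ST SP) big1// => i _; rewrite big1// => j _.
  by rewrite -/(s i j u) s0 scale0r.
have wu : w u = 0.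
  by rewrite [LHS]surjective_pairing [(w u).1]surjective_pairing -/(xi u) -/(r u) -/(S u) E1 E2 E3.
by rewrite -[u]basis_pointK wu; apply/rowP => i; rewrite !mxE linear0.
Qed.

Let mcsd_conclusion : [/\ differentiable F p,
  forall i u, y i (u *m J) = (1 - rate k ev dt i) * y i u + gamma * z i u,
  forall i u, z i (u *m J) = - rate k ev dt i * y i u + gamma * z i u &
  forall i j u, (forall i, y i u = 0) -> (forall i, z i u = 0) ->
    s i j (u *m J) = coupling k ev dt i j * s i j u].
Proof.
have [G [[Fd FE] GE G1 G2]] := linearised.
have wJ u : w (u *m J) = G u.
  by rewrite -(basis_coordK (GE u)) mul_rV_lin1 FE.
split; first exact: Fd.
- by move=> i u; rewrite /y /xi wJ G1 (tcoord_step dt VfVf H0E RsE).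
- by move=> i u; rewrite /z /r wJ G1 (tcoord_momentum dt VfVf H0E RsE).
move=> i j u y0 z0; have [xit rt SC ST] := wP u.
rewrite /s {1}/S wJ (G2 _ (tangent_eq0 xit y0) (tangent_eq0 rt z0)).
exact: (ocoord_step dt VfVf VfTVf H0E RsE _ _ ST (tangent_tproj SC)).
Qed.

Lemma mcsd_contractive :
  locally_contractive E (mcsd_chart c xs) (mcsd_coords c xs)
    (mcsd_step c f Ret k dt gamma) (xs, 0, Rs).
Proof.
have [Fd yJ zJ sJ] := mcsd_conclusion.
have cb i j := coupling_bound lmin_gt0 ev_bound dt_gt0 dt_lt i j.
split; [exact: mcsd_step_fixed|exact: Fd|].
have [B0 B1] := andP contraction.
pose B := Num.max (Num.sqrt gamma) (1 - dt * lmin).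
have Bb : 0 <= B < 1.
  by rewrite le_max sqrtr_ge0 gt_max B1 andbT -sqrtr1 ltr_sqrt.
have gB : gamma <= B ^+ 2.
  rewrite -{1}(sqr_sqrtr (ltW gamma_gt0)) lerXn2r ?nnegrE ?sqrtr_ge0 ?le_max ?lexx//.
  by rewrite sqrtr_ge0.
have rB i : 1 - rate k ev dt i <= B by rewrite (le_trans (rate_le i))// le_max lexx orbT.
have tB i j : 0 <= coupling k ev dt i j <= B.
  have /andP[t0 t1] := cb i j.
  by rewrite t0 (le_trans t1)// le_max lexx orbT.
exact: (momentum_spectral_radius y_lin z_lin s_lin Bb rate_pos rB tB gamma_gt0 gB separated yJ zJ sJ).
Qed.

End Mcsd.

End Charts.

Theorem proposition5p5 (R : realType) (d m k : nat)
    (f : 'rV[R]_d -> R) (c : 'I_m -> 'rV[R]_d -> R)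
    (Ret : 'rV[R]_d -> 'rV[R]_d -> 'rV[R]_d)
    (xs : 'rV[R]_d) (vs : 'M[R]_(k, d)) (delta L mu dt gamma : R)
    (f_smooth : smooth f) (c_smooth : forall i, smooth (c i))
    (c_licq : licq c) (Ret_retr : smooth_retraction c Ret)
    (k_ge1 : (1 <= k)%N) (k_le : (k <= d - m - 1)%N)
    (xs_saddle : index_saddle c f k xs)
    (delta_gt0 : 0 < delta) (mu_gt0 : 0 < mu) (mu_lt_L : mu < L)
    (hess_bounds : forall x, mfd c x -> (geodist c x xs < delta%:E)%E ->
       exists2 s, ordered_eigenvalues c x (rhess c f x) s &
         forall i : 'I_(d - m),
           ((i < k)%N -> - L <= s 0 i <= - mu) /\
           ((k <= i)%N -> mu <= s 0 i <= L))
    (vs_orthonormal : vs *m vs^T = 1%:M)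
    (vs_tangent : forall i, tangent c xs (row i vs))
    (vs_eigen : forall i, exists2 l : R, l < 0 &
       row i vs *m rhess c f xs = l *: row i vs)
    (dt_gt0 : 0 < dt) (dt_lt : dt < 1 / (2 * L))
    (gamma_gt0 : 0 < gamma) (gamma_lt1 : gamma < 1) :
  let Rs := tproj c xs - 2 *: \sum_i (row i vs)^T *m row i vs in
  (locally_contractive (csd_space c xs) (csd_chart c xs) (csd_coords c xs)
     (csd_step c f Ret k dt) (xs, Rs) /\
   asymptotically_linearly_stable (csd_space c xs) (csd_chart c xs)
     (csd_coords c xs) (csd_step c f Ret k dt) (xs, Rs)) /\
  locally_contractive (mcsd_space c xs) (mcsd_chart c xs) (mcsd_coords c xs)
    (mcsd_step c f Ret k dt gamma) (xs, 0, Rs).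
Proof.
move=> Rs.
have [xsM x_crit _] := xs_saddle.
have d_gt0 : (0 < d)%N by case: (d) k_le k_ge1 => // ; rewrite sub0n sub0n leqn0 => /eqP ->.
have km : (k <= d - m)%N by rewrite (leq_trans k_le)// leq_subr.
have [rho [K [rho0 xs_chart]]] := local_geometry c_smooth c_licq d_gt0 xsM.
have [_ _ pt_near] := xs_chart.
have xs_reg := mfd_regular c_licq xsM.
have xr : `|xs - xs| <= rho by rewrite subrr normr0 ltW.
have [V [s [sE sb]]] : exists V s, eigendecomp c xs (rhess c f xs) V s /\
    forall i : 'I_(d - m), ((i < k)%N -> - L <= s 0 i <= - mu) /\ ((k <= i)%N -> mu <= s 0 i <= L).
  have [|s [V VE] sb] := hess_bounds xs xsM; last by exists V, s.
  have [_ _ _ _ dist_le] := pt_near xs xs xsM xsM xr xr.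
  by apply: le_lt_trans dist_le _; rewrite subrr normr0 mulr0 lte_fin.
have [V_frame ev_bound RsE] := saddle_data xs_reg (c_licq xs xsM) km mu_gt0 sE sb
  vs_orthonormal vs_tangent vs_eigen.
have [_ _ HE _] := sE.
(* Near xs the Hessian has an eigenbasis, because the extrinsic distance
   controls the geodesic one. *)
have hess_sym : \forall x \near xs, mfd c x -> (rhess c f x)^T = rhess c f x.
  have e0 : 0 < Num.min rho (delta / (2 * (`|K| + 1))).
    by rewrite lt_min rho0 divr_gt0// mulr_gt0// ltr_wpDl.
  have near_x : \forall x \near xs, `|xs - x| <= Num.min rho (delta / (2 * (`|K| + 1))).
    by apply: filterS (near_ball_le (is_diff_id xs) e0) => x; rewrite distrC.
  apply: filterS near_x => x; rewrite le_min => /andP[x1 x2] xM.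
  have x1' : `|x - xs| <= rho by rewrite distrC.
  have [|s' [W [_ _ -> _]] _] := hess_bounds x xM; last first.
    by rewrite !trmx_mul trmxK tr_diag_mx mulmxA.
  have [_ _ _ _ dist_le] := pt_near x xs xM xsM x1' xr.
  apply: le_lt_trans dist_le _; rewrite lte_fin.
  have K1 : 0 < `|K| + 1 by rewrite ltr_wpDl.
  have : `|xs - x| * (`|K| + 1) <= delta / 2.
    by move: x2; rewrite invfM mulrA ler_pdivlMr.
  have := ler_norm K; have := normr_ge0 (xs - x); nra.
have dtL : dt * (2 * L) < 1 by rewrite -ltr_pdivlMr//; lra.
have contraction : 0 <= 1 - dt * mu < 1.
  have tm : 0 < dt * mu by rewrite mulr_gt0.
  by apply/andP; split; nra.
split.
  apply: (csd_contractive_stable c_smooth c_licq xsM rho0 xs_chart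
    gamma f_smooth x_crit Ret_retr km V_frame hess_sym mu_gt0 ev_bound HE RsE dt_gt0 dt_lt contraction).
apply: (mcsd_contractive c_smooth c_licq xsM rho0 xs_chart
    f_smooth x_crit Ret_retr km V_frame hess_sym mu_gt0 ev_bound HE RsE dt_gt0 dt_lt contraction gamma_gt0 gamma_lt1).
Qed.
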